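(* The Johnson solids $J25$, $J45$, $J47$, $J71$ and $J76$ are all Rupert. That is, for each of these five convex polyhedra $P\subset\mathbb{R}^3$ (defined in the context) there exist $\theta_p,\theta_q\in[0,2\pi)$, $\phi_p,\phi_q\in[0,\pi]$, $\alpha\in\mathbb{R}$ and $(u,v)\in\mathbb{R}^2$ such that $$\left(T_{u,v}\circ R_\alpha\circ M_{\theta_p,\phi_p}\right)(P)\subset \mathrm{int}\left(M_{\theta_q,\phi_q}(P)\right).$$
   Context: Informally, a convex polyhedron is Rupert if one can cut a hole in it and thread an identical copy of the polyhedron through the hole. Precisely: polyhedra are convex, compact and have nonempty interior. For $\theta,\phi\in\mathbb{R}$ let $M_{\theta,\phi}:\mathbb{R}^3\to\mathbb{R}^2$ be the linear map with matrix $$M_{\theta,\phi}=\begin{pmatrix}-\sin\theta&\cos\theta&0\\-\cos\theta\cos\phi&-\sin\theta\cos\phi&\sin\phi\end{pmatrix}$$ (orthogonal projection onto the plane orthogonal to $(\cos\theta\sin\phi,\sin\theta\sin\phi,\cos\phi)$, in an orthonormal basis of that plane). Let $R_\alpha=\begin{pmatrix}\cos\alpha&-\sin\alpha\\\sin\alpha&\cos\alpha\end{pmatrix}$ be rotation by $\alpha$ in $\mathbb{R}^2$, and $T_{u,v}(x,y)=(x+u,y+v)$. All maps act elementwise on sets, and $\mathrm{int}$ denotes interior in $\mathbb{R}^2$. A convex polyhedron $P\subset\mathbb{R}^3$ is Rupert if there are angles $\theta_p,\theta_q\in[0,2\pi)$, $\phi_p,\phi_q\in[0,\pi]$, $\alpha\in\mathbb{R}$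 and a translation $(u,v)\in\mathbb{R}^2$ with $(T_{u,v}\circ R_\alpha\circ M_{\theta_p,\phi_p})(P)\subset\mathrm{int}(M_{\theta_q,\phi_q}(P))$. This property is invariant under similarities of $\mathbb{R}^3$ applied to $P$ (including reflections), so the scale, position and chirality of $P$ do not matter. The Johnson solids are the strictly convex polyhedra with regular polygonal faces that are not Platonic solids, Archimedean solids, prisms or antiprisms; numbering is the standard one. All edges below have the same length, and ''attaching'' means gluing along congruent regular faces, with the two solids on opposite sides of the common face plane. A regular-faced $n$-gonal antiprism has two parallel regular $n$-gonal bases joined by $2n$ equilateral triangles. A square (resp. pentagonal) cupola is the polyhedron with a regular octagonal (resp. decagonal) base, a parallel square (resp. regular pentagonal) top, and lateral faces that are alternately squares and equilateral triangles. A pentagonal rotunda is half of an icosidodecahedron, cut along the plane of an equatorial regular decagon; it has a decagonal base. $J25$ (gyroelongated pentagonal rotunda): a pentagonal rotunda attached by its decagonal base to one base of a regular-faced decagonal antiprism. $J45$ (gyroelongated square bicupola): a regular-faced octagonal antiprism with a square cupola attached by its octagonal base to each of its two bases. $J47$ (gyroelongated pentagonal cupolarotunda): a regular-faced decagonal antiprism with a pentagonal cupola attached by its decagonal base to one base and a pentagonal rotunda attached by its decagonal base to the other base. ($J25$, $J45$ and $J47$ are each determined up to congruence, possibly including reflection, by these descriptions.) $J71$ (triaugmented truncated dodecahedron): a truncated dodecahedron with pentagonal cupolas attached by their decagonal bases to three decagonal faces that pairwise share no edge, each cupola being placed so that its square faces share edges with triangular faces of the truncated dodecahedron (and hence its triangular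 faces share edges with decagonal faces of the truncated dodecahedron). $J76$ (diminished rhombicosidodecahedron): a rhombicosidodecahedron with one pentagonal cupola removed; equivalently, the convex hull of all the vertices of a rhombicosidodecahedron except the five vertices of one of its pentagonal faces. *)

(* Defs.v *)
From HB Require Import structures.
From mathcomp Require Import all_boot all_order all_algebra.
From mathcomp Require Import all_classical all_reals all_analysis.

Set Implicit Arguments.
Unset Strict Implicit.
Unset Printing Implicit Defensive.

Import Order.TTheory GRing.Theory Num.Theory.
Import numFieldNormedType.Exports.

Local Open Scope classical_set_scope.
Local Open Scope ring_scope.

Section Rupert.
Variable R : realType.

Definition mx_of_rows (m n : nat) (s : seq (seq R)) : 'M[R]_(m, n) :=
  \matrix_(i < m, j < n) nth 0 (nth [::] s i) j.

(* The orthogonal projection along (cos theta sin phi, sin theta sin phi, cos phi). *)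
Definition Mproj (theta phi : R) (x : 'cV[R]_3) : 'cV[R]_2 :=
  mx_of_rows 2 3
    [:: [:: - sin theta; cos theta; 0];
        [:: - (cos theta * cos phi); - (sin theta * cos phi); sin phi]] *m x.

Definition rotation (alpha : R) (x : 'cV[R]_2) : 'cV[R]_2 :=
  mx_of_rows 2 2
    [:: [:: cos alpha; - sin alpha];
        [:: sin alpha; cos alpha]] *m x.

Definition transl (u v : R) (x : 'cV[R]_2) : 'cV[R]_2 :=
  x + mx_of_rows 2 1 [:: [:: u]; [:: v]].

Definition Rupert (P : set 'cV[R]_3) : Prop :=
  exists thetap thetaq phip phiq alpha u v : R,
    [/\ 0 <= thetap < 2 * pi, 0 <= thetaq < 2 * pi,
        0 <= phip <= pi, 0 <= phiq <= pi &
        (transl u v \o rotation alpha \o Mproj thetap phip) @` P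
          `<=` interior (Mproj thetaq phiq @` P)].

End Rupert.

Section Geometry.
Variable R : realType.
Local Notation point := 'cV[R]_3.
Implicit Types (x y w : point) (A B F P V : set point) (b p q t : nat -> point).

Definition hull A : set point := smallest (@convex_set R point) A.

Definition dot x y : R := \sum_i x i 0 * y i 0.

Definition dist x y : R := Num.sqrt (dot (x - y) (x - y)).

(* Orientation-reversing similarities are included. *)
Definition similarity (f : point -> point) : Prop :=
  exists (s : R) (O : 'M[R]_3) (c : point),
    [/\ 0 < s, O^T *m O = 1%:M & forall x, f x = c + s *: (O *m x)].

(* The vertices, in cyclic order, of a nondegenerate convex regular n-gon; the
   sequence is n-periodic, so that p i and p i.+1 are adjacent for all i. *)
Definition regular_polygon (n : nat) p : Prop :=
  exists (c u v : point) (r : R),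
    [/\ 0 < r, dot u u = 1, dot v v = 1, dot u v = 0 &
        forall i, p i = c + (r * cos (2 * pi * i%:R / n%:R)) *: u
                          + (r * sin (2 * pi * i%:R / n%:R)) *: v].

Definition polygon p : set point := hull (range p).

Definition distinct_parallel_planes p q : Prop :=
  exists (w : point) (a b : R),
    [/\ w != 0, a != b, forall i, dot w (p i) = a & forall i, dot w (q i) = b].

Definition equilateral x y z : Prop := dist x y = dist y z /\ dist y z = dist z x.

Definition square (x y z w : point) : Prop :=
  [/\ y - x = z - w, dist x y = dist y z & dot (y - x) (z - y) = 0].

Definition is_face P F : Prop :=
  exists (w : point) (a : R),
    [/\ w != 0, P `<=` [set x | dot w x <= a] & F = P `&` [set x | dot w x = a]].

(* A and B lie on opposite sides of a plane in which F is a face of both. *)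
Definition attached A B F : Prop :=
  exists (w : point) (a : R),
    [/\ w != 0,
        A `<=` [set x | dot w x <= a], F = A `&` [set x | dot w x = a],
        B `<=` [set x | a <= dot w x] & F = B `&` [set x | dot w x = a]].

(* The solid with vertices p i and q i. *)
Definition solid p q : set point := hull (range p `|` range q).

Definition antiprism (n : nat) p q : Prop :=
  [/\ regular_polygon n p, regular_polygon n q, distinct_parallel_planes p q &
      forall i, equilateral (p i) (p i.+1) (q i) /\
                equilateral (q i) (q i.+1) (p i.+1)].

(* The squares stand on the base edges from b i.*2 to b i.*2.+1. *)
Definition cupola (n : nat) b t : Prop :=
  [/\ regular_polygon n.*2 b, regular_polygon n t, distinct_parallel_planes b t &
      forall i, square (b i.*2) (b i.*2.+1) (t i.+1) (t i) /\
                equilateral (b i.*2.+1) (b i.*2.+2) (t i.+1)].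

Definition point3 (x y z : R) : point := mx_of_rows 3 1 [:: [:: x]; [:: y]; [:: z]].

(* All even permutations of (+-x, +-y, +-z), with all combinations of signs. *)
Definition even_perms (x y z : R) : set point :=
  [set p | exists (s1 s2 s3 : bool),
     let x' := (-1) ^+ s1 * x in
     let y' := (-1) ^+ s2 * y in
     let z' := (-1) ^+ s3 * z in
     [\/ p = point3 x' y' z', p = point3 y' z' x' | p = point3 z' x' y']].

Definition golden : R := (1 + Num.sqrt 5) / 2.

Definition icosidodecahedron_vertices : set point :=
  even_perms 0 0 (2 * golden) `|` even_perms 1 golden (golden ^+ 2).

Definition truncated_dodecahedron_vertices : set point :=
  even_perms 0 golden^-1 (2 + golden)
  `|` even_perms golden^-1 golden (2 * golden)
  `|` even_perms golden 2 (golden + 1).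

Definition rhombicosidodecahedron_vertices : set point :=
  even_perms 1 1 (golden ^+ 3)
  `|` even_perms (golden ^+ 2) golden (2 * golden)
  `|` even_perms (2 + golden) 0 (golden ^+ 2).

(* A is a pentagonal rotunda with base decagon b. The icosidodecahedron above is
   centred at the origin, so a plane orthogonal to w through the origin is
   equatorial. *)
Definition pentagonal_rotunda A b : Prop :=
  exists (f : point -> point) (p : nat -> point) (w : point),
    [/\ similarity f /\ w != 0,
        regular_polygon 10 p,
        forall i, icosidodecahedron_vertices (p i) /\ dot w (p i) = 0,
        A = f @` (hull icosidodecahedron_vertices `&` [set x | 0 <= dot w x]) &
        b = f \o p].

Definition truncated_dodecahedron A : Prop :=
  exists2 f, similarity f & A = f @` hull truncated_dodecahedron_vertices.

(* In J25, J45, J47 and J71 the set P is the union of the pieces, and the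
   requirement that this union be convex is part of being a Johnson solid. *)

Definition J25 P : Prop :=
  exists (A : set point) (b p q : nat -> point),
    [/\ pentagonal_rotunda A b, antiprism 10 p q,
        polygon b = polygon p, attached A (solid p q) (polygon p) &
        P = A `|` solid p q /\ convex_set P].

Definition J45 P : Prop :=
  exists p q b1 t1 b2 t2 : nat -> point,
    [/\ antiprism 8 p q,
        [/\ cupola 4 b1 t1, polygon b1 = polygon p &
            attached (solid b1 t1) (solid p q) (polygon p)],
        [/\ cupola 4 b2 t2, polygon b2 = polygon q &
            attached (solid b2 t2) (solid p q) (polygon q)] &
        P = solid p q `|` solid b1 t1 `|` solid b2 t2 /\ convex_set P].

Definition J47 P : Prop :=
  exists (p q b t : nat -> point) (A : set point) (d : nat -> point),
    [/\ antiprism 10 p q,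
        [/\ cupola 5 b t, polygon b = polygon p &
            attached (solid b t) (solid p q) (polygon p)],
        [/\ pentagonal_rotunda A d, polygon d = polygon q &
            attached A (solid p q) (polygon q)] &
        P = solid p q `|` solid b t `|` A /\ convex_set P].

Definition J71 P : Prop :=
  exists (T : set point) (b t : 'I_3 -> nat -> point),
    [/\ truncated_dodecahedron T,
        forall k, cupola 5 (b k) (t k) /\
                  attached (solid (b k) (t k)) T (polygon (b k)),
        (* the base edge of every square lies on a triangular face of T *)
        forall k i, exists z, let x := b k i.*2 in let y := b k i.*2.+1 in
                  equilateral x y z /\ is_face T (hull [set x; y; z]),
        (* edges of the three decagons, compared by their endpoints *)
        forall k l, k != l -> forall i j,
                  [set b k i; b k i.+1] <> [set b l j; b l j.+1] &
        P = T `|` \bigcup_k solid (b k) (t k) /\ convex_set P].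

Definition J76 P : Prop :=
  exists (f : point -> point) (p : nat -> point),
    let V := f @` rhombicosidodecahedron_vertices in
    [/\ similarity f, regular_polygon 5 p, is_face (hull V) (polygon p) &
        P = hull (V `\` range p)].

End Geometry.

(* Main.v *)
Require Import Defs.
From Stdlib Require Import ZArith.
From mathcomp Require Import all_boot all_order all_algebra.
From mathcomp Require Import all_classical all_reals all_analysis.
From mathcomp Require Import ssrZ zify.
From mathcomp Require Import ring lra.
From mathcomp Require Import unstable.

Set Implicit Arguments.
Unset Strict Implicit.
Unset Printing Implicit Defensive.

Import Order.TTheory GRing.Theory Num.Theory.
Import numFieldNormedType.Exports.

Local Open Scope classical_set_scope.
Local Open Scope ring_scope.
Delimit Scope Z_scope with ZZ.

(** Up to similarity each of the five solids is one of finitely many explicit convex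
    hulls, and for each of these a numerical certificate proves the Rupert property.

    A certificate consists of two views of the solid, given by integral quaternions, a
    translation, and a polygon with vertices in the outer shadow. If the vertices of
    the inner shadow lie strictly to the left of all edges of the polygon, then the
    inner shadow is contained in the interior of the outer one ([rupert_criterion]).
    Since the condition is open, the coordinates of the vertices need only be known
    approximately, and integer arithmetic on balls verifies it ([check_rupert]).

    The solids that are unions of pieces are hulls of the vertices of the pieces,
    because the unions are convex ([hull_pieces]). A regular polygon is treated as a
    solution of the linear recurrence of a rotation ([ngon]). The edge lengths
    determine the second base of an antiprism and the top of a cupola up to the side of
    the base on which they lie ([antiprism_vertices], [cupola_vertices]), and the side
    is known because pieces are glued on opposite sides of the common face
    ([attached_opposite]). What is left is the parity of the edges that carry squares.
    It gives two vertex lists for J47 and four for J45.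

    The rotunda, J71 and J76 refer to faces or equators of uniform polyhedra with
    coordinates in Z[phi]. By an enumeration of triples of vertices, every regular
    pentagonal or decagonal face of the given kind, and every equatorial decagon, is the
    image of a standard one under a signed cyclic permutation of the coordinates
    ([face_orbit], [icosidodecahedron_axis]). For J71, the condition on the squares
    fixes the parity ([decagon_triangle_edge]), and three decagons without common edges
    can be moved to one of two standard triples ([far_orbits]). *)

(** * Coordinates and scalar products *)

Definition i0 : 'I_3 := @Ordinal 3 0 isT.
Definition i1 : 'I_3 := @Ordinal 3 1 isT.
Definition i2 : 'I_3 := @Ordinal 3 2 isT.
Definition j0 : 'I_2 := @Ordinal 2 0 isT.
Definition j1 : 'I_2 := @Ordinal 2 1 isT.

Section Dot.
Variable R : realType.
Local Notation pt := 'cV[R]_3.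
Implicit Types (x y z w : pt) (a b : R).

Lemma forall_I3 (P : 'I_3 -> Prop) : P i0 -> P i1 -> P i2 -> forall i, P i.
Proof.
move=> P0 P1 P2 [[|[|[|i]]] Hi] //.
- by rewrite (_ : Ordinal Hi = i0) //; apply: val_inj.
- by rewrite (_ : Ordinal Hi = i1) //; apply: val_inj.
- by rewrite (_ : Ordinal Hi = i2) //; apply: val_inj.
Qed.

Lemma sum_I3 (V : nmodType) (F : 'I_3 -> V) : \sum_i F i = F i0 + F i1 + F i2.
Proof.
rewrite !big_ord_recl big_ord0 addr0 addrA.
by congr (F _ + F _ + F _); apply: val_inj.
Qed.

Lemma sum_I2 (V : nmodType) (F : 'I_2 -> V) : \sum_i F i = F j0 + F j1.
Proof.
rewrite !big_ord_recl big_ord0 addr0.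
by congr (F _ + F _); apply: val_inj.
Qed.

Lemma pt_eq x y : x i0 0 = y i0 0 -> x i1 0 = y i1 0 -> x i2 0 = y i2 0 -> x = y.
Proof.
by move=> h0 h1 h2; apply/matrixP => i j; rewrite ord1; move: i; apply: forall_I3.
Qed.

Lemma plane_eq (x y : 'cV[R]_2) : x j0 0 = y j0 0 -> x j1 0 = y j1 0 -> x = y.
Proof.
move=> h0 h1; apply/matrixP => i j; rewrite ord1.
case: i => [[|[|i]] Hi] //.
- by rewrite (_ : Ordinal Hi = j0) //; apply: val_inj.
- by rewrite (_ : Ordinal Hi = j1) //; apply: val_inj.
Qed.

Lemma dotE x y : dot x y = x i0 0 * y i0 0 + x i1 0 * y i1 0 + x i2 0 * y i2 0.
Proof. by rewrite /dot sum_I3. Qed.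

Lemma dotC x y : dot x y = dot y x.
Proof. by rewrite !dotE; ring. Qed.

Lemma dotDl x y z : dot (x + y) z = dot x z + dot y z.
Proof. by rewrite !dotE !mxE; ring. Qed.

Lemma dotNl x z : dot (- x) z = - dot x z.
Proof. by rewrite !dotE !mxE; ring. Qed.

Lemma dotZl a x z : dot (a *: x) z = a * dot x z.
Proof. by rewrite !dotE !mxE; ring. Qed.

Lemma dotDr x y z : dot z (x + y) = dot z x + dot z y.
Proof. by rewrite !(dotC z) dotDl. Qed.

Lemma dotNr x z : dot z (- x) = - dot z x.
Proof. by rewrite !(dotC z) dotNl. Qed.

Lemma dotZr a x z : dot z (a *: x) = a * dot z x.
Proof. by rewrite !(dotC z) dotZl. Qed.

Lemma dot0l x : dot 0 x = 0.
Proof. by rewrite dotE !mxE; ring. Qed.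

Lemma dot0r x : dot x 0 = 0.
Proof. by rewrite dotC dot0l. Qed.

Definition dotL := (dotDl, dotDr, dotNl, dotNr, dotZl, dotZr, dot0l, dot0r).

Lemma dot_ge0 x : 0 <= dot x x.
Proof. by rewrite dotE !addr_ge0 // -expr2 sqr_ge0. Qed.

Lemma dot_eq0 x : (dot x x == 0) = (x == 0).
Proof.
apply/idP/idP => [|/eqP->]; last by rewrite dot0l.
rewrite dotE => /eqP h; apply/eqP.
have := (sqr_ge0 (x i0 0), sqr_ge0 (x i1 0), sqr_ge0 (x i2 0)).
rewrite !expr2 => -[[h0 h1] h2].
by apply: pt_eq; rewrite !mxE; apply/eqP; rewrite -sqrf_eq0 expr2; apply/eqP; lra.
Qed.

Lemma dot_gt0 x : (0 < dot x x) = (x != 0).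
Proof. by rewrite lt_neqAle dot_ge0 andbT eq_sym dot_eq0. Qed.

Lemma dist_eq x y z w : dist x y = dist z w -> dot (x - y) (x - y) = dot (z - w) (z - w).
Proof. by move=> h; rewrite -[LHS]sqr_sqrtr ?dot_ge0 // -[RHS]sqr_sqrtr ?dot_ge0 //; congr (_ ^+ 2). Qed.

(** The first hypothesis is the linear independence of x and y, so the vectors
    orthogonal to both form a line. *)
Lemma normals_collinear x y w e :
  dot x x * dot y y - dot x y ^+ 2 != 0 -> w != 0 ->
  dot w x = 0 -> dot w y = 0 -> dot e x = 0 -> dot e y = 0 ->
  e = (dot e w / dot w w) *: w.
Proof.
move=> hxy w0 wx wy ex ey.
have ww0 : dot w w != 0 by rewrite dot_eq0.
pose v := dot w w *: e - dot e w *: w.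
have vx : dot x v = 0 by rewrite /v dotC !dotL ex wx; ring.
have vy : dot y v = 0 by rewrite /v dotC !dotL ey wy; ring.
have vw : dot w v = 0 by rewrite /v dotC !dotL; ring.
pose det := x i0 0 * (y i1 0 * w i2 0 - y i2 0 * w i1 0)
  - x i1 0 * (y i0 0 * w i2 0 - y i2 0 * w i0 0)
  + x i2 0 * (y i0 0 * w i1 0 - y i1 0 * w i0 0).
have det0 : det != 0.
  rewrite -sqrf_eq0 (_ : det ^+ 2 = (dot x x * dot y y - dot x y ^+ 2) * dot w w
     - dot w x * (dot w x * dot y y - dot w y * dot x y)
     + dot w y * (dot w x * dot x y - dot w y * dot x x)); last first.
    by rewrite /det !dotE; ring.
  by rewrite wx wy !(mul0r, mulr0, subr0, addr0) mulf_eq0 negb_or hxy.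
suff v0 : v = 0.
  have : dot w w *: e = dot e w *: w by apply/eqP; rewrite -subr_eq0 -/v v0.
  move/(congr1 (fun u => (dot w w)^-1 *: u)).
  by rewrite !scalerA mulVf // scale1r mulrC.
by apply: pt_eq; rewrite [RHS]mxE; apply: (mulfI det0); rewrite mulr0;
   [ rewrite (_ : det * _ = (y i1 0 * w i2 0 - y i2 0 * w i1 0) * dot x v
       - (x i1 0 * w i2 0 - x i2 0 * w i1 0) * dot y v
       + (x i1 0 * y i2 0 - x i2 0 * y i1 0) * dot w v)
   | rewrite (_ : det * _ = - (y i0 0 * w i2 0 - y i2 0 * w i0 0) * dot x v
       + (x i0 0 * w i2 0 - x i2 0 * w i0 0) * dot y v
       - (x i0 0 * y i2 0 - x i2 0 * y i0 0) * dot w v)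
   | rewrite (_ : det * _ = (y i0 0 * w i1 0 - y i1 0 * w i0 0) * dot x v
       - (x i0 0 * w i1 0 - x i1 0 * w i0 0) * dot y v
       + (x i0 0 * y i1 0 - x i1 0 * y i0 0) * dot w v)];
   [rewrite vx vy vw; ring | rewrite /det !dotE; ring
   |rewrite vx vy vw; ring | rewrite /det !dotE; ring
   |rewrite vx vy vw; ring | rewrite /det !dotE; ring].
Qed.

End Dot.

(** * Convex hulls *)

Section Hull.
Variable R : realType.

(** The same notion of hull is needed in the plane, for shadows. *)
Definition chull (V : lmodType R) (A : set V) : set V := smallest (@convex_set R V) A.

(** Convexity with explicit weights, kept as a record so that proofs of it can
    be passed around without being applied. *)
Record convex (V : lmodType R) (A : set V) : Prop := Convex {
  convex_comb : forall x y (a b : R), 0 <= a -> 0 <= b -> a + b = 1 ->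
    A x -> A y -> A (a *: x + b *: y) }.

Lemma convexP (V : lmodType R) (A : set V) : @convex_set R V A <-> convex A.
Proof.
split=> [cA|[h]].
  split=> x y a b a0 b0 ab Ax Ay.
  have a1 : a <= 1 by rewrite -ab lerDl.
  have := cA x y (Itv01 a0 a1); rewrite !inE => /(_ Ax Ay).
  rewrite /conv /= /onem.
  by rewrite (_ : 1 - a = b) //; lra.
move=> x y l; rewrite !inE => Ax Ay.
apply: h => //=.
- by rewrite onem_ge0 //; exact: le1.
- by rewrite add_onemK.
Qed.

End Hull.

Section HullTheory.
Variable R : realType.

Section Generic.
Variable V : lmodType R.
Implicit Types A B K : set V.

Lemma chull_convex A : convex (chull A).
Proof.
split=> x y a b a0 b0 ab Ax Ay K [cK AK].
by apply: (convex_comb ((convexP K).1 cK)) => //; [apply: Ax|apply: Ay].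
Qed.

Lemma sub_chull A : A `<=` chull A.
Proof. exact: sub_smallest. Qed.

Lemma chull_min A K : convex K -> A `<=` K -> chull A `<=` K.
Proof. by move=> cK AK; apply: smallest_sub => //; apply/convexP. Qed.

Lemma chull_sub A B : A `<=` B -> chull A `<=` chull B.
Proof.
by move=> AB; apply: chull_min; [exact: chull_convex|move=> x /AB; exact: sub_chull].
Qed.

(** How convexity of a union of pieces is used: only the vertices matter. *)
Lemma hull_pieces A K : @convex_set R V K -> A `<=` K -> K `<=` chull A -> K = chull A.
Proof. by move=> /convexP cK AK KA; apply/seteqP; split=> //; apply: chull_min. Qed.

End Generic.

Definition affine (V W : lmodType R) (f : V -> W) :=
  forall x y a b, a + b = 1 -> f (a *: x + b *: y) = a *: f x + b *: f y.

Lemma preimage_convex (V W : lmodType R) (f : V -> W) (K : set W) :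
  affine f -> convex K -> convex (f @^-1` K).
Proof.
move=> af cK; split=> x y a b a0 b0 ab Kx Ky.
by rewrite /preimage /= af //; apply: convex_comb cK _ _ _ _ _ _ _ _ _.
Qed.

Lemma image_convex (V W : lmodType R) (f : V -> W) (K : set V) :
  affine f -> convex K -> convex (f @` K).
Proof.
move=> af cK; split=> _ _ a b a0 b0 ab [x Kx <-] [y Ky <-].
by exists (a *: x + b *: y); [apply: convex_comb cK _ _ _ _ _ _ _ _ _ | rewrite af].
Qed.

Lemma image_chull (V W : lmodType R) (f : V -> W) (A : set V) :
  affine f -> f @` chull A = chull (f @` A).
Proof.
move=> af; apply/seteqP; split.
  move=> _ [x Ax <-]; move: x Ax.
  apply: (@chull_min _ A (f @^-1` chull (f @` A))) => [|x Ax].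
    exact: preimage_convex af (chull_convex _).
  by apply: sub_chull; exists x.
apply: chull_min; first exact: image_convex af (chull_convex _).
by move=> _ [x Ax <-]; exists x => //; apply: sub_chull.
Qed.

Local Notation pt := 'cV[R]_3.
Implicit Types (x y w c : pt) (S K Q : set pt).

Lemma hullE S : hull S = chull S. Proof. by []. Qed.

Lemma halfspace_convex w a : convex [set x | dot w x <= a].
Proof.
split=> x y s t s0 t0 st /= hx hy; rewrite !dotL.
have -> : a = s * a + t * a by rewrite -mulrDl st mul1r.
by apply: lerD; apply: ler_wpM2l.
Qed.

Lemma ball_convex c r : convex [set x | dot (x - c) (x - c) <= r].
Proof.
split=> x y s t s0 t0 st /= hx hy.
have ht : t = 1 - s by lra.
have -> : s *: x + t *: y - c = s *: (x - c) + t *: (y - c).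
  by apply: pt_eq; rewrite !mxE ht; ring.
move: (x - c) (y - c) hx hy => u v hu hv.
have := dot_ge0 (u - v); rewrite !dotL (dotC v u) => h.
have h2 := mulr_ge0 (mulr_ge0 s0 t0) h; rewrite ht in t0 h2 *.
have h3 := ler_wpM2l s0 hu; have h4 := ler_wpM2l t0 hv.
nra.
Qed.

(** By strict convexity, a ball has no boundary point that is a proper convex
    combination, so a hull inside the ball meets the sphere only in the
    generating points. *)
Lemma hull_sphere S c r x : (forall y, S y -> dot (y - c) (y - c) <= r) ->
  hull S x -> dot (x - c) (x - c) = r -> S x.
Proof.
move=> Sr; pose K := [set y | dot (y - c) (y - c) <= r /\ (dot (y - c) (y - c) = r -> S y)].
suff cK : convex K.
  have /chull_min : S `<=` K by move=> y Sy; split=> //; exact: Sr.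
  by move=> /(_ cK) SK /SK [_ h] /h.
split=> y z s t s0 t0 st [yr Sy] [zr Sz]; split.
  exact: convex_comb (ball_convex c r) _ _ _ _ s0 t0 st yr zr.
have ht : t = 1 - s by lra.
have [yz|yz] := eqVneq y z.
  by rewrite yz -scalerDl st scale1r.
have E : s *: y + t *: z - c = s *: (y - c) + t *: (z - c).
  by apply: pt_eq; rewrite !mxE ht; ring.
have [s00|s00] := eqVneq s 0.
  by rewrite ht s00 scale0r add0r subr0 scale1r.
have [t00|t00] := eqVneq t 0.
  by rewrite (_ : s = 1) ?t00 ?scale1r ?scale0r ?addr0 //; lra.
rewrite E.
have : 0 < dot ((y - c) - (z - c)) ((y - c) - (z - c)).
  by rewrite dot_gt0 opprD opprK addrACA addNr addr0 subr_eq0.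
move: (y - c) (z - c) yr zr => u v hu hv.
rewrite !dotL (dotC v u) => h1 h.
have st0 : 0 < s * t by rewrite mulr_gt0 // lt_neqAle eq_sym ?s00 ?t00.
have h2 := mulr_gt0 st0 h1.
have h3 := ler_wpM2l s0 hu; have h4 := ler_wpM2l t0 hv.
by exfalso; rewrite ht in h h2 h4; nra.
Qed.

(** Likewise a supporting plane meets a hull in the hull of the generators that
    lie on it. *)
Lemma hull_face S w a : (forall y, S y -> dot w y <= a) ->
  hull S `&` [set x | dot w x = a] = hull (S `&` [set x | dot w x = a]).
Proof.
move=> Sa; apply/seteqP; split.
  pose K := [set y | dot w y <= a /\ (dot w y = a -> hull (S `&` [set x | dot w x = a]) y)].
  suff cK : convex K.
    have /chull_min : S `<=` K.
      by move=> y Sy; split=> [|ya]; [exact: Sa|apply: sub_chull].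
    by move=> /(_ cK) SK x [/SK [_ h]] /h.
  split=> y z s t s0 t0 st [ya Hy] [za Hz]; split.
    exact: convex_comb (halfspace_convex w a) _ _ _ _ s0 t0 st ya za.
  rewrite !dotL => h.
  have ht : t = 1 - s by lra.
  have [s00|s00] := eqVneq s 0.
    by move: h Hz; rewrite ht s00 scale0r add0r subr0 scale1r mul0r add0r mul1r => h; apply.
  have [t00|t00] := eqVneq t 0.
    move: h Hy; rewrite (_ : s = 1) ?t00 ?scale1r ?scale0r ?addr0 ?mul0r ?addr0 ?mul1r; last by lra.
    by move=> h; apply.
  have {}s00 : 0 < s by rewrite lt_neqAle eq_sym s00.
  have {}t00 : 0 < t by rewrite lt_neqAle eq_sym t00.
  have ey : dot w y = a.
    by apply/eqP; rewrite eq_le ya /= -(ler_pM2l s00); have := ler_wpM2l t0 za; nra.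
  have ez : dot w z = a.
    by apply/eqP; rewrite eq_le za /= -(ler_pM2l t00); have := ler_wpM2l s0 ya; nra.
  exact: convex_comb (chull_convex _) _ _ _ _ s0 t0 st (Hy ey) (Hz ez).
move=> x hx; split; first by apply: chull_sub hx => y [].
apply: chull_min hx; last by move=> y [].
split=> y z s t s0 t0 st /= hy hz.
by rewrite !dotL hy hz -mulrDl st mul1r.
Qed.

Lemma sphere_hull_inj S Q c r c' r' :
  (forall y, S y -> dot (y - c) (y - c) = r) -> (forall y, Q y -> dot (y - c') (y - c') = r') ->
  hull S = hull Q -> S = Q.
Proof.
have sub (A B : set pt) o s : (forall y, A y -> dot (y - o) (y - o) = s) -> hull A = hull B -> A `<=` B.
  move=> As AB x Ax; apply: (@hull_sphere B o s x _ _ (As _ Ax)).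
    move=> y By; have : hull A y by rewrite AB; apply: sub_chull.
    by apply: (@chull_min _ A [set z | dot (z - o) (z - o) <= s]) => [|z /As /= ->];
      [exact: ball_convex|exact: lexx].
  by rewrite -AB; apply: sub_chull.
by move=> Sr Qr SQ; apply/seteqP; split; [apply: sub Sr SQ|apply: sub Qr (esym SQ)].
Qed.

End HullTheory.

(** * Projections and a criterion for the Rupert property *)

Section Polygon.
Variable R : realType.
Local Notation plane := 'cV[R]_2.
Implicit Types (u v w y : plane).

Definition det2 u v : R := u j0 0 * v j1 0 - u j1 0 * v j0 0.

Definition edges (T : Type) (W : seq T) : seq (T * T) := zip W (rot 1 W).

Lemma edges_map (T T' : Type) (g : T -> T') (W : seq T) :
  edges (map g W) = [seq (g e.1, g e.2) | e <- edges W].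
Proof.
rewrite /edges -map_rot; move: (rot 1 W) => W'.
by elim: W W' => [|w W IH] [|w' W'] //=; rewrite IH.
Qed.

(** A convex polygon without its boundary, when W lists its vertices
    counterclockwise. *)
Definition inside (W : seq plane) : set plane :=
  [set y | forall e, e \in edges W -> 0 < det2 (e.2 - e.1) (y - e.1)].

Lemma open_inside W : open (inside W).
Proof.
rewrite /inside; elim: (edges W) => [|e E IH].
  by rewrite (_ : mkset _ = setT); [exact: openT|apply/seteqP; split].
rewrite (_ : mkset _ = [set y | 0 < det2 (e.2 - e.1) (y - e.1)] `&`
   [set y | forall e, e \in E -> 0 < det2 (e.2 - e.1) (y - e.1)]).
  apply: openI => //.
  have -> : [set y | 0 < det2 (e.2 - e.1) (y - e.1)] =
      (fun y : plane => (e.2 - e.1) j0 0 * (y j1 0 - e.1 j1 0)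
            - (e.2 - e.1) j1 0 * (y j0 0 - e.1 j0 0)) @^-1` [set x | 0 < x].
    by apply/seteqP; split=> y; rewrite /preimage /= /det2 !mxE.
  apply: open_comp; last exact: open_gt.
  have cc (i : 'I_2) (k c : R) (y : plane) : (fun y : plane => k * (y i 0 - c)) @ y --> k * (y i 0 - c).
    by apply: (cvgMr (cvgB (@coord_continuous _ _ _ i 0 y) (cvg_cst c))).
  by move=> y _; apply: (cvgB (cc _ _ _ _) (cc _ _ _ _)).
apply/seteqP; split=> y /= h.
  split=> [|f fE]; apply: h; first exact: mem_head.
  by rewrite inE fE orbT.
by case: h => he hE f; rewrite inE => /predU1P[->|/hE].
Qed.

(** Seen from the first vertex, a point to the left of all edges lies in the
    triangle spanned by that vertex and the first edge at which the point
    passes from the left to the right of the line of sight. *)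
Lemma inside_chull W : W != [::] -> inside W `<=` chull [set` W].
Proof.
case: W => // o W _ y; rewrite /inside /edges rot1_cons /=.
have tri a b : 0 < det2 (a - o) (y - o) -> det2 (b - o) (y - o) <= 0 ->
    0 < det2 (b - a) (y - a) -> forall A, A o -> A a -> A b -> convex A -> A y.
  move=> ha hb hab A Ao Aa Ab cA.
  pose D := det2 (b - a) (y - a) - det2 (b - o) (y - o) + det2 (a - o) (y - o).
  have D0 : 0 < D by rewrite /D; lra.
  pose al := det2 (b - a) (y - a) / D.
  pose be := - det2 (b - o) (y - o) / D.
  pose ga := det2 (a - o) (y - o) / D.
  have al0 : 0 < al by rewrite divr_gt0.
  have be0 : 0 <= be by rewrite divr_ge0 ?oppr_ge0 // ltW.
  have ga0 : 0 < ga by rewrite divr_gt0.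
  have sum1 : al + be + ga = 1.
    by rewrite /al /be /ga -!mulrDl; apply: divff; rewrite gt_eqF.
  have ab0 : al + be != 0 by rewrite gt_eqF //; lra.
  have -> : y = (al + be) *: ((al / (al + be)) *: o + (be / (al + be)) *: a) + ga *: b.
    rewrite scalerDr !scalerA !(mulrC (al + be)) !divfK //.
    have Dn : D != 0 by rewrite gt_eqF.
    have key (y' o' a' b' : R) : D * y' = det2 (b - a) (y - a) * o'
        - det2 (b - o) (y - o) * a' + det2 (a - o) (y - o) * b' ->
        y' = al * o' + be * a' + ga * b'.
      move=> h; rewrite -[y'](mulKf Dn) h /al /be /ga; ring.
    by apply: plane_eq; rewrite [RHS]mxE [X in X + _]mxE !mxE; apply: key; rewrite /D /det2 !mxE; ring.
  apply: (convex_comb cA) => //; [lra|lra|].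
  apply: (convex_comb cA) => //; last by rewrite -mulrDl divff.
    by apply: divr_ge0; lra.
  by apply: divr_ge0; lra.
case: W => [|a W] h.
  by have := h (o, o) (mem_head _ _); rewrite /= subrr /det2 !mxE; lra.
have ha : 0 < det2 (a - o) (y - o) by apply: (h (o, a)); exact: mem_head.
have hW : forall e, e \in zip (a :: W) (rcons W o) -> 0 < det2 (e.2 - e.1) (y - e.1).
  by move=> e eW; apply: h; rewrite /= inE eW orbT.
have : [set` (a :: W)] `<=` [set` [:: o, a & W]].
  by move=> x /= xW; rewrite in_cons xW orbT.
have oA : [set` [:: o, a & W]] o by exact: mem_head.
move: [set` [:: o, a & W]] oA => A oA; clear h.
elim: W a ha hW => [|b W IH] a ha hW WA.
  have := hW (a, o) (mem_head _ _).
  by move: ha; rewrite /= /det2 !mxE => h1 h2; exfalso; lra.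
have [hb|hb] := lerP (det2 (b - o) (y - o)) 0.
  apply: (tri a b) => //.
  - by apply: (hW (a, b)); exact: mem_head.
  - exact: sub_chull.
  - by apply: sub_chull; apply: WA; exact: mem_head.
  - by apply: sub_chull; apply: WA; rewrite /= !inE eqxx orbT.
  - exact: chull_convex.
apply: (IH b) => //.
  by move=> e eW; apply: hW; rewrite /= inE eW orbT.
by move=> x xW; apply: WA; rewrite /= inE xW orbT.
Qed.

Lemma inside_interior W (K : set plane) : W != [::] -> convex K ->
  [set` W] `<=` K -> inside W `<=` interior K.
Proof.
move=> W0 cK WK; rewrite -open_subsetE; last exact: open_inside.
exact: subset_trans (inside_chull W0) (chull_min cK WK).
Qed.

End Polygon.

Section Frames.
Variable R : realType.
Local Notation pt := 'cV[R]_3.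
Local Notation plane := 'cV[R]_2.
Implicit Types (a b x : pt).

Lemma rotationE (al : R) (x : plane) :
  ((rotation al x) j0 0 = cos al * x j0 0 - sin al * x j1 0) *
  ((rotation al x) j1 0 = sin al * x j0 0 + cos al * x j1 0).
Proof. by rewrite !mxE !sum_I2 !mxE /=; split; ring. Qed.

Lemma MprojE (th ph : R) (x : pt) :
  ((Mproj th ph x) j0 0 = - sin th * x i0 0 + cos th * x i1 0) *
  ((Mproj th ph x) j1 0 = - (cos th * cos ph) * x i0 0 - (sin th * cos ph) * x i1 0 + sin ph * x i2 0).
Proof. by rewrite !mxE !sum_I3 !mxE /=; split; ring. Qed.

Definition proj a b (x : pt) : plane :=
  \col_(i < 2) if i == j0 then dot a x else dot b x.

Lemma projE a b x : (proj a b x j0 0 = dot a x) * (proj a b x j1 0 = dot b x).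
Proof. by rewrite !mxE. Qed.

(** The arc cosine gives the angle up to its sign, which that of s decides. *)
Lemma angle_of_unit (c s : R) : c ^+ 2 + s ^+ 2 = 1 ->
  exists2 t, 0 <= t < 2 * pi & cos t = c /\ sin t = s.
Proof.
move=> cs.
have c1 : -1 <= c <= 1.
  by rewrite -ler_norml -(@ler_pXn2r _ 2) ?nnegrE // expr1n -normrX ger0_norm ?sqr_ge0 // -cs lerDl sqr_ge0.
have sinE : sin (acos c) = `|s|.
  by rewrite sin_acos // -cs [c ^+ 2 + _]addrC addrK sqrtr_sqr.
have p0 : 0 < pi :> R by exact: pi_gt0.
have a0 := acos_ge0 c1; have api := acos_lepi c1.
have [s0|s0] := lerP 0 s.
  exists (acos c); first by apply/andP; split; lra.
  by rewrite acosK ?in_itv // sinE ger0_norm.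
exists (2 * pi - acos c).
  have : acos c != 0.
    apply/eqP => h; move: sinE; rewrite h sin0 => /esym/eqP.
    by rewrite normr_eq0 => /eqP h0; move: s0; rewrite h0 ltxx.
  by move=> h; have : 0 < acos c by [rewrite lt_neqAle eq_sym h]; move=> ?; apply/andP; split; lra.
have E : 2 * pi - acos c = - acos c + pi *+ 2 by rewrite mulr2n; ring.
rewrite E cosD2pi sinD2pi cosN sinN sinE acosK ?in_itv // ltr0_norm ?opprK //.
Qed.

(** A pair of orthonormal vectors becomes the pair of rows of some Mproj after a
    rotation of their plane: the angles are the spherical coordinates of the
    cross product. *)
Lemma frame_angles a b : dot a a = 1 -> dot b b = 1 -> dot a b = 0 ->
  exists th ph al : R, [/\ 0 <= th < 2 * pi, 0 <= ph <= pi &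
    forall x, proj a b x = rotation al (Mproj th ph x)].
Proof.
move=> aa bb ab.
pose n0 := a i1 0 * b i2 0 - a i2 0 * b i1 0.
pose n1 := a i2 0 * b i0 0 - a i0 0 * b i2 0.
pose n2 := a i0 0 * b i1 0 - a i1 0 * b i0 0.
have nn : n0 ^+ 2 + n1 ^+ 2 + n2 ^+ 2 = 1.
  have -> : n0 ^+ 2 + n1 ^+ 2 + n2 ^+ 2 = dot a a * dot b b - dot a b ^+ 2.
    by rewrite !dotE /n0 /n1 /n2; ring.
  by rewrite aa bb ab; ring.
have n21 : -1 <= n2 <= 1.
  rewrite -ler_norml -(@ler_pXn2r _ 2) ?nnegrE // expr1n -normrX ger0_norm ?sqr_ge0 // -nn.
  by rewrite lerDr addr_ge0 ?sqr_ge0.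
pose ph := acos n2.
have cph : cos ph = n2 by rewrite acosK ?in_itv.
have ph0 := acos_ge0 n21; have phpi := acos_lepi n21.
have sph2 : sin ph ^+ 2 = n0 ^+ 2 + n1 ^+ 2.
  by have := cos2Dsin2 ph; rewrite cph -nn; lra.
have [th thr [nth0 nth1]] : exists2 th, 0 <= th < 2 * pi &
    n0 = sin ph * cos th /\ n1 = sin ph * sin th.
  have [s0|s0] := eqVneq (sin ph) 0.
    exists 0; first by rewrite lexx mulr_gt0 // pi_gt0.
    have /eqP : n0 ^+ 2 + n1 ^+ 2 = 0 by rewrite -sph2 s0 expr0n.
    by rewrite paddr_eq0 ?sqr_ge0 // !sqrf_eq0 s0 !mul0r => /andP[/eqP-> /eqP->].
  have /angle_of_unit[th thr [hc hs]] : (n0 / sin ph) ^+ 2 + (n1 / sin ph) ^+ 2 = 1.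
    by rewrite !exprMn -mulrDl -sph2 exprVn divff // expf_neq0.
  by exists th => //; rewrite hc hs !(mulrC (sin ph)) !divfK.
have cs := cos2Dsin2 th.
pose m1 : pt := point3 (- sin th) (cos th) 0.
pose m2 : pt := point3 (- (cos th * n2)) (- (sin th * n2)) (sin ph).
have M1 x : dot m1 x = Mproj th ph x j0 0.
  by rewrite dotE MprojE !mxE /=; ring.
have M2 x : dot m2 x = Mproj th ph x j1 0.
  by rewrite dotE MprojE cph !mxE /=; ring.
have m11 : dot m1 m1 = 1 by rewrite dotE !mxE /=; lra.
have sc : sin ph ^+ 2 + n2 ^+ 2 = 1 by rewrite sph2.
have m22 : dot m2 m2 = 1.
  rewrite dotE !mxE /= (_ : _ + _ = (cos th ^+ 2 + sin th ^+ 2) * n2 ^+ 2 + sin ph ^+ 2); last by ring.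
  by rewrite cs mul1r addrC.
have m12 : dot m1 m2 = 0 by rewrite dotE !mxE /=; ring.
pose n : pt := point3 n0 n1 n2.
have nm1 : dot n m1 = 0 by rewrite dotE !mxE /= nth0 nth1; ring.
have nm2 : dot n m2 = 0.
  rewrite dotE !mxE /= nth0 nth1.
  rewrite (_ : _ + _ = sin ph * n2 * (1 - (cos th ^+ 2 + sin th ^+ 2))); last by ring.
  by rewrite cs subrr mulr0.
have n_n : dot n n = 1 by rewrite dotE !mxE /= -!expr2.
have nz : n != 0 by rewrite -dot_eq0 n_n oner_neq0.
have expand (y : pt) : dot y n = 0 -> y = dot y m1 *: m1 + dot y m2 *: m2.
  move=> yn; apply/eqP; rewrite -subr_eq0; apply/eqP.
  rewrite [LHS](@normals_collinear _ m1 m2 n) // ?m11 ?m22 ?m12 ?expr0n /= ?subr0 ?mulr1 ?oner_neq0 //.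
  - by rewrite !dotL yn !(dotC _ n) nm1 nm2 !(mulr0, mul0r, oppr0, addr0, subr0) scale0r.
  - by rewrite !dotL m11 (dotC m2) m12; ring.
  - by rewrite !dotL m22 m12; ring.
have an : dot a n = 0 by rewrite dotE !mxE /= /n0 /n1 /n2; ring.
have bn : dot b n = 0 by rewrite dotE !mxE /= /n0 /n1 /n2; ring.
(* m2 is the cross product of n and m1, and n that of a and b *)
have m20 : m2 i0 0 = n1 * m1 i2 0 - n2 * m1 i1 0 by rewrite !mxE /=; ring.
have m21 : m2 i1 0 = n2 * m1 i0 0 - n0 * m1 i2 0 by rewrite !mxE /=; ring.
have m2_2 : m2 i2 0 = n0 * m1 i1 0 - n1 * m1 i0 0.
  rewrite !mxE /= nth0 nth1.
  rewrite (_ : _ - _ = sin ph * (cos th ^+ 2 + sin th ^+ 2)); last by ring.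
  by rewrite cs mulr1.
have am2 : dot a m2 = - dot b m1.
  transitivity (dot a b * dot a m1 - dot a a * dot b m1); last by rewrite aa ab; ring.
  by rewrite [LHS]dotE m20 m21 m2_2 !dotE /n0 /n1 /n2; ring.
have bm2 : dot b m2 = dot a m1.
  transitivity (dot b b * dot a m1 - dot a b * dot b m1); last by rewrite bb ab; ring.
  by rewrite [LHS]dotE m20 m21 m2_2 !dotE /n0 /n1 /n2; ring.
have [al _ [hc hs]] : exists2 al, 0 <= al < 2 * pi & cos al = dot a m1 /\ sin al = dot b m1.
  apply: angle_of_unit; have := aa; rewrite {1}(expand a an) am2.
  by rewrite !dotL (dotC m1 a) (dotC m2 a) am2; nra.
exists th, ph, al; split=> //; first by rewrite ph0.
move=> x; apply: plane_eq; rewrite projE rotationE hc hs -M1 -M2.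
  by rewrite {1}(expand a an) am2 !dotL; ring.
by rewrite {1}(expand b bn) bm2 !dotL; ring.
Qed.

Lemma det2_rotation (al : R) (u v : plane) :
  det2 (rotation al u) (rotation al v) = det2 u v.
Proof.
rewrite /det2 !rotationE.
transitivity ((cos al ^+ 2 + sin al ^+ 2) * (u j0 0 * v j1 0 - u j1 0 * v j0 0)).
  by ring.
by rewrite cos2Dsin2 mul1r.
Qed.

Lemma projD a b x y : proj a b (x + y) = proj a b x + proj a b y.
Proof. by apply: plane_eq; rewrite [RHS]mxE !projE dotDr. Qed.

Lemma projZ a b k x : proj a b (k *: x) = k *: proj a b x.
Proof. by apply: plane_eq; rewrite [RHS]mxE !projE dotZr. Qed.

Lemma rotationD al (u v : plane) : rotation al (u + v) = rotation al u + rotation al v.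
Proof. by rewrite /rotation mulmxDr. Qed.

Lemma rotationZ al k (u : plane) : rotation al (k *: u) = k *: rotation al u.
Proof. by rewrite /rotation -scalemxAr. Qed.

Lemma rotation_comp al be (u : plane) : rotation al (rotation be u) = rotation (al + be) u.
Proof. by apply: plane_eq; rewrite !rotationE cosD sinD; ring. Qed.

Lemma rotation0 (u : plane) : rotation 0 u = u.
Proof. by apply: plane_eq; rewrite !rotationE cos0 sin0; ring. Qed.

Lemma similarity_affine (f : pt -> pt) : similarity f -> affine f.
Proof.
move=> [s [U [c [_ _ fE]]]] x y a b ab; rewrite !fE mulmxDr -!scalemxAr.
by rewrite (_ : a = 1 - b); [apply: pt_eq; rewrite !mxE; ring|lra].
Qed.

Lemma dot_orthogonal (O : 'M[R]_3) x y : O^T *m O = 1%:M -> dot (O *m x) (O *m y) = dot x y.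
Proof.
have dotM (u v : pt) : dot u v = (u^T *m v) 0 0.
  by rewrite mxE; apply: eq_bigr => i _; rewrite mxE.
by move=> OO; rewrite !dotM trmx_mul -mulmxA (mulmxA O^T) OO mul1mx.
Qed.

(** The hypothesis on the vertices says that their inner shadow is inside a polygon
    spanned by outer shadows. It passes to their hull, since lying to the left of a
    line is a convex condition, and the inside of the polygon is an open part of the
    outer shadow. The pairs a1, a2 and b1, b2 are frames of the two planes of
    projection, scaled by the same factor; the similarity f is absorbed in the
    frames and in the translation. *)
Lemma rupert_criterion (f : pt -> pt) (vs ws : seq pt) (a1 a2 b1 b2 : pt) (s : R) (t : plane) :
  similarity f -> 0 < s ->
  dot a1 a1 = s -> dot a2 a2 = s -> dot a1 a2 = 0 ->
  dot b1 b1 = s -> dot b2 b2 = s -> dot b1 b2 = 0 ->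
  ws != [::] -> {subset ws <= vs} ->
  (forall v e, v \in vs -> e \in edges ws ->
     0 < det2 (proj b1 b2 e.2 - proj b1 b2 e.1) (proj a1 a2 v + t - proj b1 b2 e.1)) ->
  Rupert (f @` hull [set` vs]).
Proof.
move=> simf s0 a11 a22 a12 b11 b22 b12 ws0 wv H.
have [k [U [c [k0 UU fE]]]] := simf.
pose r := Num.sqrt s.
have r0 : 0 < r by rewrite sqrtr_gt0.
have rr : r * r = s by rewrite -expr2 sqr_sqrtr // ltW.
have rn0 : r != 0 by rewrite gt_eqF.
pose tr (a : pt) : pt := r^-1 *: (U *m a).
have dtr a b : dot (tr a) (tr b) = dot a b / s.
  by rewrite /tr !dotL dot_orthogonal // -rr invfM; ring.
have dtf a x : dot (tr a) (f x) = dot (tr a) c + k / r * dot a x.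
  by rewrite fE /tr !dotL dot_orthogonal //; ring.
have ss : s / s = 1 by rewrite divff // gt_eqF.
have [thp [php [alp [thp_r php_r Ap]]]] := @frame_angles (tr a1) (tr a2) ltac:(by rewrite dtr a11)
  ltac:(by rewrite dtr a22) ltac:(by rewrite dtr a12 mul0r).
have [thq [phq [alq [thq_r phq_r Bq]]]] := @frame_angles (tr b1) (tr b2) ltac:(by rewrite dtr b11)
  ltac:(by rewrite dtr b22) ltac:(by rewrite dtr b12 mul0r).
have projf a b x : proj (tr a) (tr b) (f x) = proj (tr a) (tr b) c + (k / r) *: proj a b x.
  by apply: plane_eq; rewrite mxE (mxE _ _ _ j0) || rewrite mxE; rewrite ?mxE ?projE /= ?dtf // !mxE /= ?dtf.
pose sh : plane := rotation (- alq) ((k / r) *: t + proj (tr b1) (tr b2) c - proj (tr a1) (tr a2) c).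
exists thp, thq, php, phq, (alp - alq), (sh j0 0), (sh j1 0); split=> //.
have MP x : Mproj thp php x = rotation (- alp) (proj (tr a1) (tr a2) x).
  by rewrite Ap rotation_comp addNr rotation0.
have MQ x : Mproj thq phq x = rotation (- alq) (proj (tr b1) (tr b2) x).
  by rewrite Bq rotation_comp addNr rotation0.
have imP x : (transl (sh j0 0) (sh j1 0) \o rotation (alp - alq) \o Mproj thp php) (f x) =
    rotation (- alq) ((k / r) *: (proj a1 a2 x + t) + proj (tr b1) (tr b2) c).
  rewrite /= /transl MP rotation_comp (_ : alp - alq - alp = - alq); last by ring.
  rewrite projf (_ : mx_of_rows _ _ _ = sh); last by apply: plane_eq; rewrite !mxE.
  by rewrite -rotationD; congr rotation; apply: plane_eq; rewrite !mxE; ring.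
have imQ x : Mproj thq phq (f x) =
    rotation (- alq) ((k / r) *: proj b1 b2 x + proj (tr b1) (tr b2) c).
  by rewrite MQ projf addrC.
have affM : affine (Mproj thq phq \o f).
  by move=> x y a b ab; rewrite /= (similarity_affine simf) // /Mproj mulmxDr -!scalemxAr.
move=> _ [_ [x xv <-] <-]; rewrite imP.
have -> : Mproj thq phq @` (f @` hull [set` vs]) = (Mproj thq phq \o f) @` hull [set` vs].
  by rewrite image_comp.
apply: (@inside_interior _ [seq Mproj thq phq (f w) | w <- ws]).
- by case: ws ws0 {wv H}.
- exact: image_convex affM (chull_convex _).
- move=> _ /= /mapP[w ww ->]; exists w => //; apply: sub_chull => /=; exact: wv.
pose K1 := [set x : pt | forall e, e \in edges ws ->
     0 < det2 (proj b1 b2 e.2 - proj b1 b2 e.1) (proj a1 a2 x + t - proj b1 b2 e.1)].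
have cK1 : convex K1.
  split=> y z a b a0 b0 ab /= hy hz e ew.
  have := hy e ew; have := hz e ew; rewrite projD !projZ.
  move: (proj b1 b2 e.2) (proj b1 b2 e.1) (proj a1 a2 y) (proj a1 a2 z) => u w y' z'.
  have -> : det2 (u - w) (a *: y' + b *: z' + t - w) =
      a * det2 (u - w) (y' + t - w) + b * det2 (u - w) (z' + t - w).
    by rewrite /det2 !mxE (_ : b = 1 - a); [ring|lra].
  move=> h1 h2; have [a00|a00] := eqVneq a 0.
    by rewrite a00 mul0r add0r (_ : b = 1) ?mul1r //; lra.
  by rewrite ltr_wpDr ?mulr_ge0 ?mulr_gt0 ?(ltW h1) // lt_neqAle eq_sym a00.
have xK1 : K1 x by apply: (chull_min cK1 _ xv) => y yv e ew; exact: H.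
move=> e'; rewrite edges_map => /mapP[e ew ->] /=.
rewrite !imQ.
have sub2 (y z : plane) : rotation (- alq) y - rotation (- alq) z = rotation (- alq) (y - z).
  by rewrite -[- rotation _ _]scaleN1r -rotationZ -rotationD scaleN1r.
rewrite !sub2 det2_rotation.
rewrite (_ : det2 _ _ = (k / r) ^+ 2 *
  det2 (proj b1 b2 e.2 - proj b1 b2 e.1) (proj a1 a2 x + t - proj b1 b2 e.1)).
  by rewrite mulr_gt0 ?exprn_gt0 ?divr_gt0 //; exact: xK1.
move: (proj b1 b2 e.2) (proj b1 b2 e.1) (proj a1 a2 x) (proj (tr b1) (tr b2) c) (k / r).
by move=> u w y z m; rewrite /det2 !mxE; ring.
Qed.

End Frames.

(** * Ball arithmetic *)

(** A centre and a radius. *)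
Notation zball := (Z * Z)%type.

Section ZR.
Variable R : realType.

Definition ZR (z : Z) : R := (ssrZ.int_of_Z z)%:~R.

Lemma ZRD a b : ZR (a + b)%ZZ = ZR a + ZR b.
Proof. by rewrite /ZR -intrD; congr _%:~R; lia. Qed.

Lemma ZRM a b : ZR (a * b)%ZZ = ZR a * ZR b.
Proof. by rewrite /ZR -intrM; congr _%:~R; lia. Qed.

Lemma ZRN a : ZR (- a)%ZZ = - ZR a.
Proof. by rewrite /ZR -mulrNz; congr _%:~R; lia. Qed.

Lemma ZRB a b : ZR (a - b)%ZZ = ZR a - ZR b.
Proof. by rewrite -ZRN -ZRD; congr ZR; lia. Qed.

Lemma ZR_le a b : (a <= b)%ZZ -> ZR a <= ZR b.
Proof. by move=> h; rewrite /ZR ler_int; lia. Qed.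

Lemma ZR_lt a b : (a < b)%ZZ -> ZR a < ZR b.
Proof. by move=> h; rewrite /ZR ltr_int; lia. Qed.

Lemma ZR_abs a : ZR (Z.abs a) = `|ZR a|.
Proof. by rewrite /ZR -intr_norm; congr _%:~R; lia. Qed.

Lemma ZR0 : ZR 0 = 0. Proof. by []. Qed.
Lemma ZR1 : ZR 1 = 1. Proof. by []. Qed.
Lemma ZR2 : ZR 2 = 2. Proof. by []. Qed.

Definition inb (b : zball) (x : R) : Prop := `|x - ZR b.1| <= ZR b.2.

Definition badd (b c : zball) : zball := ((b.1 + c.1)%ZZ, (b.2 + c.2)%ZZ).
Definition bopp (b : zball) : zball := ((- b.1)%ZZ, b.2).
Definition bscale (z : Z) (b : zball) : zball := ((z * b.1)%ZZ, (Z.abs z * b.2)%ZZ).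
Definition bmul (b c : zball) : zball :=
  ((b.1 * c.1)%ZZ, (Z.abs b.1 * c.2 + b.2 * Z.abs c.1 + b.2 * c.2)%ZZ).
(** Rounding loses at most one unit in the centre and one in the radius. *)
Definition bshift (k : Z) (b : zball) : zball := (Z.shiftr b.1 k, (Z.shiftr b.2 k + 2)%ZZ).
Definition bsqrt (k : Z) (b : zball) : zball :=
  let lo := Z.sqrt (Z.shiftl (b.1 - b.2) k) in
  (lo, (Z.sqrt (Z.shiftl (b.1 + b.2) k) + 1 - lo)%ZZ).
Definition bpos (b : zball) : bool := (b.2 <? b.1)%ZZ.
Definition bzero : zball := (0%ZZ, 0%ZZ).

Lemma inb_exact z : inb (z, 0%ZZ) (ZR z).
Proof. by rewrite /inb /= subrr normr0. Qed.

Lemma inb_add b c x y : inb b x -> inb c y -> inb (badd b c) (x + y).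
Proof.
rewrite /inb /= !ZRD => hx hy; rewrite opprD addrACA.
exact: le_trans (ler_normD _ _) (lerD hx hy).
Qed.

Lemma inb_opp b x : inb b x -> inb (bopp b) (- x).
Proof. by rewrite /inb /= ZRN -opprD normrN. Qed.

Lemma inb_scale z b x : inb b x -> inb (bscale z b) (ZR z * x).
Proof. by rewrite /inb /= !ZRM ZR_abs -mulrBr normrM => h; apply: ler_wpM2l. Qed.

Lemma inb_mul b c x y : inb b x -> inb c y -> inb (bmul b c) (x * y).
Proof.
rewrite /inb /= !ZRD !ZRM !ZR_abs => hx hy.
have E (u v : R) : x * y - u * v = u * (y - v) + (x - u) * v + (x - u) * (y - v) by ring.
rewrite E.
apply: le_trans (ler_normD _ _) _; apply: lerD.
  apply: le_trans (ler_normD _ _) _; rewrite !normrM; apply: lerD.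
    exact: ler_wpM2l.
  exact: ler_wpM2r.
by rewrite normrM; apply: ler_pM.
Qed.

Lemma inb_pos b x : bpos b -> inb b x -> 0 < x.
Proof.
rewrite /bpos /inb => /Z.ltb_lt /ZR_lt h; rewrite ler_norml => /andP[h1 _].
lra.
Qed.

Definition pow2 (k : Z) : R := ZR (2 ^ k)%ZZ.

Lemma pow2_gt0 k : (0 <= k)%ZZ -> 0 < pow2 k.
Proof. by move=> k0; rewrite -(ZR0); apply: ZR_lt; apply: Z.pow_pos_nonneg; lia. Qed.

Lemma ZR_shiftr a k : (0 <= k)%ZZ ->
  ZR (Z.shiftr a k) <= ZR a / pow2 k < ZR (Z.shiftr a k) + 1.
Proof.
move=> k0; have p0 := pow2_gt0 k0.
have p0' : (0 < 2 ^ k)%ZZ by apply: Z.pow_pos_nonneg; lia.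
rewrite ler_pdivlMr // ltr_pdivrMr // Z.shiftr_div_pow2 //.
have E := Z.div_mod a _ (not_eq_sym (Z.lt_neq _ _ p0')).
have [m0 m1] := Z.mod_pos_bound a _ p0'.
rewrite -ZR1 -ZRD /pow2 -!ZRM ZR_le ?ZR_lt //; nia.
Qed.

Lemma inb_shift k b x : (0 <= k)%ZZ -> inb b x -> inb (bshift k b) (x / pow2 k).
Proof.
move=> k0; rewrite /inb /= ZRD ZR2 => h.
have p0 := pow2_gt0 k0.
have /andP[m0 m1] := ZR_shiftr b.1 k0; have /andP[r0 r1] := ZR_shiftr b.2 k0.
have : `|x / pow2 k - ZR b.1 / pow2 k| <= ZR b.2 / pow2 k.
  by rewrite -mulrBl normrM (gtr0_norm (x := _^-1)) ?invr_gt0 // ler_pM2r ?invr_gt0.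
rewrite !ler_norml => /andP[h0 h1]; apply/andP; split; lra.
Qed.

(** Numbers are scaled by a power of two: the ball of a square root contains the
    scaled root when the ball of the radicand contains the scaled radicand. *)
Lemma inb_sqrt k b x : (0 <= k)%ZZ -> (0 <= b.1 - b.2)%ZZ ->
  inb b (pow2 k * x) -> inb (bsqrt k b) (pow2 k * Num.sqrt x).
Proof.
move=> k0 b0; rewrite /inb /= => h.
have p0 := pow2_gt0 k0.
have b2 : (0 <= b.2)%ZZ.
  have : 0 <= ZR b.2 by apply: le_trans h.
  by rewrite /ZR ler0z; lia.
have p0' : (0 < 2 ^ k)%ZZ by apply: Z.pow_pos_nonneg; lia.
rewrite !Z.shiftl_mul_pow2 //.
set A := ((b.1 - b.2) * 2 ^ k)%ZZ; set B := ((b.1 + b.2) * 2 ^ k)%ZZ.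
have A0 : (0 <= A)%ZZ by rewrite /A; nia.
have B0 : (0 <= B)%ZZ by rewrite /B; nia.
have [lo0 _] := Z.sqrt_spec A A0; have [_ hi] := Z.sqrt_spec B B0.
have sA0 := Z.sqrt_nonneg A; have sB0 := Z.sqrt_nonneg B.
move: h; rewrite ler_norml => /andP[h1 h2].
have x0 : 0 <= x.
  by rewrite -(pmulr_rge0 _ p0); have := ZR_le b0; rewrite ZRB ZR0; lra.
set y := pow2 k * Num.sqrt x.
have y0 : 0 <= y by rewrite mulr_ge0 ?sqrtr_ge0 // ltW.
have yy : y ^+ 2 = pow2 k * (pow2 k * x) by rewrite exprMn sqr_sqrtr // expr2; ring.
have lo1 : ZR (Z.sqrt A) <= y.
  rewrite -(@ler_pXn2r _ 2) ?nnegrE //; last by rewrite -ZR0; apply: ZR_le.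
  rewrite yy expr2 -ZRM; apply: le_trans (ZR_le lo0) _.
  by rewrite /A ZRM ZRB -/(pow2 k) [leLHS]mulrC ler_pM2l //; lra.
have hi1 : y <= ZR (Z.sqrt B + 1).
  rewrite -(@ler_pXn2r _ 2) ?nnegrE //; last by rewrite -ZR0; apply: ZR_le; lia.
  rewrite yy expr2 -ZRM; apply: le_trans _ (ZR_le (Z.lt_le_incl _ _ hi)).
  by rewrite /B ZRM ZRD -/(pow2 k) [leRHS]mulrC ler_pM2l //; lra.
by rewrite ger0_norm ?subr_ge0 // ZRB lerD2r.
Qed.

End ZR.

Arguments inb {R}.

(** * Points with coordinates in a ring of algebraic numbers *)

(** [(a, b)] stands for a + b * theta, a form [:: z0; z1; ...] for the sum of the
    z_i * s_i, and a point is given by three forms. *)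
Notation form := (seq (Z * Z)).
Notation cpt := (form * form * form)%type.

Section Forms.
Variable R : realType.
Local Notation pt := 'cV[R]_3.
Local Notation ZR := (@ZR R).

Section Eval.
Variables (theta : R) (ss : seq R).

Definition evz (z : Z * Z) : R := ZR z.1 + ZR z.2 * theta.

Fixpoint evf (ss : seq R) (f : form) : R :=
  match f, ss with z :: f', s :: ss' => evz z * s + evf ss' f' | _, _ => 0 end.

Definition evp (c : cpt) : pt := point3 (evf ss c.1.1) (evf ss c.1.2) (evf ss c.2).

End Eval.

Section BallEval.
Variables (k : Z) (bt : zball).

Definition bevz (z : Z * Z) : zball := badd (Z.shiftl z.1 k, 0%ZZ) (bscale z.2 bt).

Fixpoint bevf (bs : seq zball) (f : form) : zball :=
  match f, bs with
  | z :: f', s :: bs' => badd (bshift k (bmul (bevz z) s)) (bevf bs' f')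
  | _, _ => bzero
  end.

End BallEval.

Definition inbs (k : Z) (bs : seq zball) (ss : seq R) : Prop :=
  size bs = size ss /\ forall i, (i < size bs)%N -> inb (nth bzero bs i) (pow2 R k * nth 0 ss i).

Lemma inb_evf k bt bs theta ss f : (0 <= k)%ZZ -> inb bt (pow2 R k * theta) ->
  inbs k bs ss -> inb (bevf k bt bs f) (pow2 R k * evf theta ss f).
Proof.
move=> k0 ht; have p0 := pow2_gt0 R k0.
elim: f bs ss => [|z f IH] [|b bs] [|s ss] [] //= => [_ _|_ _|_ _|[sz] H].
- by rewrite mulr0; exact: inb_exact.
- by rewrite mulr0; exact: inb_exact.
- by rewrite mulr0; exact: inb_exact.
rewrite mulrDr; apply: inb_add; last first.
  by apply: IH; split=> // i ib; apply: (H i.+1).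
have -> : pow2 R k * (evz theta z * s) = (pow2 R k * evz theta z) * (pow2 R k * s) / pow2 R k.
  by rewrite -[RHS]mulrA -[X in _ = _ * X]mulrA mulrAC mulrC; field; rewrite gt_eqF.
apply: inb_shift => //; apply: inb_mul; last exact: (H 0%N).
rewrite /evz mulrDr; apply: inb_add.
  by rewrite Z.shiftl_mul_pow2 // /pow2 mulrC -ZRM; exact: inb_exact.
rewrite mulrCA; exact: inb_scale.
Qed.

End Forms.

(** * Certificates *)

Notation zvec := (Z * Z * Z)%type.
Notation quaternion := (Z * Z * Z * Z)%type.

Definition zscale (k : Z) (u : zvec) : zvec :=
  let: (x, y, z) := u in ((k * x)%ZZ, (k * y)%ZZ, (k * z)%ZZ).

Definition zdot (u v : zvec) : Z :=
  let: (x, y, z) := u in let: (x', y', z') := v in (x * x' + y * y' + z * z')%ZZ.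

Definition qnorm (q : quaternion) : Z :=
  let: (a, b, c, d) := q in (a * a + b * b + c * c + d * d)%ZZ.

(** Two rows of the matrix of v |-> q v q^*, which are orthogonal of length
    [qnorm q]. *)
Definition qrow1 (q : quaternion) : zvec :=
  let: (a, b, c, d) := q in
  ((a * a + b * b - c * c - d * d)%ZZ, (2 * (b * c - a * d))%ZZ, (2 * (b * d + a * c))%ZZ).
Definition qrow2 (q : quaternion) : zvec :=
  let: (a, b, c, d) := q in
  ((2 * (b * c + a * d))%ZZ, (a * a - b * b + c * c - d * d)%ZZ, (2 * (c * d - a * b))%ZZ).

Lemma qrowP q : [/\ zdot (qrow1 q) (qrow1 q) = (qnorm q * qnorm q)%ZZ,
  zdot (qrow2 q) (qrow2 q) = (qnorm q * qnorm q)%ZZ & zdot (qrow1 q) (qrow2 q) = 0%ZZ].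
Proof. by case: q => [[[a b] c] d]; split; cbv [zdot qrow1 qrow2 qnorm]; lia. Qed.

(** The views of the inner and of the outer copy, the translation, and the indices
    of the vertices of the outer shadow in counterclockwise order; coordinates in
    the plane are rounded by 2 ^ [cshift]. *)
Record certificate := Certificate {
  cinner : quaternion; couter : quaternion; cshift : Z; ctrans : Z * Z; cpoly : seq nat }.

Notation bpt := (zball * zball * zball)%type.
Definition bdot (u : zvec) (p : bpt) : zball :=
  let: (x, y, z) := u in let: (p0, p1, p2) := p in
  badd (badd (bscale x p0) (bscale y p1)) (bscale z p2).
Definition bdet (u v : zball * zball) : zball :=
  badd (bmul u.1 v.2) (bopp (bmul u.2 v.1)).
Definition bsub2 (u v : zball * zball) : zball * zball :=
  (badd u.1 (bopp v.1), badd u.2 (bopp v.2)).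
Definition bevp (k : Z) (bt : zball) (bs : seq zball) (c : cpt) : bpt :=
  (bevf k bt bs c.1.1, bevf k bt bs c.1.2, bevf k bt bs c.2).

Definition shadow (K : Z) (q : quaternion) (m : Z) (p : bpt) : zball * zball :=
  (bshift K (bdot (zscale m (qrow1 q)) p), bshift K (bdot (zscale m (qrow2 q)) p)).

(** The frame of each copy is multiplied by the norm of the other quaternion, so
    that both have the same scale. *)
Definition check (k : Z) (bt : zball) (bs : seq zball) (vs : seq cpt) (c : certificate) : bool :=
  let: Certificate p q K t w := c in
  let pts := map (bevp k bt bs) vs in
  let inner := map (fun x => let s := shadow K p (qnorm q) x in
      (badd s.1 (t.1, 0%ZZ), badd s.2 (t.2, 0%ZZ))) pts in
  let outer := map (fun i => shadow K q (qnorm p) (nth (bzero, bzero, bzero) pts i)) w in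
  [&& (0 <? qnorm p)%ZZ, (0 <? qnorm q)%ZZ, (0 <=? K)%ZZ,
      w != [::], all (fun i => i < size vs)%N w &
      all (fun e => let d := bsub2 e.2 e.1 in
         all (fun x => bpos (bdet d (bsub2 x e.1))) inner) (edges outer)].

Section Soundness.
Variable R : realType.
Local Notation pt := 'cV[R]_3.
Local Notation plane := 'cV[R]_2.
Local Notation ZR := (@ZR R).

Definition zpt (u : zvec) : pt := let: (x, y, z) := u in point3 (ZR x) (ZR y) (ZR z).

Lemma dot_zpt u v : dot (zpt u) (zpt v) = ZR (zdot u v).
Proof.
case: u v => [[x y] z] [[x' y'] z'].
by rewrite dotE !mxE /= !ZRD !ZRM.
Qed.

Lemma zdot_scale m u v : zdot (zscale m u) (zscale m v) = (m * m * zdot u v)%ZZ.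
Proof. by case: u v => [[x y] z] [[x' y'] z']; cbv [zdot zscale]; lia. Qed.

Definition inbp (p : bpt) (k : R) (x : pt) : Prop :=
  let: (p0, p1, p2) := p in
  [/\ inb p0 (k * x i0 0), inb p1 (k * x i1 0) & inb p2 (k * x i2 0)].

Lemma inb_dot u p k x : inbp p k x -> inb (bdot u p) (k * dot (zpt u) x).
Proof.
case: u p => [[a b] c] [[p0 p1] p2] [h0 h1 h2].
have -> : k * dot (zpt (a, b, c)) x =
    ZR a * (k * x i0 0) + ZR b * (k * x i1 0) + ZR c * (k * x i2 0).
  by rewrite dotE !mxE /=; ring.
by apply: inb_add; [apply: inb_add|]; exact: inb_scale.
Qed.

Definition inb2 (b : zball * zball) (k : R) (x : plane) : Prop :=
  inb b.1 (k * x j0 0) /\ inb b.2 (k * x j1 0).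

Lemma inb_sub2 b c k x y : inb2 b k x -> inb2 c k y -> inb2 (bsub2 b c) k (x - y).
Proof.
by move=> [h0 h1] [g0 g1]; rewrite /inb2 !mxE !mulrBr; split; apply: inb_add => //; apply: inb_opp.
Qed.

Lemma inb_det b c k x y : inb2 b k x -> inb2 c k y -> inb (bdet b c) (k ^+ 2 * det2 x y).
Proof.
move=> [h0 h1] [g0 g1].
have -> : k ^+ 2 * det2 x y = (k * x j0 0) * (k * y j1 0) - (k * x j1 0) * (k * y j0 0).
  by rewrite /det2; ring.
by apply: inb_add; [|apply: inb_opp]; exact: inb_mul.
Qed.

Lemma inb_shadow K q m p k x : (0 <= K)%ZZ -> inbp p k x ->
  inb2 (shadow K q m p) (k / pow2 R K) (proj (zpt (zscale m (qrow1 q))) (zpt (zscale m (qrow2 q))) x).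
Proof.
move=> K0 px; rewrite /inb2 /shadow /= !projE.
by split; rewrite mulrAC; apply: inb_shift => //; apply: inb_dot.
Qed.

(** The balls contain the coordinates of the two shadows, all multiplied by
    2 ^ (k - cshift), so positive determinants of balls give the hypothesis of
    [rupert_criterion]. *)
Lemma check_rupert k bt bs theta ss vs c (f : pt -> pt) :
  (0 <= k)%ZZ -> inb bt (pow2 R k * theta) -> inbs k bs ss -> similarity f ->
  check k bt bs vs c -> Rupert (f @` hull [set` map (evp theta ss) vs]).
Proof.
case: c => p q K t w k0 ht hs simf.
case/and5P => np nq K0 w0 /andP[wv] /seq.allP H.
have {}K0 : (0 <= K)%ZZ by lia.
set a1 := zscale (qnorm q) (qrow1 p); set a2 := zscale (qnorm q) (qrow2 p).
set b1 := zscale (qnorm p) (qrow1 q); set b2 := zscale (qnorm p) (qrow2 q).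
have pk := pow2_gt0 R k0; have pK := pow2_gt0 R K0.
set s := pow2 R k / pow2 R K.
have s0 : 0 < s by rewrite divr_gt0.
set v0 : cpt := ([::], [::], [::]).
set n := ((qnorm p * qnorm q) * (qnorm p * qnorm q))%ZZ.
have [P1 P2 P3] := qrowP p; have [Q1 Q2 Q3] := qrowP q.
apply: (@rupert_criterion R f _ [seq evp theta ss (nth v0 vs i) | i <- w]
  (zpt a1) (zpt a2) (zpt b1) (zpt b2) (ZR n)
  (\col_(i < 2) if i == j0 then ZR t.1 / s else ZR t.2 / s)) => //.
- by rewrite -[0](ZR0 R); apply: ZR_lt; rewrite /n; nia.
- by rewrite dot_zpt zdot_scale P1 /n; congr ZR; lia.
- by rewrite dot_zpt zdot_scale P2 /n; congr ZR; lia.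
- by rewrite dot_zpt zdot_scale P3 Z.mul_0_r.
- by rewrite dot_zpt zdot_scale Q1 /n; congr ZR; lia.
- by rewrite dot_zpt zdot_scale Q2 /n; congr ZR; lia.
- by rewrite dot_zpt zdot_scale Q3 Z.mul_0_r.
- by case: (w) w0.
- move=> x /mapP[i iw ->]; apply: map_f; apply: mem_nth.
  exact: (seq.allP wv).
have inp x : inbp (bevp k bt bs x) (pow2 R k) (evp theta ss x).
  by split; rewrite /= ?mxE /=; apply: inb_evf.
move=> _ e /mapP[v vv ->]; rewrite edges_map => /mapP[e' ew ->] /=.
move: H; rewrite edges_map => /(_ _ (map_f _ ew)) /= /seq.allP.
rewrite -map_comp => /(_ _ (map_f _ vv)) /= /inb_pos.
have iw : (e'.1 < size vs)%N /\ (e'.2 < size vs)%N.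
  move: ew => /(nthP (0%N, 0%N)); rewrite size_zip size_rot minnn => -[j jw <-].
  rewrite nth_zip ?size_rot //=; move/seq.allP: wv => wv.
  by split; apply: wv; [|rewrite -(mem_rot 1)]; apply: mem_nth; rewrite ?size_rot.
move=> /(_ R (s ^+ 2 * _)) pos.
rewrite -(pmulr_rgt0 _ (exprn_gt0 2 s0)); apply: pos.
have out i : (i < size vs)%N -> inb2 (shadow K q (qnorm p)
      (nth (bzero, bzero, bzero) [seq bevp k bt bs x | x <- vs] i)) s
      (proj (zpt b1) (zpt b2) (evp theta ss (nth v0 vs i))).
  by move=> iv; rewrite (nth_map v0) //; apply: inb_shadow.
case: iw => iw1 iw2.
apply: inb_det; apply: inb_sub2; try exact: out.
have [h0 h1] := @inb_shadow K p (qnorm q) _ _ _ K0 (inp v).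
have sn : s != 0 by rewrite gt_eqF.
by split; rewrite mxE mulrDr; apply: inb_add => //; rewrite mxE /= mulrC divfK //; exact: inb_exact.
Qed.

End Soundness.

(** * Regular polygons *)

Section Polygons.
Variable R : realType.
Local Notation pt := 'cV[R]_3.
Implicit Types (p q b t : nat -> pt) (c e : pt) (n : nat) (g r : R).

(** The parameter of the recurrence satisfied by the vertices of a regular n-gon. *)
Definition gam n : R := 2 * cos (2 * pi / n%:R).

(** A regular polygon without trigonometry: seen from the centre, consecutive
    vertices obey the linear recurrence of a rotation, with [g] twice the cosine of
    its angle. *)
Record ngon g r c p : Prop := Ngon {
  ngon_gt0 : 0 < r;
  ngon_rec : forall i, p i.+2 - c = g *: (p i.+1 - c) - (p i - c);
  ngon_sq : forall i, dot (p i - c) (p i - c) = r;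
  ngon_next : forall i, dot (p i - c) (p i.+1 - c) = g * r / 2 }.

Lemma gam_bound n : (2 < n)%N -> -2 < gam n < 2.
Proof.
move=> n2.
have p0 : 0 < pi :> R by exact: pi_gt0.
have n0 : 0 < n%:R :> R by rewrite ltr0n; lia.
have n3 : 3%:R <= n%:R :> R by rewrite ler_nat.
have t0 : 0 < 2 * pi / n%:R :> R by rewrite divr_gt0 ?mulr_gt0.
have t1 : 2 * pi / n%:R < pi :> R.
  by rewrite ltr_pdivrMr // mulrC ltr_pM2l //; lra.
have i0 : (0 : R) \in `[0, pi]%R by rewrite in_itv /= lexx ltW.
have ith : (2 * pi / n%:R : R) \in `[0, pi]%R by rewrite in_itv /= !ltW.
have ipi : (pi : R) \in `[0, pi]%R by rewrite in_itv /= lexx ltW.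
have := ltr_cos i0 ith; have := ltr_cos ith ipi; rewrite cos0 cospi t0 t1 => c2 c1.
by rewrite /gam; apply/andP; split; lra.
Qed.

Lemma regular_ngon n p : (0 < n)%N -> regular_polygon n p -> exists c r, ngon (gam n) r c p.
Proof.
move=> n0 [c [u [v [r [r0 uu vv uv pE]]]]].
have nz : n%:R != 0 :> R by rewrite pnatr_eq0; lia.
pose th : R := 2 * pi / n%:R.
have xE i : p i - c = (r * cos (i%:R * th)) *: u + (r * sin (i%:R * th)) *: v.
  have -> : i%:R * th = 2 * pi * i%:R / n%:R by rewrite /th; ring.
  by rewrite pE addrC addrA addKr.
have vu : dot v u = 0 by rewrite dotC.
exists c, (r ^+ 2); split=> [|i|i|i]; first by rewrite exprn_gt0.
- rewrite !xE -!natr1 !mulrDl !mul1r !(cosD, sinD) /gam -/th.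
  have cs := cos2Dsin2 th; set C := cos th in cs *; set S := sin th in cs *.
  set a := cos _; set b := sin _.
  have E1 : (a * C - b * S) * C - (b * C + a * S) * S = 2 * C * (a * C - b * S) - a.
    by transitivity (2 * C * (a * C - b * S) - a * (C ^+ 2 + S ^+ 2)); [ring|rewrite cs mulr1].
  have E2 : (b * C + a * S) * C + (a * C - b * S) * S = 2 * C * (b * C + a * S) - b.
    by transitivity (2 * C * (b * C + a * S) - b * (C ^+ 2 + S ^+ 2)); [ring|rewrite cs mulr1].
  by rewrite E1 E2; apply: pt_eq; rewrite !mxE; ring.
- rewrite xE !dotL uu vv uv vu.
  transitivity (r ^+ 2 * (cos (i%:R * th) ^+ 2 + sin (i%:R * th) ^+ 2)); first by ring.
  by rewrite cos2Dsin2 mulr1.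
- rewrite !xE -natr1 mulrDl mul1r !(cosD, sinD) !dotL uu vv uv vu /gam -/th.
  set a := cos (_ * th); set b := sin (_ * th).
  transitivity (r ^+ 2 * cos th * (a ^+ 2 + b ^+ 2)); first by ring.
  by rewrite cos2Dsin2; field.
Qed.

Lemma ngon_regular n r c p : (2 < n)%N -> ngon (gam n) r c p -> regular_polygon n p.
Proof.
move=> n2 [r0 prec psq pnext].
pose th : R := 2 * pi / n%:R.
have nz : n%:R != 0 :> R by rewrite pnatr_eq0; lia.
have /andP[g0 g1] := gam_bound n2.
have cs := cos2Dsin2 th.
have gE : gam n = 2 * cos th by [].
have S0 : sin th != 0.
  apply/eqP => h; move: cs; rewrite h expr0n addr0 => /eqP.
  by rewrite sqrf_eq1 => /orP[] /eqP h1; move: g0 g1; rewrite gE h1; lra.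
pose s := Num.sqrt r.
have s0 : 0 < s by rewrite sqrtr_gt0.
have ss : s ^+ 2 = r by rewrite sqr_sqrtr // ltW.
have sn : s != 0 by rewrite gt_eqF.
pose u := s^-1 *: (p 0%N - c).
pose v := (s * sin th)^-1 *: ((p 1%N - c) - cos th *: (p 0%N - c)).
have x01 : dot (p 0%N - c) (p 1%N - c) = cos th * r by rewrite pnext gE; field.
have x11 := psq 1%N; have x00 := psq 0%N.
have v2 : (s * sin th) ^+ 2 = r * (1 - cos th ^+ 2).
  by rewrite exprMn ss -cs; ring.
have vn : s * sin th != 0 by rewrite mulf_neq0.
exists c, u, v, s; split=> //.
- by rewrite /u; move: (p 0%N - c) x00 => x x00; rewrite !dotL x00 -ss; field.
- rewrite /v; move: x01 x11 x00; move: (p 0%N - c) (p 1%N - c) => x y x01 x11 x00.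
  rewrite !dotL (dotC y x) x01 x11 x00.
  rewrite (_ : _ * _ = r * (1 - cos th ^+ 2) * (s * sin th)^-1 ^+ 2); last by ring.
  by rewrite -v2 exprVn divff // expf_neq0.
- rewrite /v /u; move: x01 x11 x00; move: (p 0%N - c) (p 1%N - c) => x y x01 x11 x00.
  by rewrite !dotL x01 x00; ring.
move=> i.
suff [] : p i = c + (s * cos (2 * pi * i%:R / n%:R)) *: u + (s * sin (2 * pi * i%:R / n%:R)) *: v /\
  p i.+1 = c + (s * cos (2 * pi * i.+1%:R / n%:R)) *: u + (s * sin (2 * pi * i.+1%:R / n%:R)) *: v by [].
have arg j : 2 * pi * j%:R / n%:R = j%:R * th by rewrite /th; ring.
rewrite !arg; elim: i => [|i [IH0 IH1]].
  split; rewrite ?mul0r ?mul1r ?cos0 ?sin0 ?mulr1 ?mulr0 ?scale0r ?addr0.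
    by rewrite /u scalerA divff // scale1r addrC subrK.
  rewrite /u /v !scalerA divff // scale1r mulrAC divff // mul1r.
  by apply: pt_eq; rewrite !mxE; ring.
split=> //.
have -> : p i.+2 = c + (gam n *: (p i.+1 - c) - (p i - c)) by rewrite -prec addrC subrK.
rewrite {}IH0 {}IH1 -!natr1 !mulrDl !mul1r !(cosD, sinD) gE.
set C := cos th in cs *; set S := sin th in cs *; set a := cos _; set b := sin _.
have E1 : (a * C - b * S) * C - (b * C + a * S) * S = 2 * C * (a * C - b * S) - a.
  by transitivity (2 * C * (a * C - b * S) - a * (C ^+ 2 + S ^+ 2)); [ring|rewrite cs mulr1].
have E2 : (b * C + a * S) * C + (a * C - b * S) * S = 2 * C * (b * C + a * S) - b.
  by transitivity (2 * C * (b * C + a * S) - b * (C ^+ 2 + S ^+ 2)); [ring|rewrite cs mulr1].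
by rewrite E1 E2; apply: pt_eq; rewrite !mxE; ring.
Qed.

Lemma regular_period n p i k : (0 < n)%N -> regular_polygon n p -> p (i + n * k)%N = p i.
Proof.
move=> n0 [c [u [v [r [_ _ _ _ pE]]]]]; rewrite !pE.
have nz : n%:R != 0 :> R by rewrite pnatr_eq0; lia.
have -> : 2 * pi * (i + n * k)%:R / n%:R = 2 * pi * i%:R / n%:R + pi *+ 2 *+ k :> R.
  by rewrite natrD natrM -mulrnA -[pi *+ _]mulr_natr natrM; field.
elim: k => [|k IH]; first by rewrite addr0.
by rewrite [_ *+ k.+1]mulrSr addrA cosD2pi sinD2pi.
Qed.

(** The recurrence determines the centre, so it is the one of the parametrization. *)
Lemma regular_antipode n p i : (0 < n)%N -> regular_polygon n.*2 p ->
  forall r g c, g != 2 -> ngon g r c p -> p (i + n)%N - c = - (p i - c).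
Proof.
move=> n0 [c0 [u [v [s [_ _ _ _ pE]]]]] r g c g2 pn.
have anti j : p (j + n)%N - c0 = - (p j - c0).
  rewrite !pE.
  have nz : n%:R != 0 :> R by rewrite pnatr_eq0; lia.
  have -> : 2 * pi * (j + n)%:R / n.*2%:R = 2 * pi * j%:R / n.*2%:R + pi :> R.
    by rewrite natrD -muln2 natrM; field.
  by rewrite cosDpi sinDpi; apply: pt_eq; rewrite !mxE; ring.
suff -> : c = c0 by exact: anti.
have h0 := ngon_rec pn 0; have h1 := ngon_rec pn (0 + n)%N.
have a0 := anti 0%N; have a1 := anti 1%N; have a2 := anti 2%N.
move: h0 h1 a0 a1 a2; rewrite !add0n !addSn !add0n.
move: (p 0%N) (p 1%N) (p 2%N) (p n) (p n.+1) (p n.+2) => p0 p1 p2 q0 q1 q2 h0 h1 a0 a1 a2.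
have E : (2 - g) *: (c - c0) = 0.
  have opp (x y : pt) : x - c0 = - (y - c0) -> x = c0 + c0 - y.
    by move=> h; rewrite -[x](subrK c0) h; apply: pt_eq; rewrite !mxE; ring.
  move: a0 a1 a2 => /opp E1 /opp E2 /opp E3.
  have F : forall i, ((2 - g) *: (c - c0)) i 0 = 0.
    move=> j; have := congr1 (fun M : pt => M j 0) h0; have := congr1 (fun M : pt => M j 0) h1.
    by rewrite E1 E2 E3 !mxE; lra.
  by apply: pt_eq; rewrite F mxE.
have h : 2 - g != 0 by rewrite subr_eq0 eq_sym.
by apply/eqP; rewrite -subr_eq0; move/eqP: E; rewrite scaler_eq0 (negbTE h).
Qed.

End Polygons.

Section SamePolygon.
Variable R : realType.
Local Notation pt := 'cV[R]_3.
Implicit Types (p q b t : nat -> pt) (c e : pt) (n : nat) (g r : R).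

Lemma ngon_centre_eq g r c p : ngon g r c p ->
  p 2%N - g *: p 1%N + p 0%N = (2 - g) *: c.
Proof.
move=> pn; have h := ngon_rec pn 0.
rewrite -[p 2%N](subrK c) h; apply: pt_eq; rewrite !mxE; ring.
Qed.

Lemma ngon_orth g r c p e : ngon g r c p -> dot e (p 0%N - c) = 0 -> dot e (p 1%N - c) = 0 ->
  forall i, dot e (p i - c) = 0.
Proof.
move=> pn h0 h1 i.
suff [] : dot e (p i - c) = 0 /\ dot e (p i.+1 - c) = 0 by [].
elim: i => [|i [IH0 IH1]] //; split=> //.
rewrite (ngon_rec pn); move: (p i.+1 - c) (p i - c) IH0 IH1 => x y hx hy.
by rewrite !dotL hx hy; ring.
Qed.

(** A vector whose scalar products with all vertices agree is a normal. *)
Lemma ngon_const_orth g r c p e a : g < 2 -> ngon g r c p -> (forall i, dot e (p i) = a) ->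
  dot e c = a /\ forall i, dot e (p i - c) = 0.
Proof.
move=> g2 pn ea.
have h := congr1 (dot e) (ngon_centre_eq pn); rewrite !dotL !ea in h.
have ec : dot e c = a.
  have /mulfI : 2 - g != 0 by rewrite subr_eq0 gt_eqF.
  by apply; rewrite -h; ring.
by split=> // i; rewrite !dotL ea ec subrr.
Qed.

(** Two consecutive vertices are linearly independent, seen from the centre. *)
Lemma ngon_gram g r c p : -2 < g < 2 -> ngon g r c p -> forall i,
  dot (p i - c) (p i - c) * dot (p i.+1 - c) (p i.+1 - c) - dot (p i - c) (p i.+1 - c) ^+ 2 != 0.
Proof.
move=> /andP[g0 g1] pn i; rewrite !(ngon_sq pn) (ngon_next pn).
have r0 := ngon_gt0 pn.
rewrite gt_eqF // (_ : _ - _ = r ^+ 2 * ((2 - g) * (2 + g)) / 4); last by field.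
by rewrite divr_gt0 // mulr_gt0 ?exprn_gt0 // mulr_gt0; lra.
Qed.

Lemma ngon_edge g r c p i : ngon g r c p -> dot (p i - p i.+1) (p i - p i.+1) = (2 - g) * r.
Proof.
move=> pn; have h0 := ngon_sq pn i; have h1 := ngon_sq pn i.+1; have h2 := ngon_next pn i.
have -> : p i - p i.+1 = (p i - c) - (p i.+1 - c) by rewrite opprB addrA subrK.
move: (p i - c) (p i.+1 - c) h0 h1 h2 => x y h0 h1 h2.
by rewrite !dotL (dotC y x) h0 h1 h2; field.
Qed.

Lemma ngon_diagonal g r c p i : ngon g r c p ->
  dot (p i - p i.+2) (p i - p i.+2) = (2 + g) * ((2 - g) * r).
Proof.
move=> pn; have h0 := ngon_sq pn i; have h1 := ngon_sq pn i.+1; have h2 := ngon_next pn i.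
have -> : p i - p i.+2 = (p i - c) - (p i.+2 - c) by rewrite opprB addrA subrK.
rewrite (ngon_rec pn).
move: (p i - c) (p i.+1 - c) h0 h1 h2 => x y h0 h1 h2.
by rewrite !dotL (dotC y x) h0 h1 h2; field.
Qed.

(** The centre is determined by the circle, hence by the set of vertices. *)
Lemma ngon_same_centre g r c p g' r' c' b : g < 2 -> g' < 2 ->
  ngon g r c p -> ngon g' r' c' b -> range p = range b -> c = c' /\ r = r'.
Proof.
move=> g2 g2' pn bn pb.
have [s _ hs] : range b (p 0%N) by rewrite -pb; exists 0%N.
have all_p i : exists j, p i = b j by have [j _ <-] : range b (p i); [rewrite -pb; exists i|exists j].
have all_b j : exists i, b j = p i by have [i _ <-] : range p (b j); [rewrite pb; exists j|exists i].
(* the points of b lie on a sphere around c, so c - c' is orthogonal to their plane *)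
have ob j : dot (c - c') (b j - c') = (r' - r + dot (c - c') (c - c')) / 2.
  have [i ji] := all_b j.
  have h1 : dot (b j - c) (b j - c) = r by rewrite ji (ngon_sq pn).
  have h2 := ngon_sq bn j.
  have E : b j - c = (b j - c') - (c - c') by rewrite opprB addrA subrK.
  move: h1; rewrite E; move: (b j - c') (c - c') h2 => x d h2.
  by rewrite !dotL (dotC d x) h2; lra.
have [dc' od] : dot (c - c') c' = dot (c - c') c' /\ forall j, dot (c - c') (b j - c') = 0.
  have [_ od] := @ngon_const_orth _ _ _ _ (c - c') (dot (c - c') c' +
     (r' - r + dot (c - c') (c - c')) / 2) g2' bn (fun j => ltac:(by rewrite -(ob j) dotDr dotNr; ring)).
  by [].
have op i : dot (c - c') (p i - c') = 0 by have [j ->] := all_p i; exact: od.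
have cc : c = c'.
  have E : (2 - g) *: (c - c') = (p 2%N - c') - g *: (p 1%N - c') + (p 0%N - c').
    rewrite scalerBr -(ngon_centre_eq pn); apply: pt_eq; rewrite !mxE; ring.
  apply/eqP; rewrite -subr_eq0 -dot_eq0.
  have : (2 - g) * dot (c - c') (c - c') = 0.
    by rewrite -dotZr E dotDr dotDr dotNr dotZr !op; ring.
  by move/eqP; rewrite mulf_eq0 subr_eq0 gt_eqF.
split=> //; subst c'; rewrite -(ngon_sq pn 0) -(ngon_sq bn s).
by rewrite hs.
Qed.

(** If p 0 = b s, the distance from p 0 to p 1 leaves only the neighbours of b s for
    p 1, and the recurrence propagates the direction. *)
Lemma regular_reindex n p b : (2 < n)%N -> regular_polygon n p -> regular_polygon n b ->
  range p = range b ->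
  exists s d, (d = 1%N \/ d = n.-1) /\ forall i, p i = b (s + d * i)%N.
Proof.
move=> n2 rp rb pb.
have n0 : (0 < n)%N by lia.
have [c [r pn]] := regular_ngon n0 rp; have [c' [r' bn]] := regular_ngon n0 rb.
have /andP[g0 g1] := gam_bound R n2.
have [cc rr] := ngon_same_centre g1 g1 pn bn pb; subst c' r'.
have [s _ hs] : range b (p 0%N) by rewrite -pb; exists 0%N.
have [m _ hm] : range b (p 1%N) by rewrite -pb; exists 1%N.
pose d := ((m + n * s - s) %% n)%N.
have dn : (d < n)%N by rewrite ltn_mod.
have hd : p 1%N = b (s + d)%N.
  rewrite -hm -(regular_period m s n0 rb) -(regular_period (s + d) ((m + n * s - s) %/ n) n0 rb).
  congr b; have := divn_eq (m + n * s - s) n; rewrite -/d => E.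
  have : (s <= n * s)%N by rewrite leq_pmull.
  by rewrite mulnC in E; lia.
have bnd : d = 1%N \/ d = n.-1.
  have [c0 [u [v [k [k0 uu vv uv bE]]]]] := rb.
  have nz : n%:R != 0 :> R by rewrite pnatr_eq0; lia.
  have nr0 : 0 < n%:R :> R by rewrite ltr0n.
  have pi0 : 0 < pi :> R by exact: pi_gt0.
  pose th : R := 2 * pi / n%:R.
  have th0 : 0 < th by rewrite divr_gt0 ?mulr_gt0.
  have nth : n%:R * th = 2 * pi by rewrite /th; field.
  (* a chord determines the cosine of its angle about the centre *)
  have chord i j : dot (b i - b (i + j)%N) (b i - b (i + j)%N) = 2 * k ^+ 2 * (1 - cos (j%:R * th)).
    rewrite !bE natrD.
    have -> : 2 * pi * (i%:R + j%:R) / n%:R = 2 * pi * i%:R / n%:R + j%:R * th :> R by rewrite /th; ring.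
    rewrite cosD sinD; set a := 2 * pi * _ / _; set t := j%:R * th.
    have ca := cos2Dsin2 a; have ct := cos2Dsin2 t.
    set A := cos a in ca *; set B := sin a in ca *; set C := cos t in ct *; set D := sin t in ct *.
    have -> : c0 + (k * A) *: u + (k * B) *: v -
       (c0 + (k * (A * C - B * D)) *: u + (k * (B * C + A * D)) *: v) =
       (k * (A - A * C + B * D)) *: u + (k * (B - B * C - A * D)) *: v.
      by apply: pt_eq; rewrite !mxE; ring.
    rewrite !dotL uu vv uv (dotC v u) uv.
    transitivity (k ^+ 2 * (A ^+ 2 + B ^+ 2) * ((C ^+ 2 + D ^+ 2) - 2 * C + 1)); first by ring.
    by rewrite ca ct; ring.
  have e1 : dot (b s - b (s + d)%N) (b s - b (s + d)%N) = dot (b s - b (s + 1)%N) (b s - b (s + 1)%N).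
    by rewrite hs -hd -hs addn1 hs (ngon_edge 0 pn) -hs (ngon_edge s bn).
  have cosd : cos (d%:R * th) = cos th.
    move: e1; rewrite !chord mul1r => e1.
    have k2 : 2 * k ^+ 2 != 0 by rewrite mulf_neq0 // expf_neq0 // gt_eqF.
    by move/(mulfI k2): e1; lra.
  have th_pi : th \in `[0, pi]%R.
    rewrite in_itv /= ltW //= -(ler_pM2l nr0) nth ler_pM2r // ler_nat; lia.
  have half j : (j.*2 <= n)%N -> cos (j%:R * th) = cos th -> j = 1%N.
    move=> jn jc.
    have jt : j%:R * th \in `[0, pi]%R.
      rewrite in_itv /= mulr_ge0 ?(ltW th0) //= -(@ler_pM2l _ 2) // mulrA.
      rewrite -nth ler_pM2r // -natrM ler_nat mul2n.
      exact: jn.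
    have := cos_inj jt th_pi jc => /eqP.
    rewrite -[X in _ == X]mul1r => /eqP /(mulIf (lt0r_neq0 th0)) /eqP.
    by rewrite pnatr_eq1 => /eqP.
  have [dn2|dn2] := leqP d.*2 n; first by left; exact: half.
  right; have : (n - d)%N = 1%N; last by lia.
  apply: half; first by rewrite doubleB; lia.
  rewrite natrB ?(ltnW dn) // mulrBl nth (_ : 2 * pi = pi *+ 2); last by rewrite mulr2n; ring.
  by rewrite addrC cosD2pi cosN.
exists s, d; split=> // i.
suff [] : p i = b (s + d * i)%N /\ p i.+1 = b (s + d * i.+1)%N by [].
elim: i => [|i [IH0 IH1]]; first by rewrite muln0 addn0 muln1 hs.
split=> //.
rewrite -[LHS](subrK c) (ngon_rec pn) IH0 IH1 -[RHS](subrK c); congr (_ + c).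
case: bnd => ->.
  by rewrite !mul1n !addnS (ngon_rec bn).
(* backwards, the recurrence is read in the opposite direction *)
set j := (s + n.-1 * i)%N.
have -> : (s + n.-1 * i.+1 = (j + n.-2).+1)%N.
  by rewrite /j mulnS; clear j; move: (n.-1 * i)%N => K; lia.
have -> : b (s + n.-1 * i.+2)%N = b (j + n.-2)%N.
  rewrite -(regular_period (j + n.-2) 1 n0 rb) /j; congr b; rewrite !mulnS; clear j; move: (n.-1 * i)%N => K; lia.
have -> : b j = b (j + n.-2).+2.
  by rewrite -(regular_period j 1 n0 rb); congr b; lia.
by rewrite (ngon_rec bn); move: (b _ - c) (b _ - c) => x y; apply: pt_eq; rewrite !mxE; ring.
Qed.

Definition same_edge (x y x' y' : pt) := (x = x' /\ y = y') \/ (x = y' /\ y = x').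

(** A rotation of the indices changes the parity of all edges or of none, and so does
    a reversal, as the number of sides is even. *)
Lemma regular_edges n p b : (2 < n)%N -> ~~ odd n -> regular_polygon n p -> regular_polygon n b ->
  range p = range b -> exists s : bool,
    (forall i, exists2 j, odd j = odd i (+) s & same_edge (p i) (p i.+1) (b j) (b j.+1)) /\
    (forall j, exists2 i, odd j = odd i (+) s & same_edge (p i) (p i.+1) (b j) (b j.+1)).
Proof.
move=> n2 nev rp rb pb.
have n0 : (0 < n)%N by lia.
have [s [d [dE pE]]] := regular_reindex n2 rp rb pb.
case: dE pE => -> pE.
  exists (odd s); split=> [i|j].
    exists (s + i)%N; first by rewrite oddD addbC.
    by left; rewrite !pE !mul1n addnS.
  exists (j + n.-1 * s)%N.
    rewrite oddD oddM; have : odd n.-1 by lia.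
    by move=> ->; rewrite -addbA addbb addbF.
  have E k : b (s + (j + n.-1 * s + k))%N = b (j + k)%N.
    by rewrite -(regular_period (j + k) s n0 rb); congr b; nia.
  left; rewrite !pE !mul1n; split; first by have := E 0%N; rewrite !addn0 => ->.
  by have := E 1%N; rewrite !addn1 => ->.
have on : odd n.-1 by lia.
exists (~~ odd s); split=> [i|j].
  exists (s + n.-1 * i + n.-1)%N.
    by rewrite !oddD oddM on /=; case: (odd s); case: (odd i).
  right; rewrite !pE; split; last by congr b; rewrite mulnS; move: (n.-1 * i)%N => K; lia.
  by rewrite -(regular_period _ 1 n0 rb); congr b; lia.
exists (n.-1 * (j + n.-1 * s) + n.-1)%N.
  by rewrite !(oddD, oddM) on /=; case: (odd s); case: (odd j).
right; rewrite !pE; split.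
  rewrite -(regular_period j.+1 (s + n.-2 * (j + n.-1 * s) + n.-2) n0 rb); congr b.
  have -> : n = n.-2.+2 by lia.
  by move: n.-2 => k /=; nia.
rewrite -(regular_period j (s + n.-2 * (j + n.-1 * s) + n.-1) n0 rb); congr b.
have -> : n = n.-2.+2 by lia.
by move: n.-2 => k /=; nia.
Qed.

End SamePolygon.

(** * Antiprisms and cupolas *)

Section Pieces.
Variable R : realType.
Local Notation pt := 'cV[R]_3.
Implicit Types (p q b t : nat -> pt) (c e : pt) (n : nat) (g r : R).

(** A vertex of the second base is equidistant from the ends of an edge of the
    first, hence lies over a multiple [al] of the sum of their radii. Antipodal
    vertices have the same midpoint, which forces the centre of the second base onto
    the axis of the first. As the circumscribed circles are equal, [al] is now known
    up to its sign, and the length of the lateral edges decides the sign and gives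
    the height. *)
Lemma antiprism_vertices n p q r c : (1 < n)%N -> 0 < gam R n.*2 ->
  ngon (gam R n.*2) r c p -> antiprism n.*2 p q ->
  exists e, let s := Num.sqrt (2 + gam R n.*2) in
  [/\ dot e e = (s - gam R n.*2) * r, forall i, dot e (p i - c) = 0 &
      forall i, q i = c + s^-1 *: ((p i - c) + (p i.+1 - c)) + e].
Proof.
move=> n1 g0 pn [rp rq [w [a [b [w0 ab wp wq]]]] eq].
have n2 : (2 < n.*2)%N by lia.
have gb := gam_bound R n2; have /andP[gl gr] := gb.
set g := gam R n.*2 in g0 gb gl gr pn *; set s := Num.sqrt (2 + g).
have r0 := ngon_gt0 pn.
have [c' [r' qn]] := regular_ngon (ltac:(lia) : (0 < n.*2)%N) rq.
rewrite -/g in qn.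
have ww0 : dot w w != 0 by rewrite dot_eq0.
have [wc wx] := ngon_const_orth gr pn wp.
have gg : 2 + g != 0 by rewrite gt_eqF //; lra.
(* all triangles have sides of the same length, so the two bases are congruent *)
have rr : r' = r.
  have [[h3 _] [h1 h2]] := eq 0%N.
  have : (2 - g) * r' = (2 - g) * r.
    rewrite -(ngon_edge 0 qn) -(ngon_edge 0 pn); apply: dist_eq.
    by rewrite h1 h2 h3.
  by apply: mulfI; rewrite subr_eq0 gt_eqF.
subst r'.
pose al i := dot (q i - c) (p i - c) / ((2 + g) * r / 2).
pose m i := (p i - c) + (p i.+1 - c).
have d0 : (2 + g) * r / 2 != 0 by rewrite !mulf_neq0 ?invr_eq0 // gt_eqF.
have hz i : dot (q i - c) (p i - c) = dot (q i - c) (p i.+1 - c) /\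
    dot (q i - c) (q i - c) - 2 * dot (q i - c) (p i - c) + r = (2 - g) * r.
  have [[h1 h2] _] := eq i.
  have k1 := dist_eq h1; have k2 := dist_eq h2.
  move: k1 k2; rewrite (ngon_edge i pn).
  have -> : p i.+1 - q i = (p i.+1 - c) - (q i - c) by rewrite opprB addrA subrK.
  have -> : q i - p i = (q i - c) - (p i - c) by rewrite opprB addrA subrK.
  have := ngon_sq pn i; have := ngon_sq pn i.+1.
  move: (q i - c) (p i - c) (p i.+1 - c) => z x y hy hx.
  rewrite !dotL (dotC y z) (dotC x z) hx hy => k1 k2; split; lra.
have zE i : q i - c = al i *: m i + ((b - dot w c) / dot w w) *: w.
  have [h1 h2] := hz i.
  have sq0 := ngon_sq pn i; have sq1 := ngon_sq pn i.+1; have nx := ngon_next pn i.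
  have wz : dot w (q i - c) = b - dot w c by rewrite dotDr dotNr wq.
  have w1 := wx i; have w2 := wx i.+1; have gr0 := ngon_gram gb pn i.
  rewrite -[LHS](subrK (al i *: m i)) addrC; congr (_ + _).
  have em : dot (q i - c - al i *: m i) w = b - dot w c.
    by rewrite -wz dotC /m; move: (q i - c) (p i - c) (p i.+1 - c) w1 w2 => z x y w1 w2; rewrite !dotL w1 w2; ring.
  rewrite -em; apply: (@normals_collinear _ (p i - c) (p i.+1 - c)) => //;
    rewrite /al /m -?h1; move: (q i - c) (p i - c) (p i.+1 - c) h1 sq0 sq1 nx d0 => z x y h1 sq0 sq1 nx d0;
    rewrite !dotL ?(dotC y x) ?sq0 ?sq1 nx ?h1; field; rewrite ?gg ?gt_eqF //.
set e := ((b - dot w c) / dot w w) *: w in zE.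
have ex i : dot e (p i - c) = 0 by rewrite /e dotZl wx mulr0.
clearbody e.
have n0 : (0 < n)%N by lia.
have gn2 : g != 2 by rewrite lt_eqF.
have xa i := regular_antipode i n0 rp gn2 pn.
have qa i := regular_antipode i n0 rq gn2 qn.
have ma i : m (i + n)%N = - m i by rewrite /m xa -addSn xa -opprD.
have mid i : exists k : R, (c' - c) - e = k *: m i.
  exists ((al i - al (i + n)%N) / 2).
  have : (q (i + n)%N - c) + (q i - c) = 2 *: (c' - c).
    by rewrite -[q (i + n)%N](subrK c') qa; apply: pt_eq; rewrite !mxE; ring.
  rewrite !zE ma; move: (m i) (c' - c) => x y h.
  by apply: pt_eq; have := congr1 (fun M : pt => M i0 0) h; have := congr1 (fun M : pt => M i1 0) h;
    have := congr1 (fun M : pt => M i2 0) h; rewrite !mxE; lra.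
have ce : c' = c + e.
  have [k0 E0] := mid 0%N; have [k1 E1] := mid 1%N.
  have sq0 := ngon_sq pn 0; have sq1 := ngon_sq pn 1; have nx := ngon_next pn 0.
  have E : k0 *: m 0%N = k1 *: m 1%N by rewrite -E0.
  rewrite /m (ngon_rec pn) in E.
  have F0 := congr1 (dot (p 0%N - c)) E; have F1 := congr1 (dot (p 1%N - c)) E.
  move: F0 F1; move: (p 0%N - c) (p 1%N - c) sq0 sq1 nx => x y sq0 sq1 nx.
  rewrite !dotL (dotC y x) sq0 sq1 nx => F0 F1.
  have G1 : k0 + k1 = 0.
    have H : (k0 + k1) * ((2 - g) * (2 + g) * r / 4) = 0.
      by have F2 := congr1 (fun z => g / 2 * z) F1; rewrite /= in F2; lra.
    apply/eqP; move/eqP: H; rewrite mulf_eq0 => /orP[//|]; rewrite gt_eqF //.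
    by rewrite divr_gt0 // !mulr_gt0 //; lra.
  have G2 : k1 * ((2 + g) * r) = 0.
    have K : k0 = - k1 by lra.
    by move: F1; rewrite K; lra.
  have {}G2 : k1 = 0.
    by apply/eqP; move/eqP: G2; rewrite !mulf_eq0 (negbTE gg) (gt_eqF r0) !orbF.
  by apply/eqP; rewrite -subr_eq0 opprD addrA E1 G2 scale0r.
have s0 : 0 < s by rewrite sqrtr_gt0; lra.
have ss : s ^+ 2 = 2 + g by rewrite sqr_sqrtr //; lra.
have mm i : dot (m i) (m i) = s ^+ 2 * r.
  have sq0 := ngon_sq pn i; have sq1 := ngon_sq pn i.+1; have nx := ngon_next pn i.
  rewrite /m; move: (p i - c) (p i.+1 - c) sq0 sq1 nx => x y sq0 sq1 nx.
  by rewrite !dotL (dotC y x) sq0 sq1 nx ss; field.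
have em i : dot e (m i) = 0 by rewrite /m dotDr !ex addr0.
have alE i : al i = s^-1 /\ dot e e = (s - g) * r.
  have [h1 h2] := hz i.
  have a2 : (al i * s) ^+ 2 = 1.
    have := ngon_sq qn i; rewrite ce opprD addrA zE addrK; move: (m i) (mm i) => x xx; rewrite !dotL xx => h.
    have : ((al i * s) ^+ 2 - 1) * r = 0.
      by rewrite mulrBl mul1r -[X in _ - X]h; ring.
    by move/eqP; rewrite mulf_eq0 (gt_eqF r0) orbF subr_eq0 => /eqP.
  have zx : dot (q i - c) (p i - c) = al i * (s ^+ 2 * r / 2) by rewrite ss /al -!mulrA; field; rewrite gg gt_eqF.
  move: h2; rewrite zx zE; move: (m i) (mm i) (em i) => x xx ex'; rewrite !dotL (dotC x e) ex' xx => h2.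
  have as_ : al i * s = 1.
    have e0 := dot_ge0 e.
    move/eqP: a2; rewrite sqrf_eq1 => /orP[/eqP//|/eqP h].
    have : al i * (s ^+ 2 * r) = - (s * r) by rewrite expr2 !mulrA h; ring.
    have : 0 < s * r by rewrite mulr_gt0.
    have : al i * (al i * (s ^+ 2 * r)) = r.
      by transitivity ((al i * s) ^+ 2 * r); [ring|rewrite h; ring].
    by have : 0 < g * r by [rewrite mulr_gt0]; nra.
  have aV : al i = s^-1 by rewrite -[LHS](mulfK (lt0r_neq0 s0)) as_ mul1r.
  split=> //; move: h2; rewrite aV.
  have E1 : s^-1 * (s^-1 * (s ^+ 2 * r)) = r by field; rewrite gt_eqF.
  have E2 : s^-1 * (s ^+ 2 * r / 2) = s * r / 2 by field; rewrite gt_eqF.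
  by lra.
exists e; split=> [|//|i]; first by have [] := alE 0%N.
have [aV _] := alE i.
by rewrite -[LHS](subrK c) zE aV -/e addrAC [_ + c]addrC.
Qed.

(** The foot of a top vertex is pinned down by the two squares that meet there;
    the sides of the squares carry the vertex to its neighbours. *)
Lemma cupola_vertices n b t r c : (1 < n)%N -> 0 < gam R n.*2 ->
  ngon (gam R n.*2) r c b -> cupola n b t ->
  exists e, let g := gam R n.*2 in
  [/\ dot e e * (2 + g) = (3 - g ^+ 2) * r, forall i, dot e (b i - c) = 0 &
      forall i, t i.+1 = c + (2 + g)^-1 *: ((b i.*2.+1 - c) + (b i.*2.+2 - c)) + e].
Proof.
move=> n1 g0 bn [rb rt _ ct].
have n2 : (2 < n.*2)%N by lia.
have gb := gam_bound R n2; have /andP[gl gr] := gb.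
set g := gam R n.*2 in g0 gb gl gr bn *.
have gg : 2 + g != 0 by rewrite gt_eqF //; lra.
have r0 := ngon_gt0 bn.
pose m i := (b i.*2.+1 - c) + (b i.*2.+2 - c).
pose d i := t i.+1 - c - (2 + g)^-1 *: m i.
have dS i : d i.+1 = d i.
  have [[h _ _] _] := ct i.+1.
  rewrite /d /m doubleS; rewrite doubleS in h.
  have E : t i.+2 = t i.+1 + (b i.*2.+3 - b i.*2.+2) by rewrite h addrC subrK.
  have E3 : b i.*2.+3 - b i.*2.+2 = (b i.*2.+3 - c) - (b i.*2.+2 - c) by rewrite opprB addrA subrK.
  rewrite E E3 [b i.*2.+4 - c](ngon_rec bn) [b i.*2.+3 - c](ngon_rec bn).
  move: (b i.*2.+1 - c) (b i.*2.+2 - c) (t i.+1) => x y z.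
  by apply: pt_eq; rewrite !mxE; field.
have dE i : d i = d 0%N by elim: i => // i IH; rewrite dS.
have dx : dot (d 0%N) (b 0%N.*2.+1 - c) = 0 /\ dot (d 0%N) (b 0%N.*2.+2 - c) = 0 /\
    dot (d 0%N) (d 0%N) * (2 + g) = (3 - g ^+ 2) * r.
  have [[_ h2 h3] _] := ct 0%N; have [[h4 _ h5] _] := ct 1%N.
  have {}h2 := dist_eq h2; rewrite (ngon_edge _ bn) in h2.
  have sq0 := ngon_sq bn 1; have sq1 := ngon_sq bn 2; have nx := ngon_next bn 1.
  have r2 := ngon_rec bn 0; have r3 := ngon_rec bn 1.
  have tE : t 1%N - c = d 0%N + (2 + g)^-1 *: m 0%N by rewrite /d subrK.
  rewrite /m in tE; move: (d 0%N) tE => D tE.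
  rewrite /= in h2 h3 h4 h5 tE *.
  have e1 : b 1%N - t 1%N = (b 1%N - c) - (t 1%N - c) by rewrite opprB addrA subrK.
  have e2 : t 1%N - b 1%N = (t 1%N - c) - (b 1%N - c) by rewrite opprB addrA subrK.
  have e3 : b 1%N - b 0%N = (b 1%N - c) - (g *: (b 1%N - c) - (b 2%N - c)).
    by rewrite -[X in _ - X](subrK c) r2; apply: pt_eq; rewrite !mxE; ring.
  have e4 : t 2%N - b 3%N = (t 1%N - c) - (b 2%N - c).
    by rewrite -[t 2%N](subrK (t 1%N)) -h4; apply: pt_eq; rewrite !mxE; ring.
  have e5 : b 3%N - b 2%N = (g *: (b 2%N - c) - (b 1%N - c)) - (b 2%N - c).
    by rewrite -r3 opprB addrA subrK.
  move: h2 h3 h5; rewrite e1 e2 e3 e4 e5 tE.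
  move: (b 1%N - c) (b 2%N - c) sq0 sq1 nx => x y xx yy xy.
  rewrite !dotL !(dotC x D) !(dotC y D) !(dotC y x) xx yy xy => h2 h3 h5.
  have k1 : (2 + g)^-1 * (2 + g) = 1 by rewrite mulVf.
  set k := (2 + g)^-1 in h2 h3 h5 k1.
  have P : (1 - g) * dot D x + dot D y = 0.
    have := congr1 (fun z => (2 - g) * r / 2 * z) k1; rewrite /=; lra.
  have Q : (g - 1) * dot D y - dot D x = 0.
    have := congr1 (fun z => (2 - g) * r / 2 * z) k1; rewrite /=; lra.
  have Dy : dot D y = 0.
    have : dot D y * (g * (2 - g)) = 0.
      have := congr1 (fun z => (1 - g) * z) Q; rewrite /=; lra.
    move/eqP; rewrite mulf_eq0 => /orP[/eqP //|].
    by rewrite gt_eqF // mulr_gt0 //; lra.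
  have Dx : dot D x = 0 by move: Q; rewrite Dy; lra.
  split=> //; split=> //; move: h2; rewrite Dx Dy => h2.
  have -> : dot D D = (2 - g) * r - k * r.
    have := congr1 (fun z => r * z) k1; have := congr1 (fun z => r * k * z) k1; rewrite /=; lra.
  by have := congr1 (fun z => r * z) k1; rewrite /=; lra.
exists (d 0%N); split.
- by case: dx => _ [].
- case: dx => h1 [h2 _]; apply: (ngon_orth bn) => //.
  have := ngon_rec bn 0; move/(congr1 (dot (d 0%N))).
  move: (d 0%N) (b 0%N - c) (b 1%N - c) (b 2%N - c) h1 h2 => D x y z h1 h2.
  by rewrite !dotL h1 h2; lra.
- move=> i; rewrite -(dE i) /d /m; move: (_ *: _) => z; apply: pt_eq; rewrite !mxE; ring.
Qed.

End Pieces.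

(** * Gluing *)

Section Gluing.
Variable R : realType.
Local Notation pt := 'cV[R]_3.
Implicit Types (p q b t : nat -> pt) (c e : pt) (n : nat) (g r : R).

(** The vertices of a polygon are the points of its hull on the circumscribed sphere. *)
Lemma polygon_range g r c p g' r' c' b : ngon g r c p -> ngon g' r' c' b ->
  polygon p = polygon b -> range p = range b.
Proof.
move=> pn bn; apply: (@sphere_hull_inj _ _ _ c r c' r') => _ [i _ <-].
- exact: (ngon_sq pn).
- exact: (ngon_sq bn).
Qed.

(** The base may be known as a set only. This leaves one bit: the vertices of the top
    lie over the edges of one parity, and the squares stand on the other edges. *)
Lemma cupola_top n b t p r c : (1 < n)%N -> 0 < gam R n.*2 ->
  cupola n b t -> regular_polygon n.*2 p -> ngon (gam R n.*2) r c p -> range b = range p ->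
  exists e (s : bool), let g := gam R n.*2 in
  [/\ dot e e * (2 + g) = (3 - g ^+ 2) * r, forall i, dot e (p i - c) = 0,
      range t = [set x | exists2 j, odd j = s &
         x = c + (2 + g)^-1 *: ((p j - c) + (p j.+1 - c)) + e] &
      forall i, exists2 j, odd j = ~~ s & same_edge (b i.*2) (b i.*2.+1) (p j) (p j.+1)].
Proof.
move=> n1 g0 cup rp pn bp; have [rb rt _ _] := cup.
have n2 : (2 < n.*2)%N by lia.
have /andP[gl gr] := gam_bound R n2.
have [c' [r' bn]] := regular_ngon (ltac:(lia) : (0 < n.*2)%N) rb.
have [cc rr] := ngon_same_centre gr gr bn pn bp; subst c' r'.
have [e [ee eb tE]] := cupola_vertices n1 g0 bn cup.
have nev : ~~ odd n.*2 by rewrite odd_double.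
have [s [bp_edge pb_edge]] := regular_edges n2 nev rb rp bp.
exists e, (~~ s); split=> //.
- move=> i; have : range b (p i) by rewrite bp; exists i.
  by case=> j _ <-.
- apply/seteqP; split.
    move=> _ [i _ <-].
    have -> : t i = t (i + n.-1).+1.
      rewrite -(regular_period i 1 (ltac:(lia) : (0 < n)%N) rt); congr t; lia.
    have [j jo je] := bp_edge (i + n.-1).*2.+1.
    exists j; first by rewrite jo /= odd_double.
    by rewrite tE; case: je => -[-> ->] //; rewrite [X in _ *: X]addrC.
  move=> _ [j jo ->].
  have [i io ie] := pb_edge j.
  have : odd i by move: io; rewrite jo; case: (odd i); case: (s).
  move=> oi; have iE : i = i./2.*2.+1 by rewrite -[LHS]odd_double_half oi.
  exists i./2.+1 => //; rewrite tE; rewrite iE in ie.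
  by case: ie => -[-> ->] //; rewrite [X in _ *: X]addrC.
move=> i; have [j jo je] := bp_edge i.*2.
by exists j => //; rewrite jo odd_double /= negbK.
Qed.

(** This settles the signs of the heights of the pieces on a common face: points of
    the two pieces, decomposed into the centre c of the face, a part parallel to its
    plane and a part orthogonal to it, have opposite orthogonal parts. *)
Lemma attached_opposite A B p g r c y1 y2 e1 e2 : -2 < g < 2 -> ngon g r c p ->
  attached A B (polygon p) -> 
  (forall w, (forall i, dot w (p i - c) = 0) -> dot w y1 = 0 /\ dot w y2 = 0) ->
  A (c + y1 + e1) -> B (c + y2 + e2) ->
  (forall i, dot e1 (p i - c) = 0) -> (forall i, dot e2 (p i - c) = 0) ->
  e1 != 0 -> e2 != 0 -> exists2 k, 0 < k & e2 = - k *: e1.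
Proof.
move=> gb pn [w [a [w0 Aw Fa Bw Fb]]] yE A1 B2 o1 o2 e10 e20.
have /andP[gl gr] := gb.
have pF i : polygon p (p i) by apply: sub_chull; exists i.
have wp i : dot w (p i) = a by have := pF i; rewrite Fa => -[].
have [wc wx] := ngon_const_orth gr pn wp.
have [w1 w2] := yE w wx.
have gr0 := ngon_gram gb pn 0.
have e1w := normals_collinear gr0 w0 (wx 0%N) (wx 1%N) (o1 0%N) (o1 1%N).
have e2w := normals_collinear gr0 w0 (wx 0%N) (wx 1%N) (o2 0%N) (o2 1%N).
set k1 := _ / _ in e1w; set k2 := _ / _ in e2w.
have ww : 0 < dot w w by rewrite dot_gt0.
have k1n : k1 != 0 by apply: contra_neq e10 => h; rewrite e1w h scale0r.
have k2n : k2 != 0 by apply: contra_neq e20 => h; rewrite e2w h scale0r.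
have k1l : k1 < 0.
  rewrite lt_neqAle k1n -(pmulr_lle0 _ ww); have := Aw _ A1.
  by rewrite /= !dotDr wc w1 e1w dotZr; lra.
have k2l : 0 < k2.
  rewrite lt_neqAle eq_sym k2n -(pmulr_lge0 _ ww); have := Bw _ B2.
  by rewrite /= !dotDr wc w2 e2w dotZr; lra.
exists (- (k2 / k1)).
  by rewrite oppr_gt0 pmulr_rlt0 // invr_lt0.
by rewrite e1w {1}e2w opprK scalerA divfK.
Qed.

End Gluing.

(** * The golden ring *)

(** Pairs (a, b) stand for a + b * phi, with phi the golden ratio; an equality of
    pairs can be decided by computation. *)
Notation zphi := (Z * Z)%type.
Notation vphi := (zphi * zphi * zphi)%type.

Definition gadd (x y : zphi) : zphi := ((x.1 + y.1)%ZZ, (x.2 + y.2)%ZZ).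
Definition gopp (x : zphi) : zphi := ((- x.1)%ZZ, (- x.2)%ZZ).
Definition gmul (x y : zphi) : zphi :=
  ((x.1 * y.1 + x.2 * y.2)%ZZ, (x.1 * y.2 + x.2 * y.1 + x.2 * y.2)%ZZ).
Definition gnat (n : Z) : zphi := (n, 0%ZZ).

(** A sufficient test of positivity: 987 / 610 and 1597 / 987 are convergents of phi
    from below and from above. *)
Definition gpos (x : zphi) : bool :=
  if (0 <=? x.2)%ZZ then (0 <? 610 * x.1 + 987 * x.2)%ZZ
  else (0 <? 987 * x.1 + 1597 * x.2)%ZZ.

Definition vadd (u v : vphi) : vphi :=
  (gadd u.1.1 v.1.1, gadd u.1.2 v.1.2, gadd u.2 v.2).
Definition vopp (u : vphi) : vphi := (gopp u.1.1, gopp u.1.2, gopp u.2).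
Definition vsub (u v : vphi) : vphi := vadd u (vopp v).
Definition vscale (k : zphi) (u : vphi) : vphi := (gmul k u.1.1, gmul k u.1.2, gmul k u.2).
Definition vdot (u v : vphi) : zphi :=
  gadd (gadd (gmul u.1.1 v.1.1) (gmul u.1.2 v.1.2)) (gmul u.2 v.2).
Definition vcross (u v : vphi) : vphi :=
  let minor a b c d := gadd (gmul a d) (gopp (gmul b c)) in
  (minor u.1.2 u.2 v.1.2 v.2, minor u.2 u.1.1 v.2 v.1.1, minor u.1.1 u.1.2 v.1.1 v.1.2).

Section Golden.
Variable R : realType.
Local Notation pt := 'cV[R]_3.
Local Notation phi := (golden R).
Local Notation ZR := (@ZR R).

Lemma golden_sq : phi ^+ 2 = phi + 1.
Proof.
have : Num.sqrt 5 ^+ 2 = 5 :> R by rewrite sqr_sqrtr.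
rewrite /golden; move: (Num.sqrt 5) => s s5.
have -> : ((1 + s) / 2) ^+ 2 = (1 + s) / 2 + 1 + (s ^+ 2 - 5) / 4 by field.
by rewrite s5 subrr mul0r addr0.
Qed.

Lemma golden_gt0 : 0 < phi.
Proof. by rewrite /golden divr_gt0 // ltr_pwDl // sqrtr_ge0. Qed.

Lemma golden_neq0 : phi != 0. Proof. by rewrite gt_eqF // golden_gt0. Qed.

Lemma golden_inv : phi^-1 = phi - 1.
Proof.
apply: (mulfI golden_neq0); rewrite divff ?golden_neq0 // mulrBr -expr2 golden_sq; ring.
Qed.

Lemma golden_lower : 987 < 610 * phi.
Proof.
rewrite ltNge; apply/negP => h.
have : 0 <= (987 - 610 * phi) * phi by apply: mulr_ge0; [lra|exact: ltW golden_gt0].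
by rewrite mulrBl -mulrA -expr2 golden_sq; lra.
Qed.

Lemma golden_upper : 987 * phi < 1597.
Proof.
rewrite ltNge; apply/negP => h.
have : 0 <= (987 * phi - 1597) * phi by apply: mulr_ge0; [lra|exact: ltW golden_gt0].
by rewrite mulrBl -mulrA -expr2 golden_sq; have := golden_lower; lra.
Qed.

Lemma golden_lt2 : phi < 2.
Proof. by have := golden_upper; lra. Qed.

Lemma golden_sq_lt3 : phi ^+ 2 < 3.
Proof. by rewrite golden_sq; have := golden_lt2; lra. Qed.

Notation ev := (evz phi).

Lemma ev_add x y : ev (gadd x y) = ev x + ev y.
Proof. by rewrite /evz /= !ZRD; ring. Qed.

Lemma ev_opp x : ev (gopp x) = - ev x.
Proof. by rewrite /evz /= !ZRN; ring. Qed.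

Lemma ev_mul x y : ev (gmul x y) = ev x * ev y.
Proof.
rewrite /evz /= !(ZRD, ZRM).
move: (ZR x.1) (ZR x.2) (ZR y.1) (ZR y.2) => a b c d.
transitivity (a * c + (a * d + b * c) * phi + b * d * phi ^+ 2); last by ring.
by rewrite golden_sq; ring.
Qed.

Lemma ev_nat n : ev (gnat n) = ZR n.
Proof. by rewrite /evz /= ZR0; ring. Qed.

Lemma ev_pos x : gpos x -> 0 < ev x.
Proof.
case: x => a b; rewrite /gpos /evz -[(a, b).1]/a -[(a, b).2]/b.
have [lo hi] := (golden_lower, golden_upper).
have e1 : ZR 610 = 610 by []. have e2 : ZR 987 = 987 by []. have e3 : ZR 1597 = 1597 by [].
case: ifP => b0 /Z.ltb_lt /(ZR_lt R); rewrite ZR0 ZRD !ZRM ?e1 ?e2 ?e3 => h; clear e1 e2 e3.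
  have : 0 <= ZR b by rewrite -(ZR0 R); apply: ZR_le; lia.
  move: (ZR a) (ZR b) h => x y h y0.
  have h1 : 0 <= y * (610 * phi - 987) by apply: mulr_ge0; [exact: y0|lra].
  by lra.
have : ZR b <= 0 by rewrite -(ZR0 R); apply: ZR_le; lia.
move: (ZR a) (ZR b) h => x y h y0.
have h1 : 0 <= - y * (1597 - 987 * phi) by apply: mulr_ge0; lra.
by lra.
Qed.

Definition evv (u : vphi) : pt := point3 (ev u.1.1) (ev u.1.2) (ev u.2).

Lemma evv_add u v : evv (vadd u v) = evv u + evv v.
Proof. by apply: pt_eq; rewrite !mxE /= ev_add. Qed.

Lemma evv_opp u : evv (vopp u) = - evv u.
Proof. by apply: pt_eq; rewrite !mxE /= ev_opp. Qed.

Lemma evv_sub u v : evv (vsub u v) = evv u - evv v.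
Proof. by rewrite evv_add evv_opp. Qed.

Lemma evv_scale k u : evv (vscale k u) = ev k *: evv u.
Proof. by apply: pt_eq; rewrite !mxE /= ev_mul. Qed.

Lemma dot_evv u v : dot (evv u) (evv v) = ev (vdot u v).
Proof. by rewrite dotE !mxE /= !ev_add !ev_mul. Qed.

Definition gsign (s : bool) (x : zphi) : zphi := if s then gopp x else x.

Definition signs3 : seq (bool * bool * bool) :=
  [seq (s, s3) | s <- [seq (s1, s2) | s1 <- [:: false; true], s2 <- [:: false; true]],
                 s3 <- [:: false; true]].

Definition even_list (x y z : zphi) : seq vphi :=
  flatten [seq [:: (gsign s.1.1 x, gsign s.1.2 y, gsign s.2 z);
                   (gsign s.1.2 y, gsign s.2 z, gsign s.1.1 x);
                   (gsign s.2 z, gsign s.1.1 x, gsign s.1.2 y)] | s <- signs3].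

Definition evvs (V : seq vphi) : set pt := [set` map evv V].

Lemma evvsP V x : evvs V x <-> exists2 v, v \in V & x = evv v.
Proof. by split=> [/mapP[v vV ->]|[v vV ->]]; [exists v|apply: map_f]. Qed.

Lemma ev_sign s x : ev (gsign s x) = (-1) ^+ s * ev x.
Proof. by case: s; rewrite /= ?ev_opp ?expr1 ?expr0 ?mul1r ?mulN1r. Qed.

Lemma even_listP x y z : even_perms (ev x) (ev y) (ev z) = evvs (even_list x y z).
Proof.
apply/seteqP; split=> [p [s1 [s2 [s3 h]]]|p /evvsP[v]].
  apply/evvsP; have sin : (s1, s2, s3) \in signs3 by clear h; case: s1; case: s2; case: s3.
  have inl v : v \in [:: (gsign s1 x, gsign s2 y, gsign s3 z); (gsign s2 y, gsign s3 z, gsign s1 x);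
      (gsign s3 z, gsign s1 x, gsign s2 y)] -> v \in even_list x y z.
    by move=> vl; apply/flattenP; eexists; first exact: (map_f _ sin).
  by case: h => ->; [exists (gsign s1 x, gsign s2 y, gsign s3 z)
    |exists (gsign s2 y, gsign s3 z, gsign s1 x)|exists (gsign s3 z, gsign s1 x, gsign s2 y)];
    rewrite ?/evv /= ?ev_sign //; apply: inl; rewrite !inE eqxx ?orbT.
move/flattenP => [l /mapP[[[s1 s2] s3] _ ->]] /= vl ->.
exists s1, s2, s3; rewrite /evv -!ev_sign; move: vl; rewrite !inE => /or3P[] /eqP -> /=.
- exact: Or31.
- exact: Or32.
- exact: Or33.
Qed.

Lemma evvs_cat V W : evvs (V ++ W) = evvs V `|` evvs W.
Proof.
apply/seteqP; split=> [x|x]; rewrite /evvs /= map_cat mem_cat.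
  by case/orP; [left|right].
by case=> /= ->; rewrite ?orbT.
Qed.

Lemma evvs_undup V : evvs (undup V) = evvs V.
Proof.
by apply/seteqP; split=> x /evvsP[v vV ->]; apply/evvsP; exists v; rewrite ?mem_undup // -mem_undup.
Qed.

Definition icosidodecahedron : seq vphi :=
  undup (even_list (0, 0)%ZZ (0, 0)%ZZ (0, 2)%ZZ ++ even_list (1, 0)%ZZ (0, 1)%ZZ (1, 1)%ZZ).

Definition truncated_dodecahedron_list : seq vphi :=
  undup (even_list (0, 0)%ZZ (-1, 1)%ZZ (2, 1)%ZZ ++ even_list (-1, 1)%ZZ (0, 1)%ZZ (0, 2)%ZZ
   ++ even_list (0, 1)%ZZ (2, 0)%ZZ (1, 1)%ZZ).

Definition rhombicosidodecahedron : seq vphi :=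
  undup (even_list (1, 0)%ZZ (1, 0)%ZZ (1, 2)%ZZ ++ even_list (1, 1)%ZZ (0, 1)%ZZ (0, 2)%ZZ
   ++ even_list (2, 1)%ZZ (0, 0)%ZZ (1, 1)%ZZ).

Lemma ev_small : [/\ ev (0, 0)%ZZ = 0, ev (1, 0)%ZZ = 1 & ev (0, 1)%ZZ = phi] /\
  [/\ ev (0, 2)%ZZ = 2 * phi, ev (1, 1)%ZZ = phi + 1, ev (-1, 1)%ZZ = phi^-1,
      ev (2, 1)%ZZ = 2 + phi & ev (2, 0)%ZZ = 2 /\ ev (1, 2)%ZZ = phi ^+ 3].
Proof.
have h2 : ZR 2 = 2 by []. have h1 : ZR (-1) = -1 by [].
rewrite /evz /= ?h2 ?h1 ZR0 ZR1; split; split; rewrite ?golden_inv; try ring.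
split; first by ring.
by rewrite exprS golden_sq mulrDr -expr2 golden_sq; ring.
Qed.

Lemma icosidodecahedronE : @icosidodecahedron_vertices R = evvs icosidodecahedron.
Proof.
have [[e0 e1 ep] [e2p ep1 _ _ _]] := ev_small.
by rewrite evvs_undup evvs_cat -!even_listP e0 e1 ep e2p ep1 -golden_sq.
Qed.

Lemma truncated_dodecahedronE :
  @truncated_dodecahedron_vertices R = evvs truncated_dodecahedron_list.
Proof.
have [[e0 e1 ep] [e2p ep1 ei e2p1 [e2 _]]] := ev_small.
by rewrite evvs_undup 2!(evvs_cat (even_list _ _ _)) -!even_listP e0 ep e2p ep1 ei e2p1 e2 setUA.
Qed.

Lemma rhombicosidodecahedronE :
  @rhombicosidodecahedron_vertices R = evvs rhombicosidodecahedron.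
Proof.
have [[e0 e1 ep] [e2p ep1 ei e2p1 [e2 e3]]] := ev_small.
by rewrite evvs_undup 2!(evvs_cat (even_list _ _ _)) -!even_listP e0 e1 ep e2p ep1 e2p1 e3 -golden_sq setUA.
Qed.

End Golden.

(** * Similarities and the pyritohedral group *)

Section Similarities.
Variable R : realType.
Local Notation pt := 'cV[R]_3.
Implicit Types (f h : pt -> pt) (p : nat -> pt).

Lemma similarity_comp f h : similarity f -> similarity h -> similarity (f \o h).
Proof.
move=> [s [U [c [s0 UU fE]]]] [s' [U' [c' [s0' UU' hE]]]].
exists (s * s'), (U *m U'), (c + s *: (U *m c')); split; first by rewrite mulr_gt0.
  by rewrite trmx_mul -mulmxA (mulmxA U^T) UU mul1mx UU'.
by move=> x; rewrite /= fE hE mulmxDr scalerDr addrA -!scalemxAr scalerA mulmxA.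
Qed.

Lemma similarity_inv f : similarity f -> exists2 h, similarity h & cancel f h /\ cancel h f.
Proof.
move=> [s [U [c [s0 UU fE]]]].
have UU' : U *m U^T = 1%:M by exact: mulmx1C.
have sn : s != 0 by rewrite gt_eqF.
exists (fun x => - (s^-1 *: (U^T *m c)) + s^-1 *: (U^T *m x)).
  by exists s^-1, U^T, (- (s^-1 *: (U^T *m c))); split=> //; rewrite ?invr_gt0 ?trmxK.
split=> x.
  by rewrite fE mulmxDr scalerDr addrA addNr add0r -scalemxAr scalerA mulVf // scale1r mulmxA UU mul1mx.
by rewrite fE mulmxDr mulmxN -!scalemxAr !mulmxA UU' !mul1mx scalerDr scalerN !scalerA divff // !scale1r addrA addrN add0r.
Qed.

Lemma similarity_scale (k : R) : 0 < k -> similarity (fun x : pt => k *: x).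
Proof.
move=> k0; exists k, 1%:M, 0; split=> //; first by rewrite trmx1 mulmx1.
by move=> x; rewrite add0r mul1mx.
Qed.

Lemma similarity_injective (f : pt -> pt) : similarity f -> injective f.
Proof. by move=> /similarity_inv[h _ [fK _]]; exact: can_inj fK. Qed.

Lemma similarity_matrix (f : pt -> pt) : similarity f -> exists (M : 'M[R]_3) (k : R),
  [/\ 0 < k, forall x, f x = f 0 + M *m x & forall x y, dot (M *m x) (M *m y) = k * dot x y].
Proof.
move=> [s [U [c [s0 UU fE]]]]; exists (s *: U), (s ^+ 2); split.
- by rewrite exprn_gt0.
- by move=> x; rewrite !fE mulmx0 scaler0 addr0 -scalemxAl.
- by move=> x y; rewrite -!scalemxAl !dotL dot_orthogonal //; ring.
Qed.

Lemma frame_neq0 (M : 'M[R]_3) (k : R) (x : pt) : 0 < k -> (forall x y : pt, dot (M *m x) (M *m y) = k * dot x y) ->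
  x != 0 -> M *m x != 0.
Proof. by move=> k0 Mk x0; rewrite -dot_eq0 Mk mulf_neq0 ?dot_eq0 // gt_eqF. Qed.

Lemma hull_scaled (T : Type) (f : pt -> pt) (F : T -> pt) (a : R) vs :
  f @` hull [set` map (fun v => a *: F v) vs] = (f \o (fun x => a *: x)) @` hull [set` map F vs].
Proof.
transitivity (f @` ((fun x => a *: x) @` hull [set` map F vs])); last first.
  by rewrite image_comp.
rewrite [X in _ = f @` X]image_chull; last first.
  by move=> x y s t _; rewrite scalerDr !scalerA ![a * _]mulrC.
congr (f @` hull _); apply/seteqP; split=> x.
  by rewrite /= (map_comp (fun x => a *: x)) => /mapP[y yv ->]; exists y.
by move=> [y /= yv <-]; rewrite (map_comp (fun x => a *: x)); apply: map_f.
Qed.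

Lemma midpoint (V : set pt) (f : pt -> pt) x y : similarity f -> x + y = 0 ->
  V (f x) -> V (f y) -> chull V (f 0).
Proof.
move=> sf xy Vx Vy.
have h0 : 0 <= 2^-1 :> R by rewrite invr_ge0.
have h2 : 2^-1 + 2^-1 = 1 :> R by field.
have <- : 2^-1 *: x + 2^-1 *: y = 0 by rewrite -scalerDr xy scaler0.
rewrite (similarity_affine sf) //.
by apply: (convex_comb (chull_convex _) h0 h0 h2); apply: sub_chull.
Qed.

(** The translation cancels in differences. The last clause, by which functionals are
    transported, holds because the linear part is onto. *)
Lemma similarity_linear f : similarity f -> exists (L : pt -> pt) (k : R), [/\ 0 < k,
  forall x y, f x - f y = L (x - y), forall a x y, L (a *: x + y) = a *: L x + L y,
  forall x y, dot (L x) (L y) = k * dot x y &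
  forall w, exists2 w', w = L w' & forall x, dot w (L x) = k * dot w' x].
Proof.
move=> [s [U [c [s0 UU fE]]]].
have UU' : U *m U^T = 1%:M by exact: mulmx1C.
have sn : s != 0 by rewrite gt_eqF.
have dL x y : dot (s *: (U *m x)) (s *: (U *m y)) = s ^+ 2 * dot x y.
  by rewrite !dotL dot_orthogonal //; ring.
exists (fun x => s *: (U *m x)), (s ^+ 2); split=> //.
- by rewrite exprn_gt0.
- by move=> x y; rewrite !fE opprD addrACA addrN add0r -scalerBr -mulmxBr.
- by move=> a x y; rewrite mulmxDr scalerDr -scalemxAr !scalerA mulrC.
- move=> w; have E : w = s *: (U *m (s^-1 *: (U^T *m w))).
    by rewrite -scalemxAr scalerA divff // scale1r mulmxA UU' mul1mx.
  by exists (s^-1 *: (U^T *m w)) => // x; rewrite {1}E dL.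
Qed.

Lemma regular_similarity n f p : similarity f -> regular_polygon n p -> regular_polygon n (f \o p).
Proof.
move=> [s [U [c [s0 UU fE]]]] [c' [u [v [r [r0 uu vv uv pE]]]]].
exists (c + s *: (U *m c')), (U *m u), (U *m v), (s * r); split; rewrite ?dot_orthogonal ?mulr_gt0 //.
move=> i; rewrite /= fE pE !mulmxDr -!scalemxAr !scalerDr !scalerA !addrA.
by rewrite !mulrA.
Qed.

Lemma regular_inj n p : (0 < n)%N -> regular_polygon n p ->
  {in gtn n &, injective p}.
Proof.
move=> n0 [c [u [v [r [r0 uu vv uv pE]]]]].
have nz : n%:R != 0 :> R by rewrite pnatr_eq0; lia.
have nr0 : 0 < n%:R :> R by rewrite ltr0n.
have p0 : 0 < pi :> R by exact: pi_gt0.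
pose th : R := 2 * pi / n%:R.
have th0 : 0 < th by rewrite divr_gt0 ?mulr_gt0.
have nth : n%:R * th = 2 * pi by rewrite /th; field.
suff main i j : (i <= j < n)%N -> p i = p j -> i = j.
  move=> i j; rewrite !inE => ni nj; case: (leqP i j) => ij.
    by apply: main; rewrite ij.
  by move=> /esym h; apply/esym; apply: main h; rewrite ltnW.
move=> /andP[ij jn]; rewrite !pE.
have arg k : 2 * pi * k%:R / n%:R = k%:R * th by rewrite /th; ring.
rewrite !arg => h.
have E (x y : pt) : c + x + y - c = x + y by rewrite addrC addrA addKr.
have hc : cos (i%:R * th) = cos (j%:R * th).
  have := congr1 (fun x => dot (x - c) u) h; rewrite /= !E.
  rewrite !dotL uu (dotC v u) uv !mulr0 !mulr1 !addr0.
  by move/(mulfI (lt0r_neq0 r0)).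
have hs : sin (i%:R * th) = sin (j%:R * th).
  have := congr1 (fun x => dot (x - c) v) h; rewrite /= !E.
  rewrite !dotL vv uv !mulr0 !mulr1 !add0r.
  by move/(mulfI (lt0r_neq0 r0)).
have : cos ((j - i)%:R * th) = 1.
  rewrite natrB // mulrBl cosB hc hs -!expr2; exact: cos2Dsin2.
have : (j - i < n)%N by lia.
have [d dE] : exists d, d = (j - i)%N by eexists.
rewrite -dE => dn cd.
suff : d = 0%N by lia.
have i00 : (0 : R) \in `[0, pi]%R by rewrite in_itv /= lexx ltW.
have half k : (k.*2 <= n)%N -> cos (k%:R * th) = 1 -> k = 0%N.
  move=> kn kc.
  have kt : k%:R * th \in `[0, pi]%R.
    rewrite in_itv /= mulr_ge0 ?(ltW th0) //= -(@ler_pM2l _ 2) // mulrA -nth ler_pM2r //.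
    by rewrite -natrM ler_nat mul2n.
  have /eqP := cos_inj kt i00 (etrans kc (esym (@cos0 R))).
  by rewrite mulf_eq0 (gt_eqF th0) orbF pnatr_eq0 => /eqP.
have [dn2|dn2] := leqP d.*2 n; first exact: half.
have : (n - d)%N = 0%N; last by lia.
apply: half; first by rewrite doubleB; lia.
rewrite natrB ?(ltnW dn) // mulrBl nth (_ : 2 * pi = pi *+ 2); last by rewrite mulr2n; ring.
by rewrite addrC cosD2pi cosN.
Qed.

End Similarities.

(** Signed cyclic permutations of the coordinates, which form the pyritohedral group,
    of order 24: the entry [(b, i)] takes the coordinate of index i, and changes its
    sign if b holds. The three vertex sets have this symmetry visibly, and it
    suffices to move each five-fold axis to any other. *)
Notation sym := ((bool * nat) * (bool * nat) * (bool * nat))%type.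

Definition pick3 (T : Type) (t : T * T * T) (i : nat) : T :=
  match i with 0 => t.1.1 | 1 => t.1.2 | _ => t.2 end.

Definition act_with (T : Type) (opp : T -> T) (g : sym) (t : T * T * T) : T * T * T :=
  let coord e := let x := pick3 t e.2 in if e.1 then opp x else x in
  (coord g.1.1, coord g.1.2, coord g.2).

Definition act : sym -> vphi -> vphi := act_with gopp.
Definition scomp (g h : sym) : sym := act_with (fun e => (~~ e.1, e.2)) g h.
Definition sid : sym := ((false, 0), (false, 1), (false, 2))%N.
Definition sneg : sym := ((true, 0), (true, 1), (true, 2))%N.

Definition syms : seq sym :=
  [seq ((s.1.1, k), (s.1.2, (k + 1) %% 3), (s.2, (k + 2) %% 3))%N
  | s <- signs3, k <- [:: 0; 1; 2]%N].

(** The eight choices of signs for each of the three cyclic shifts. *)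
Lemma symsP (P : sym -> Prop) :
  (forall s1 s2 s3, P ((s1, 0), (s2, 1), (s3, 2))%N /\ P ((s1, 1), (s2, 2), (s3, 0))%N /\
     P ((s1, 2), (s2, 0), (s3, 1))%N) -> forall g, g \in syms -> P g.
Proof.
move=> H g /allpairsP[[[[s1 s2] s3] k] /= [_ + ->]]; have [h0 [h1 h2]] := H s1 s2 s3.
by rewrite !inE => /or3P[] /eqP -> /=.
Qed.

Definition sinv_in (g : sym) : sym :=
  nth sid [seq h <- syms | scomp g h == sid] 0.

Lemma sinvP g : g \in syms -> sinv_in g \in syms /\ scomp g (sinv_in g) = sid /\ scomp (sinv_in g) g = sid.
Proof. by move: g; apply: symsP => -[] [] []. Qed.

Lemma scomp_in g h : g \in syms -> h \in syms -> scomp g h \in syms.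
Proof.
have : all (fun g => all (fun h => scomp g h \in syms) syms) syms by vm_compute.
by move=> /seq.allP H gs hs; exact: (seq.allP (H _ gs)).
Qed.

Section Action.
Variable R : realType.
Local Notation pt := 'cV[R]_3.

Definition spt (g : sym) (x : pt) : pt :=
  let t := act_with -%R g (x i0 0, x i1 0, x i2 0) in point3 t.1.1 t.1.2 t.2.

Lemma spt_evv g v : spt g (evv R v) = evv R (act g v).
Proof.
case: v => [[x y] z]; case: g => [[[b1 k1] [b2 k2]] [b3 k3]].
set t := (evv R (x, y, z) i0 0, evv R (x, y, z) i1 0, evv R (x, y, z) i2 0).
have E b k : (if b then - pick3 t k else pick3 t k) =
    evz (golden R) (if b then gopp (pick3 (x, y, z) k) else pick3 (x, y, z) k).
  by case: b k => -[|[|k]]; rewrite /= ?ev_opp !mxE.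
by apply: pt_eq; rewrite /spt -/t [LHS]mxE /= E [RHS]mxE.
Qed.

Lemma spt_comp g h x : spt (scomp g h) x = spt g (spt h x).
Proof.
case: g => [[[b1 k1] [b2 k2]] [b3 k3]]; case: h => [[[c1 l1] [c2 l2]] [c3 l3]].
by apply: pt_eq; rewrite !mxE /=; [case: k1 => [|[|k1]]|case: k2 => [|[|k2]]|case: k3 => [|[|k3]]];
  rewrite /= ?mxE /=; [case: b1 c1|case: b1 c2|case: b1 c3|case: b2 c1|case: b2 c2|case: b2 c3
   |case: b3 c1|case: b3 c2|case: b3 c3] => -[]; rewrite //= ?opprK.
Qed.

Lemma spt_id x : spt sid x = x.
Proof. by apply: pt_eq; rewrite !mxE. Qed.

Lemma sptK g : g \in syms -> cancel (spt g) (spt (sinv_in g)) /\ cancel (spt (sinv_in g)) (spt g).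
Proof. by move=> /sinvP[_ [h1 h2]]; split=> x; rewrite -spt_comp ?h1 ?h2 spt_id. Qed.

Lemma spt_linear g a x y : spt g (a *: x + y) = a *: spt g x + spt g y.
Proof.
case: g => [[[b1 k1] [b2 k2]] [b3 k3]].
by apply: pt_eq; rewrite !mxE /=; [case: k1 b1 => [|[|k1]]|case: k2 b2 => [|[|k2]]|case: k3 b3 => [|[|k3]]] => -[];
  rewrite /= ?mxE ?opprD ?mulrN.
Qed.

Lemma spt0 g : spt g 0 = 0.
Proof. by have := spt_linear g (-1) 0 0; rewrite scaler0 addr0 scaleN1r addNr. Qed.

Lemma sptZ g a x : spt g (a *: x) = a *: spt g x.
Proof. by rewrite -[a *: x]addr0 spt_linear spt0 addr0. Qed.

Lemma sptB g x y : spt g (x - y) = spt g x - spt g y.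
Proof. by rewrite addrC -scaleN1r spt_linear scaleN1r addrC. Qed.

Lemma spt_dot g x y : g \in syms -> dot (spt g x) (spt g y) = dot x y.
Proof.
move: g; apply: symsP => s1 s2 s3.
by split; [|split]; rewrite !dotE !mxE /=; case: s1; case: s2; case: s3; rewrite /=; ring.
Qed.

Lemma isometry_similarity (f : pt -> pt) : (forall a x y, f (a *: x + y) = a *: f x + f y) ->
  (forall x y, dot (f x) (f y) = dot x y) -> similarity f.
Proof.
move=> fl fd.
pose E (j : 'I_3) : pt := delta_mx j 0.
have f0 : f 0 = 0.
  by have := fl (-1) 0 0; rewrite scaler0 addr0 scaleN1r addNr.
have fZ a x : f (a *: x) = a *: f x by rewrite -[a *: x]addr0 fl f0 addr0.
pose U : 'M[R]_3 := \matrix_(i, j) f (E j) i 0.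
exists 1, U, 0; split=> //.
  apply/matrixP => i j; rewrite mxE.
  transitivity (dot (f (E i)) (f (E j))).
    by apply: eq_bigr => k _; rewrite !mxE.
  rewrite fd /dot (bigD1 i) //= big1 ?addr0 => [|k ki]; last first.
    by rewrite !mxE (negbTE ki) mul0r.
  by rewrite !mxE !eqxx mul1r andbT.
move=> x; rewrite add0r scale1r.
have -> : f x = x i0 0 *: f (E i0) + x i1 0 *: f (E i1) + x i2 0 *: f (E i2).
  have e : x = x i0 0 *: E i0 + (x i1 0 *: E i1 + (x i2 0 *: E i2)).
    by apply: pt_eq; rewrite !mxE /=; ring.
  by rewrite {1}e !fl fZ addrA.
by apply: pt_eq; rewrite !mxE sum_I3 !mxE; ring.
Qed.

Lemma spt_similarity g : g \in syms -> similarity (spt g).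
Proof.
move=> gs; apply: isometry_similarity; first exact: spt_linear.
by move=> x y; exact: spt_dot.
Qed.

End Action.

(** * Regular faces of the uniform polyhedra *)

(** A five-fold axis of the icosidodecahedron, the truncated dodecahedron and the
    rhombicosidodecahedron. *)
Definition axis : vphi := ((0, 0), (0, 1), (1, 0))%ZZ.

Definition on_axis (m : zphi) (g : sym) (v : vphi) : bool := vdot (act g axis) v == m.

(** A sufficient test of inequality. *)
Definition gdiffer (x y : zphi) : bool := gpos (gadd x (gopp y)) || gpos (gadd y (gopp x)).

(** A sufficient test that u, v, w are not consecutive vertices of a regular polygon,
    from the lengths of its sides and of its shortest diagonals; ga stands for [gam]. *)
Definition not_consecutive (ga : zphi) (u v w : vphi) : bool :=
  let sq x y := vdot (vsub x y) (vsub x y) in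
  let d := sq u v in
  if d == (0, 0)%ZZ then true else if gdiffer (sq v w) d then true
  else gdiffer (sq u w) (gmul (gadd (gnat 2) ga) d).

(** Three points of V that can be consecutive vertices of a regular polygon and are not
    excluded lie at level m in the direction of some image of the axis. By symmetry,
    the first point need only range over the representatives U. The disjunctions are
    written with [if] so that call-by-value evaluation skips what it does not need. *)
Definition triples_check (U V : seq vphi) (ga : zphi) (excl : vphi -> vphi -> vphi -> bool)
    (m : zphi) : bool :=
  all (fun u => all (fun v => all (fun w =>
    if not_consecutive ga u v w then true else if excl u v w then true else
    has (fun g => [&& on_axis m g u, on_axis m g v & on_axis m g w]) syms) V) V) U.

(** The plane of three points has vertices strictly on both sides. *)
Definition two_sided (V : seq vphi) (u v w : vphi) : bool :=
  let n := vcross (vsub v u) (vsub w u) in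
  if has (fun x => gpos (vdot n (vsub x u))) V
  then has (fun x => gpos (gopp (vdot n (vsub x u)))) V else false.

(** The plane of three points misses the origin. *)
Definition off_centre (u v w : vphi) : bool :=
  let d := vdot (vcross u v) w in gpos d || gpos (gopp d).

Definition syms_closed (V : seq vphi) : bool :=
  all (fun g => all (fun v => act g v \in V) V) syms.

Definition seeds_check (U V : seq vphi) : bool :=
  all (fun v => has (fun g => act g v \in U) syms) V.

Definition on_sphere (V : seq vphi) (r : zphi) : bool := all (fun v => vdot v v == r) V.

Definition axis_level (V : seq vphi) (m : zphi) : bool :=
  all (fun v => (vdot axis v == m) || gdiffer (vdot axis v) m) V.

Definition axis_face (V : seq vphi) (m : zphi) : seq vphi := [seq v <- V | vdot axis v == m].

Section Faces.
Variable R : realType.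
Local Notation pt := 'cV[R]_3.
Local Notation phi := (golden R).
Local Notation ev := (evz phi).
Local Notation evv := (evv R).
Local Notation evvs := (@evvs R).

Lemma ev_sq u v : ev (vdot (vsub u v) (vsub u v)) = dot (evv u - evv v) (evv u - evv v).
Proof. by rewrite -dot_evv evv_sub. Qed.

Lemma gdifferP x y : ev x = ev y -> gdiffer x y = false.
Proof.
by move=> h; apply/negP => /orP[] /(ev_pos R); rewrite ev_add ev_opp h subrr ltxx.
Qed.

Lemma not_consecutiveP ga r c (p : nat -> pt) u v w : ev ga < 2 -> ngon (ev ga) r c p ->
  p 0%N = evv u -> p 1%N = evv v -> p 2%N = evv w -> not_consecutive ga u v w = false.
Proof.
move=> g2 pn hu hv hw; have r0 := ngon_gt0 pn.
have e0 := ngon_edge 0 pn; have e1 := ngon_edge 1 pn; have e2 := ngon_diagonal 0 pn.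
rewrite hu hv -ev_sq in e0; rewrite hv hw -ev_sq in e1; rewrite hu hw -ev_sq in e2.
rewrite /not_consecutive [X in if X then true else gdiffer _ _]gdifferP ?e1 ?e0 //.
rewrite gdifferP; last by rewrite e2 ev_mul ev_add ev_nat e0.
case: eqP => // h; move: e0; rewrite h /evz /= ZR0 mul0r addr0 => /esym/eqP.
by rewrite mulf_eq0 subr_eq0 !gt_eqF.
Qed.

Lemma ngon_spt ga r c (p : nat -> pt) g : g \in syms -> ngon ga r c p ->
  ngon ga r (spt g c) (spt g \o p).
Proof.
move=> gs [r0 prec psq pnext].
split=> [//|i|i|i].
- have -> : (spt g \o p) i.+2 - spt g c = spt g (p i.+2 - c) by rewrite sptB.
  by rewrite prec [LHS]sptB sptZ /= !sptB.
- by rewrite /= -sptB spt_dot.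
- by rewrite /= -!sptB spt_dot.
Qed.

(** A symmetry moves the first vertex to a representative, where the enumeration
    applies. *)
Lemma consecutive_axis U V ga excl m r c (p : nat -> pt) :
  triples_check U V ga excl m -> seeds_check U V -> syms_closed V ->
  ev ga < 2 -> ngon (ev ga) r c p -> (forall i, evvs V (p i)) ->
  (forall g u v w, g \in syms -> spt g (p 0%N) = evv u -> spt g (p 1%N) = evv v ->
     spt g (p 2%N) = evv w -> excl u v w = false) ->
  exists2 g, g \in syms &
    forall i, (i < 3)%N -> dot (spt g (evv axis)) (p i) = ev m.
Proof.
move=> /seq.allP H sd cV g2 pn pV hex.
have /evvsP[u uV hu] := pV 0%N.
have /evvsP[v vV hv] := pV 1%N.
have /evvsP[w wV hw] := pV 2%N.
have /seq.hasP[g0 g0s uU] := seq.allP sd _ uV.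
have inV x : x \in V -> act g0 x \in V by exact: (seq.allP (seq.allP cV _ g0s)).
have hu' : spt g0 (p 0%N) = evv (act g0 u) by rewrite hu spt_evv.
have hv' : spt g0 (p 1%N) = evv (act g0 v) by rewrite hv spt_evv.
have hw' : spt g0 (p 2%N) = evv (act g0 w) by rewrite hw spt_evv.
have := seq.allP (seq.allP (H _ uU) _ (inV _ vV)) _ (inV _ wV).
rewrite (not_consecutiveP g2 (ngon_spt g0s pn) hu' hv' hw') (hex _ _ _ _ g0s hu' hv' hw').
move=> /seq.hasP[g gs /and3P[h1 h2 h3]].
have [gi _] := sinvP g0s; have [K _] := @sptK R _ g0s; have [_ K'] := @sptK R _ g0s.
exists (scomp (sinv_in g0) g); first exact: scomp_in.
have E i x : spt g0 (p i) = evv x -> on_axis m g x ->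
    dot (spt (scomp (sinv_in g0) g) (evv axis)) (p i) = ev m.
  move=> hx /eqP hm; rewrite spt_comp -(K (p i)) spt_dot // hx spt_evv dot_evv hm //.
by case=> [|[|[|//]]] _; [exact: E hu' h1|exact: E hv' h2|exact: E hw' h3].
Qed.

Lemma axis_neq0 : evv axis != 0.
Proof.
rewrite -dot_eq0 dot_evv (_ : vdot axis axis = (2, 1)%ZZ) // /evz /=.
by rewrite gt_eqF // addr_gt0 ?mulr_gt0 ?golden_gt0 // -(ZR0 R); apply: ZR_lt.
Qed.

Lemma spt_neq0 g x : g \in syms -> (spt g x == 0 :> pt) = (x == 0).
Proof. by move=> gs; rewrite -dot_eq0 spt_dot // dot_eq0. Qed.

(** Two normals of the plane of a regular polygon, one of them known on three
    vertices only. *)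
Lemma ngon_normals g r c (p : nat -> pt) w n a m : -2 < g < 2 -> ngon g r c p ->
  w != 0 -> n != 0 -> (forall i, dot w (p i) = a) ->
  dot n (p 0%N) = m -> dot n (p 1%N) = m -> dot n (p 2%N) = m ->
  exists2 k, k != 0 & w = k *: n.
Proof.
move=> gb pn w0 n0 wp n1 n2 n3; have /andP[gl gr] := gb.
have [_ wx] := ngon_const_orth gr pn wp.
have nc : dot n c = m.
  have := congr1 (dot n) (ngon_centre_eq pn); rewrite !dotL n1 n2 n3 => h.
  have /mulfI : 2 - g != 0 by rewrite subr_eq0 gt_eqF.
  by apply; rewrite -h; ring.
have nx0 : dot n (p 0%N - c) = 0 by rewrite !dotL n1 nc subrr.
have nx1 : dot n (p 1%N - c) = 0 by rewrite !dotL n2 nc subrr.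
have E := normals_collinear (ngon_gram gb pn 0) n0 nx0 nx1 (wx 0%N) (wx 1%N).
exists (dot w n / dot n n) => //.
by apply: contra_neq w0 => h; rewrite E h scale0r.
Qed.

Lemma vcross_orth u v : dot (evv (vcross u v)) (evv u) = 0 /\ dot (evv (vcross u v)) (evv v) = 0.
Proof.
case: u => [[a b] c]; case: v => [[d e] f].
by rewrite !dotE !mxE /= !(ev_add, ev_opp, ev_mul); split; ring.
Qed.

Lemma two_sidedP V g r c (p : nat -> pt) w a u v x : -2 < g < 2 -> ngon g r c p ->
  w != 0 -> (forall i, dot w (p i) = a) -> (forall y, y \in V -> dot w (evv y) <= a) ->
  p 0%N = evv u -> p 1%N = evv v -> p 2%N = evv x -> two_sided V u v x = false.
Proof.
move=> gb pn w0 wp wV hu hv hx; rewrite /two_sided; case: seq.hasP => [[y yV /(ev_pos R) y0]|//].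
apply/negP => /seq.hasP[z zV /(ev_pos R) z0].
rewrite -dot_evv evv_sub in y0; rewrite ev_opp -dot_evv evv_sub oppr_gt0 in z0.
set n := evv _ in y0 z0.
have [N1 N2] := vcross_orth (vsub v u) (vsub x u); rewrite -/n !evv_sub in N1 N2.
have n0 : n != 0 by apply/eqP => h; rewrite h dot0l ltxx in y0.
have d1 : dot n (p 1%N) = dot n (p 0%N).
  by apply/eqP; rewrite -subr_eq0 -dotNr -dotDr hu hv N1.
have d2 : dot n (p 2%N) = dot n (p 0%N).
  by apply/eqP; rewrite -subr_eq0 -dotNr -dotDr hu hx N2.
have [k k0 E] := ngon_normals gb pn w0 n0 wp erefl d1 d2.
have kle q : q \in V -> k * dot n (evv q - evv u) <= 0.
  by move=> qV; rewrite -dotZl -E dotDr dotNr -hu wp subr_le0; exact: wV.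
have := kle _ yV; rewrite pmulr_lle0 // => k1.
have := kle _ zV; rewrite nmulr_lle0 // => k2.
by move: k0; rewrite eq_le k1 k2.
Qed.

Lemma evvs_sphere V r x : on_sphere V r -> evvs V x -> dot x x = ev r.
Proof. by move=> /seq.allP H /evvsP[v /H /eqP h ->]; rewrite dot_evv h. Qed.

Lemma syms_closedP V g : syms_closed V -> g \in syms -> spt g @` evvs V = evvs V.
Proof.
move=> cV gs.
have sub h : h \in syms -> spt h @` evvs V `<=` evvs V.
  move=> hs _ [_ /evvsP[v vV ->] <-]; rewrite spt_evv; apply/evvsP; exists (act h v) => //.
  by have /seq.allP := (seq.allP cV) _ hs; apply.
have [gi _] := sinvP gs; have [_ K] := @sptK R _ gs.
apply/seteqP; split; first exact: sub.
by move=> x xV; exists (spt (sinv_in g) x) => //; apply: (sub _ gi); exists x.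
Qed.

Lemma plane_vertices V m g : axis_level V m -> syms_closed V -> g \in syms ->
  evvs V `&` [set x | dot (spt g (evv axis)) x = ev m] = spt g @` evvs (axis_face V m).
Proof.
move=> /seq.allP mV cV gs; apply/seteqP; split.
  move=> x [xV /= xm]; move: xV; rewrite -(syms_closedP cV gs) => -[_ /evvsP[v vV ->] vx].
  exists (evv v) => //; apply/evvsP; exists v => //; rewrite mem_filter vV andbT.
  move: xm; rewrite -vx spt_dot // dot_evv => h.
  by case/orP: (mV _ vV) => //; rewrite gdifferP.
move=> _ [_ /evvsP[v + ->] <-]; rewrite mem_filter => /andP[/eqP vm vV].
split; last by rewrite /= spt_dot // dot_evv vm.
by rewrite -(syms_closedP cV gs); exists (evv v) => //; apply/evvsP; exists v.
Qed.

(** The vertices of a face lie on the sphere around V, so they are in V. By enumeration,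
    three consecutive ones span a plane orthogonal to an image of the axis, and the
    vertices of V in such a plane are known. *)
Lemma face_orbit U V ga r m n (f : pt -> pt) (p : nat -> pt) w a :
  on_sphere V r -> syms_closed V -> axis_level V m ->
  triples_check U V ga (two_sided V) m -> seeds_check U V ->
  (2 < n)%N -> gam R n = ev ga -> similarity f -> regular_polygon n p -> w != 0 ->
  f @` hull (evvs V) `<=` [set x | dot w x <= a] ->
  polygon p = f @` hull (evvs V) `&` [set x | dot w x = a] ->
  exists2 g, g \in syms & range p = (f \o spt g) @` evvs (axis_face V m).
Proof.
move=> sV cV mV tV sdV n2 gE simf rp w0 wV pF.
have [h simh [fK hK]] := similarity_inv simf.
have [L [k [k0 fL Ll Lk wL]]] := similarity_linear simf.
have [w' wE w'k] := wL w.
have L0 : L 0 = 0 by have := fL 0 0; rewrite !subrr.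
have w'0 : w' != 0 by apply: contra_neq w0 => h0; rewrite wE h0 L0.
pose a' := (a - dot w (f 0)) / k.
have wf x : dot w (f x) = dot w (f 0) + k * dot w' x.
  by rewrite -w'k -[x in LHS]subr0 -(subrK (f 0) (f (x - 0))) subr0 fL subr0 dotDr addrC.
have wa x : dot w (f x) = a <-> dot w' x = a'.
  rewrite wf /a'; split=> [<-|->]; first by rewrite addrC addKr mulrC mulKf // gt_eqF.
  by rewrite mulrC divfK ?gt_eqF // addrC subrK.
have wle x : dot w (f x) <= a -> dot w' x <= a'.
  by rewrite wf /a' ler_pdivlMr // [_ * k]mulrC lerBrDl.
pose p' := h \o p.
have rp' : regular_polygon n p' := regular_similarity simh rp.
have pf : polygon p' = hull (evvs V) `&` [set x | dot w' x = a'].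
  have -> : polygon p' = h @` polygon p.
    rewrite /polygon image_chull; last exact: similarity_affine.
    by rewrite image_comp.
  rewrite pF; apply/seteqP; split.
    by move=> _ [_ [[x xV <-] /= xa] <-]; rewrite fK; split=> //; apply/wa.
  move=> x [xV /= xa]; exists (f x); last by rewrite fK.
  by split; [exists x|apply/wa].
have wV' x : evvs V x -> dot w' x <= a'.
  by move=> xV; apply: wle; apply: (wV (f x)); exists x => //; apply: sub_chull.
rewrite (hull_face wV') in pf.
have n0 : (0 < n)%N by lia.
have [c [rr pn]] := regular_ngon n0 rp'.
have range_p : range p' = evvs V `&` [set x | dot w' x = a'].
  apply: (@sphere_hull_inj _ _ _ c rr 0 (ev r)) pf => [_ [i _ <-]|x [xV _]].
    exact: (ngon_sq pn).
  by rewrite subr0; apply: evvs_sphere xV.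
have gb := gam_bound R n2; rewrite gE in gb pn.
have /andP[gl gr] := gb.
have pV i : evvs V (p' i).
  have : range p' (p' i) by exists i.
  by rewrite range_p => -[].
have wp i : dot w' (p' i) = a'.
  have : range p' (p' i) by exists i.
  by rewrite range_p => -[].
have wp3 : exists2 g, g \in syms &
    forall i, (i < 3)%N -> dot (spt g (evv axis)) (p' i) = ev m.
  apply: (consecutive_axis tV sdV cV gr pn pV) => g u v x gs hu hv hx.
  have sw0 : spt g w' != 0 by rewrite spt_neq0.
  apply: (two_sidedP gb (ngon_spt gs pn) sw0 _ _ hu hv hx (a := a')).
    by move=> i; rewrite /= spt_dot.
  move=> y yV; have : evvs V (evv y) by apply/evvsP; exists y.
  by rewrite -(syms_closedP cV gs) => -[z zV <-]; rewrite spt_dot //; exact: wV'.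
have [g gs wp3g] := wp3.
have nn : spt g (evv axis) != 0 by rewrite spt_neq0 // axis_neq0.
have [l l0 wn] := ngon_normals gb pn w'0 nn wp (wp3g 0%N isT) (wp3g 1%N isT) (wp3g 2%N isT).
exists g => //.
have la : a' = l * ev m by rewrite -(wp 0%N) wn dotZl wp3g.
have -> : range p = f @` range p'.
  apply/seteqP; split=> [_ [i _ <-]|_ [_ [i _ <-] <-]]; last by exists i => //; rewrite /p' /= hK.
  by exists (p' i); [exists i|rewrite /p' /= hK].
rewrite -image_comp -plane_vertices // range_p; congr (f @` (_ `&` _)).
apply/seteqP; split=> y /=; rewrite wn dotZl la; first by move/(mulfI l0).
by move=> ->.
Qed.

End Faces.

(** * The angles of octagons, decagons and pentagons *)

Section Angles.
Variable R : realType.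
Local Notation phi := (golden R).

Lemma cos_double (t : R) : cos (t + t) = 2 * cos t ^+ 2 - 1.
Proof. by rewrite cosD -!expr2; have := cos2Dsin2 t; lra. Qed.

Lemma gam_double n : (0 < n)%N -> gam R n = gam R n.*2 ^+ 2 - 2.
Proof.
move=> n0; have nz : n%:R != 0 :> R by rewrite pnatr_eq0; lia.
rewrite /gam; have -> : 2 * pi / n%:R = 2 * pi / n.*2%:R + 2 * pi / n.*2%:R :> R.
  by rewrite -muln2 natrM; field.
by rewrite cos_double; ring.
Qed.

Lemma gam_gt0 n : (4 < n)%N -> 0 < gam R n.
Proof.
move=> n4; have p0 : 0 < pi :> R by exact: pi_gt0.
have n0 : 0 < n%:R :> R by rewrite ltr0n; lia.
have n5 : 5%:R <= n%:R :> R by rewrite ler_nat.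
rewrite mulr_gt0 // cos_gt0_pihalf //; apply/andP; split.
  by apply: (@lt_trans _ _ 0); rewrite ?divr_gt0 ?mulr_gt0 // oppr_lt0 divr_gt0.
rewrite ltr_pdivrMr // mulrAC ltr_pdivlMr // mulrAC mulrC ltr_pM2l //; lra.
Qed.

Lemma gam8 : gam R 8 = Num.sqrt 2.
Proof.
have h := gam_double (isT : (0 < 4)%N).
have g4 : gam R 4 = 0.
  have e : 2 * pi / 4%:R = pi / 2 :> R by field.
  by rewrite /gam e cos_pihalf mulr0.
have g0 := gam_gt0 (isT : (4 < 8)%N).
rewrite -[LHS](ger0_norm (ltW g0)) -sqrtr_sqr; congr Num.sqrt.
by move: h; rewrite g4 /=; lra.
Qed.

(** With t = pi / 5, the equality of cos (3 t) and - cos (2 t) is a cubic equation for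
    2 cos t, with the roots -2, phi and 1 - phi. *)
Lemma gam10 : gam R 10 = phi.
Proof.
have g0 := gam_gt0 (isT : (4 < 10)%N).
pose t : R := 2 * pi / 10%:R.
have c3 : cos (t + t + t) = - cos (t + t).
  have -> : t + t + t = - (t + t) + pi by rewrite /t; field.
  by rewrite cosDpi cosN.
have s2 : sin (t + t) = 2 * sin t * cos t by rewrite sinD; ring.
have cs := cos2Dsin2 t.
move: c3; rewrite cosD s2 cos_double.
have -> : (2 * cos t ^+ 2 - 1) * cos t - 2 * sin t * cos t * sin t =
    (2 * cos t ^+ 2 - 1) * cos t - 2 * cos t * ((cos t ^+ 2 + sin t ^+ 2) - cos t ^+ 2) by ring.
rewrite cs => c3.
have gE : gam R 10 = 2 * cos t by [].
have g2 : (gam R 10 + 2) * (gam R 10 ^+ 2 - gam R 10 - 1) = 0 by rewrite gE; lra.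
have {}g2 : gam R 10 ^+ 2 - gam R 10 - 1 = 0.
  by move/eqP: g2; rewrite mulf_eq0 gt_eqF ?addr_gt0 //= => /eqP.
have : (gam R 10 - phi) * (gam R 10 + phi - 1) = 0.
  have := golden_sq R; lra.
have phi1 : 1 < phi by have := golden_lower R; lra.
by move/eqP; rewrite mulf_eq0 subr_eq0 => /orP[/eqP //|]; rewrite gt_eqF //; lra.
Qed.

Lemma gam5 : gam R 5 = phi - 1.
Proof. by rewrite gam_double // gam10 golden_sq; ring. Qed.

End Angles.

(** * Canonical decagons and the rotunda *)

(** The recurrence p (i + 3) = p i + (1 + ga) (p (i + 2) - p (i + 1)) does not involve
    the centre. *)
Fixpoint ngon_list (ga : zphi) (u v w : vphi) (n : nat) : seq vphi :=
  if n is n'.+1 then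
    u :: ngon_list ga v w (vadd u (vscale (gadd (gnat 1) ga) (vsub w v))) n'
  else [::].

Definition cyc (L : seq vphi) (j : nat) : vphi := nth axis L (j %% size L).

Definition ngon_check (L : seq vphi) (ga : zphi) (c : vphi) (r : zphi) : bool :=
  [&& (0 < size L)%N, gpos r & all (fun j =>
    let x k := vsub (cyc L (j + k)) c in
    [&& x 2 == vsub (vscale ga (x 1)) (x 0), vdot (x 0) (x 0) == r &
        gmul (gnat 2) (vdot (x 0) (x 1)) == gmul ga r]%N) (iota 0 (size L))].

Definition golden_z : zphi := (0, 1)%ZZ.

(** The equator of the icosidodecahedron orthogonal to the axis. *)
Definition equator : seq vphi :=
  ngon_list golden_z ((0, 2), (0, 0), (0, 0))%ZZ ((1, 1), (1, 0), (0, -1))%ZZ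
    ((1, 0), (0, 1), (-1, -1))%ZZ 10.

(** The face of the truncated dodecahedron orthogonal to the axis. *)
Definition decagon : seq vphi :=
  ngon_list golden_z ((-1, 1), (2, 1), (0, 0))%ZZ ((1, -1), (2, 1), (0, 0))%ZZ
    ((0, -1), (0, 2), (-1, 1))%ZZ 10.

Definition decagon_centre : vphi := vscale golden_z axis.

Definition rotunda : seq vphi :=
  [seq v <- icosidodecahedron | ~~ gpos (gopp (vdot axis v))].

Definition vzero : vphi := ((0, 0), (0, 0), (0, 0))%ZZ.

Section Canonical.
Variable R : realType.
Local Notation pt := 'cV[R]_3.
Local Notation phi := (golden R).
Local Notation ev := (evz phi).
Local Notation evv := (evv R).
Local Notation evvs := (@evvs R).

Lemma ev_golden : ev golden_z = phi.
Proof. by rewrite /evz /= ZR0 ZR1; ring. Qed.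

Lemma evv0 : evv vzero = 0.
Proof. by apply: pt_eq; rewrite !mxE /= /evz /= ZR0; ring. Qed.

(** Periodicity reduces the conditions on all indices to finitely many. *)
Lemma ngon_checkP L ga c r : ngon_check L ga c r ->
  ngon (ev ga) (ev r) (evv c) (fun j => evv (cyc L j)).
Proof.
case/and3P => L0 r0 /seq.allP H.
have cycE j k : cyc L (j + k) = cyc L (j %% size L + k) by rewrite /cyc modnDml.
have all_j j : let x k := vsub (cyc L (j + k)) c in
    [&& x 2 == vsub (vscale ga (x 1)) (x 0), vdot (x 0) (x 0) == r &
        gmul (gnat 2) (vdot (x 0) (x 1)) == gmul ga r]%N.
  have := H (j %% size L)%N; rewrite mem_iota add0n ltn_mod L0 => /(_ isT).
  by rewrite /= -!cycE.
split=> [|j|j|j]; first exact: ev_pos.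
- have /and3P[/eqP h _ _] := all_j j; rewrite -evv_sub.
  by rewrite -[j.+2]addn2 h evv_sub evv_scale !evv_sub addn1 addn0.
- have /and3P[_ /eqP h _] := all_j j.
  by rewrite -evv_sub dot_evv -h addn0.
- have /and3P[_ _ /eqP h] := all_j j.
  have := congr1 ev h; rewrite !ev_mul ev_nat -!dot_evv !evv_sub addn0 addn1 ZR2 => <-.
  by rewrite mulrAC divff ?mul1r.
Qed.

Lemma cyc_range L : (0 < size L)%N -> range (fun j => evv (cyc L j)) = evvs L.
Proof.
move=> L0; apply/seteqP; split=> [_ [j _ <-]|_ /evvsP[v /(nthP axis)[j jL <-] ->]].
  by apply/evvsP; exists (cyc L j) => //; rewrite mem_nth // ltn_mod.
by exists j => //; rewrite /cyc modn_small.
Qed.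

Lemma cyc_mod L n j : size L = n -> cyc L (j %% n) = cyc L j.
Proof. by move=> <-; rewrite /cyc modn_mod. Qed.

Lemma cyc_modS L n j : size L = n -> cyc L (j %% n).+1 = cyc L j.+1.
Proof. by move=> <-; rewrite /cyc -addn1 modnDml addn1. Qed.

Lemma equator_ngon : ngon phi (ev (4, 4)%ZZ) 0 (fun j => evv (cyc equator j)).
Proof. by rewrite -evv0 -{1}ev_golden; apply: ngon_checkP; vm_compute. Qed.

Lemma decagon_ngon : ngon phi (ev (4, 0)%ZZ) (evv decagon_centre) (fun j => evv (cyc decagon j)).
Proof. by rewrite -{1}ev_golden; apply: ngon_checkP; vm_compute. Qed.

Lemma decagon_regular : regular_polygon 10 (fun j => evv (cyc decagon j)).
Proof. by apply: (ngon_regular (isT : (2 < 10)%N)); rewrite gam10; exact: decagon_ngon. Qed.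

Lemma evvs_eq L L' : all (mem L') L -> all (mem L) L' -> evvs L = evvs L'.
Proof.
move=> /seq.allP h /seq.allP h'; apply/seteqP.
by split=> x /evvsP[v vL ->]; apply/evvsP; exists v => //; [exact: h|exact: h'].
Qed.

(** Cutting a hull by a half-space creates no new points when the cross-section is
    already spanned: if the projection pr to the bounding plane maps S into D, a
    segment between points of S leaves the half-space through D. *)
Lemma half_space_hull (S C D : set pt) (n : pt) (pr : pt -> pt) :
  convex C -> convex D -> D `<=` C -> affine pr ->
  (forall x, dot n x = 0 -> pr x = x) -> (forall x, S x -> D (pr x)) ->
  (forall x, S x -> 0 <= dot n x -> C x) ->
  hull S `&` [set x | 0 <= dot n x] `<=` C.
Proof.
move=> cC cD DC af fixed SD SC.
pose K := [set y | D (pr y) /\ (0 <= dot n y -> C y)].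
have cross y z s t : K y -> K z -> 0 <= s -> 0 <= t -> s + t = 1 ->
    0 <= dot n y -> dot n z < 0 -> 0 <= dot n (s *: y + t *: z) -> C (s *: y + t *: z).
  move=> [Dy Cy] [Dz _] s0 t0 st ny nz; rewrite !dotL => nyz.
  have [tz|tn] := eqVneq t 0.
    by rewrite tz scale0r addr0 (_ : s = 1) ?scale1r; [exact: Cy|lra].
  have tp : 0 < t by rewrite lt_neqAle eq_sym tn.
  have al0 : 0 < dot n y.
    rewrite lt_neqAle ny eq_sym andbT; apply/eqP => h; move: nyz; rewrite h mulr0 add0r.
    by rewrite pmulr_rge0 // leNgt nz.
  have [be beE] : exists be, dot n z = - be by exists (- dot n z); rewrite opprK.
  rewrite beE oppr_lt0 in nz nyz; rename nz into be0.
  have [al alE] : exists al, dot n y = al by eexists.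
  rewrite alE in al0 nyz.
  have sum0 : 0 < al + be by rewrite addr_gt0.
  have sumn : al + be != 0 by rewrite gt_eqF.
  have aln : al != 0 by rewrite gt_eqF.
  pose q := (be / (al + be)) *: y + (al / (al + be)) *: z.
  have w1 : be / (al + be) + al / (al + be) = 1 by field.
  have Cq : C q.
    apply: DC; rewrite -(fixed q); last first.
      by rewrite /q !dotL alE beE; field.
    rewrite /q af //; apply: (convex_comb cD) => //; rewrite divr_ge0 // ltW //.
  have -> : s *: y + t *: z = (s - t * be / al) *: y + (t * (al + be) / al) *: q.
    by rewrite /q; apply: pt_eq; rewrite !mxE; field; rewrite sumn.
  apply: (convex_comb cC) => //.
  - by rewrite subr_ge0 ler_pdivrMr //; lra.
  - by rewrite divr_ge0 ?mulr_ge0 // ltW.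
  - by rewrite -st; field.
  - exact: Cy.
have cK : convex K.
  split=> y z s t s0 t0 st Ky Kz; split.
    by rewrite af //; apply: (convex_comb cD) => //; [case: Ky|case: Kz].
  move=> nyz; have [ny|ny] := lerP 0 (dot n y); have [nz|nz] := lerP 0 (dot n z).
  - by apply: (convex_comb cC) => //; [apply: Ky.2|apply: Kz.2].
  - exact: cross.
  - by rewrite addrC; apply: cross => //; rewrite addrC.
  - move: nyz; rewrite !dotL => nyz.
    have h1 : s * dot n y <= 0 by rewrite mulr_ge0_le0 // ltW.
    have h2 : t * dot n z <= 0 by rewrite mulr_ge0_le0 // ltW.
    have [s1|s1] := eqVneq s 0.
      by have : t = 1 by [lra]; move=> t1; rewrite t1 mul1r s1 mul0r add0r leNgt nz in nyz.
    have : s * dot n y < 0 by rewrite pmulr_rlt0 // lt_neqAle eq_sym s1.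
    by lra.
by move=> x [/(chull_min cK (fun y Sy => conj (SD y Sy) (SC y Sy)))[_ h]] /h.
Qed.

(** The shadow of the icosidodecahedron along the axis is the equatorial decagon:
    every vertex lies over a vertex of the decagon or over a multiple, by a factor of
    at most one, of the midpoint of an edge. So [half_space_hull] applies. *)
Lemma rotunda_hull :
  hull (evvs icosidodecahedron) `&` [set x | 0 <= dot (evv axis) x] = hull (evvs rotunda).
Proof.
have nn : dot (evv axis) (evv axis) = 2 + phi.
  by rewrite dot_evv /evz /= ZR1 ZR2; ring.
have n0 : 2 + phi != 0 by rewrite gt_eqF // addr_gt0 ?golden_gt0.
pose pr (x : pt) := x - (dot (evv axis) x / (2 + phi)) *: evv axis.
apply/seteqP; split.
  apply: (half_space_hull (D := hull (evvs equator)) (pr := pr)); try exact: chull_convex.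
  - apply: chull_sub => x /evvsP[v vE ->]; apply/evvsP; exists v => //.
    have : all (mem rotunda) equator by vm_compute.
    by move/seq.allP; apply.
  - by move=> x y a b ab; rewrite /pr !dotL; apply: pt_eq; rewrite !mxE; field.
  - by move=> x h; rewrite /pr h mul0r scale0r subr0.
  - move=> x /evvsP[v vI ->].
    have H : all (fun v => has (fun j =>
        let y := vsub (vscale (2, 1)%ZZ v) (vscale (vdot axis v) axis) in
        let d := vadd (cyc equator j) (cyc equator j.+1) in
        [|| y == vscale (2, 1)%ZZ (cyc equator j), y == d | y == vscale golden_z d])
        (iota 0 10)) icosidodecahedron by vm_compute.
    have /seq.hasP[j _ jP] := seq.allP H _ vI; clear H.
    have d_in i : evvs equator (evv (cyc equator i)).
      by rewrite -cyc_range //; exists i.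
    have prE : pr (evv v) = (2 + phi)^-1 *: evv (vsub (vscale (2, 1)%ZZ v) (vscale (vdot axis v) axis)).
      rewrite /pr dot_evv evv_sub !evv_scale (_ : ev (2, 1)%ZZ = 2 + phi); last first.
        by rewrite /evz /= ZR1 ZR2; ring.
      move: (evv v) (evv axis) (ev (vdot axis v)) => y z k.
      by apply: pt_eq; rewrite !mxE; field.
    have mid k : 0 <= k -> 2 * k <= 1 ->
        hull (evvs equator) (k *: (evv (cyc equator j) + evv (cyc equator j.+1))).
      move=> k0 k1.
      have h0 : 0 <= 2^-1 :> R by rewrite invr_ge0.
      have h2 : 2^-1 + 2^-1 = 1 :> R by field.
      have d_in' i : hull (evvs equator) (evv (cyc equator i)) by apply: sub_chull; exact: d_in.
      have e0 : hull (evvs equator) 0.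
        have -> : 0 = 2^-1 *: evv (cyc equator 0) + 2^-1 *: evv (cyc equator 5).
          have Z : vadd (cyc equator 0) (cyc equator 5) = vzero by vm_compute.
          by rewrite -scalerDr -evv_add Z evv0 scaler0.
        exact: (convex_comb (chull_convex _) h0 h0 h2 (d_in' _) (d_in' _)).
      have e1 : hull (evvs equator) (2^-1 *: evv (cyc equator j) + 2^-1 *: evv (cyc equator j.+1)).
        exact: (convex_comb (chull_convex _) h0 h0 h2 (d_in' _) (d_in' _)).
      have := @convex_comb _ _ _ (chull_convex _) _ _ (2 * k) (1 - 2 * k) _ _ _ e1 e0.
      rewrite scaler0 addr0 -scalerDr scalerA (_ : 2 * k * 2^-1 = k); last by field.
      by apply; lra.
    have s0 : 0 < 2 + phi by rewrite addr_gt0 ?golden_gt0.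
    case/or3P: jP => /eqP h; rewrite prE h {h}.
    + rewrite evv_scale (_ : ev (2, 1)%ZZ = 2 + phi); last by rewrite /evz /= ZR1 ZR2; ring.
      by rewrite scalerA mulVf // scale1r; apply: sub_chull.
    + rewrite evv_add; apply: mid; first by rewrite invr_ge0 ltW.
      by rewrite mulrC ler_pdivrMl // mulr1; have := golden_gt0 R; lra.
    + rewrite evv_scale evv_add scalerA ev_golden; apply: mid.
        by rewrite mulr_ge0 ?invr_ge0 ?(ltW s0) // ltW // golden_gt0.
      rewrite mulrCA mulrC ler_pdivrMr // mul1r; have := golden_upper R; lra.
  - move=> x /evvsP[v vI ->]; rewrite dot_evv => h; apply: sub_chull; apply/evvsP; exists v => //.
    rewrite mem_filter vI andbT; apply/negP => /(ev_pos R); rewrite ev_opp oppr_gt0.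
    by rewrite ltNge h.
move=> x hx; split.
  by apply: chull_sub hx => y /evvsP[v + ->]; rewrite mem_filter => /andP[_ vI]; apply/evvsP; exists v.
have : [set x | 0 <= dot (evv axis) x] = [set x | dot (- evv axis) x <= 0].
  by apply/seteqP; split=> y; rewrite /= dotNl oppr_le0.
move=> ->; apply: (chull_min (halfspace_convex (- evv axis) 0) _ hx) => y /evvsP[v + ->].
rewrite mem_filter => /andP[h vI]; rewrite /= dotNl oppr_le0 dot_evv.
have : all (fun v => gpos (gopp (vdot axis v)) || (vdot axis v == (0, 0)%ZZ) || gpos (vdot axis v))
   icosidodecahedron by vm_compute.
move=> /seq.allP /(_ _ vI); rewrite (negbTE h) /= => /orP[/eqP->|/(ev_pos R)/ltW //].
by rewrite /evz /= ZR0 mul0r addr0.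
Qed.

End Canonical.

(** Representatives of the vertices under the pyritohedral group. *)
Definition icosidodecahedron_seeds : seq vphi :=
  [:: ((0, 0), (0, 0), (0, 2)); ((1, 0), (0, 1), (1, 1))]%ZZ.
Definition truncated_dodecahedron_seeds : seq vphi :=
  [:: ((0, 0), (-1, 1), (2, 1)); ((-1, 1), (0, 1), (0, 2)); ((0, 1), (2, 0), (1, 1))]%ZZ.
Definition rhombicosidodecahedron_seeds : seq vphi :=
  [:: ((1, 0), (1, 0), (1, 2)); ((1, 1), (0, 1), (0, 2)); ((2, 1), (0, 0), (1, 1))]%ZZ.

(** Here 3 + 3 phi is the largest scalar product of a vertex with the axis. *)
Definition pentagon : seq vphi := axis_face rhombicosidodecahedron (3, 3)%ZZ.

Lemma icosidodecahedron_closed : syms_closed icosidodecahedron.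
Proof. by vm_compute. Qed.

Lemma icosidodecahedron_triples :
  triples_check icosidodecahedron_seeds icosidodecahedron golden_z off_centre (0, 0)%ZZ /\
  seeds_check icosidodecahedron_seeds icosidodecahedron.
Proof. by vm_compute. Qed.

Lemma icosidodecahedron_level : axis_level icosidodecahedron (0, 0)%ZZ.
Proof. by vm_compute. Qed.

Lemma truncated_dodecahedron_closed : syms_closed truncated_dodecahedron_list.
Proof. by vm_compute. Qed.

Lemma truncated_dodecahedron_sphere : on_sphere truncated_dodecahedron_list (7, 4)%ZZ.
Proof. by vm_compute. Qed.

Lemma truncated_dodecahedron_level : axis_level truncated_dodecahedron_list (1, 3)%ZZ.
Proof. by vm_compute. Qed.

Lemma truncated_dodecahedron_triples :
  triples_check truncated_dodecahedron_seeds truncated_dodecahedron_list golden_z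
    (two_sided truncated_dodecahedron_list) (1, 3)%ZZ /\
  seeds_check truncated_dodecahedron_seeds truncated_dodecahedron_list.
Proof. by vm_compute. Qed.

Lemma rhombicosidodecahedron_closed : syms_closed rhombicosidodecahedron.
Proof. by vm_compute. Qed.

Lemma rhombicosidodecahedron_sphere : on_sphere rhombicosidodecahedron (7, 8)%ZZ.
Proof. by vm_compute. Qed.

Lemma rhombicosidodecahedron_level : axis_level rhombicosidodecahedron (3, 3)%ZZ.
Proof. by vm_compute. Qed.

Lemma rhombicosidodecahedron_triples :
  triples_check rhombicosidodecahedron_seeds rhombicosidodecahedron (-1, 1)%ZZ
    (two_sided rhombicosidodecahedron) (3, 3)%ZZ /\
  seeds_check rhombicosidodecahedron_seeds rhombicosidodecahedron.
Proof. by vm_compute. Qed.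

(** So the triangular faces stand on the edges of odd index. *)
Lemma decagon_edges : all (fun j => odd j || all (fun v =>
    let sq x y := vdot (vsub x y) (vsub x y) in
    let d := sq (cyc decagon j) (cyc decagon j.+1) in
    gdiffer (sq (cyc decagon j) v) d || gdiffer (sq (cyc decagon j.+1) v) d)
    truncated_dodecahedron_list) (iota 0 10).
Proof. by vm_compute. Qed.

Lemma equator_axis : all (mem equator) (axis_face icosidodecahedron (0, 0)%ZZ) /\
  all (mem (axis_face icosidodecahedron (0, 0)%ZZ)) equator.
Proof. by vm_compute. Qed.

Lemma decagon_axis : all (mem decagon) (axis_face truncated_dodecahedron_list (1, 3)%ZZ) /\
  all (mem (axis_face truncated_dodecahedron_list (1, 3)%ZZ)) decagon.
Proof. by vm_compute. Qed.

Section Frames.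
Variable R : realType.
Local Notation pt := 'cV[R]_3.
Local Notation phi := (golden R).
Local Notation ev := (evz phi).
Local Notation evv := (evv R).
Local Notation evvs := (@evvs R).
Local Notation equator_pt := (fun j => evv (cyc equator j)).
Local Notation decagon_pt := (fun j => evv (cyc decagon j)).

Lemma spt_sneg g (x : pt) : spt (scomp g sneg) x = - spt g x.
Proof.
have E : spt sneg x = - x by apply: pt_eq; rewrite !mxE.
by rewrite spt_comp E -[- x]sub0r sptB spt0 sub0r.
Qed.

(** The planes that miss the centre are excluded by [off_centre], and the enumeration leaves
    those orthogonal to the images of the axis. The point reflection is one of the
    symmetries, which allows k to be positive. *)
Lemma icosidodecahedron_axis (p : nat -> pt) w : regular_polygon 10 p -> w != 0 ->
  (forall i, icosidodecahedron_vertices (p i) /\ dot w (p i) = 0) ->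
  exists2 g, g \in syms & exists2 k, 0 < k & w = k *: spt g (evv axis).
Proof.
move=> rp w0 pw.
have [c [r pn]] := regular_ngon (isT : (0 < 10)%N) rp.
have gb := gam_bound R (isT : (2 < 10)%N).
rewrite gam10 -ev_golden in pn gb; have /andP[_ g2] := gb.
have pV i : evvs icosidodecahedron (p i) by rewrite -icosidodecahedronE; exact: (pw i).1.
have wp i : dot w (p i) = 0 := (pw i).2.
have [tc sc] := icosidodecahedron_triples.
have [g u v x gs hu hv hx|g gs ga] :=
    consecutive_axis tc sc icosidodecahedron_closed g2 pn pV; clear tc sc.
  (* the normal w of the plane is a multiple of the cross product *)
  have d0 y : p y = p y -> dot (spt g w) (spt g (p y)) = 0 by rewrite spt_dot.
  have wu := d0 0%N erefl; have wv := d0 1%N erefl; have wx := d0 2%N erefl.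
  rewrite hu in wu; rewrite hv in wv; rewrite hx in wx.
  have sw0 : spt g w != 0 by rewrite spt_neq0.
  have [N1 N2] := vcross_orth R u v.
  rewrite /off_centre; apply/negbTE/negP => h.
  have nx0 : dot (evv (vcross u v)) (evv x) != 0.
    by case/orP: h => /(ev_pos R); rewrite ?ev_opp ?oppr_gt0 dot_evv => h; [rewrite gt_eqF|rewrite lt_eqF].
  have n0 : evv (vcross u v) != 0 by apply: contra_neq nx0 => ->; rewrite dot0l.
  have gram : dot (evv u) (evv u) * dot (evv v) (evv v) - dot (evv u) (evv v) ^+ 2 != 0.
    have -> : dot (evv u) (evv u) * dot (evv v) (evv v) - dot (evv u) (evv v) ^+ 2 =
        dot (evv (vcross u v)) (evv (vcross u v)).
      case: (u) => [[a b] c0]; case: (v) => [[d e] f].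
      by rewrite !dotE !mxE /= !(ev_add, ev_opp, ev_mul); ring.
    by rewrite dot_eq0.
  have E := normals_collinear gram sw0 wu wv N1 N2.
  by move: nx0; rewrite E dotZl wx mulr0 eqxx.
have nn : spt g (evv axis) != 0 by rewrite spt_neq0 // axis_neq0.
have e0 : ev (0, 0)%ZZ = 0 by rewrite /evz /= ZR0 mul0r addr0.
rewrite e0 in ga.
have [k k0 wE] := ngon_normals gb pn w0 nn wp (ga 0%N isT) (ga 1%N isT) (ga 2%N isT).
have [kn|kp] := ltrP k 0; last first.
  by exists g => //; exists k => //; rewrite lt_neqAle eq_sym k0.
exists (scomp g sneg); first by rewrite scomp_in.
by exists (- k); rewrite ?oppr_gt0 // spt_sneg scalerN scaleNr opprK.
Qed.

(** The symmetry that moves the axis to the normal of the cutting plane gives the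
    standard rotunda. Its equator contains the vertices of the base, and both have ten
    elements. *)
Lemma rotunda_frame (A : set pt) b : pentagonal_rotunda A b ->
  exists f, [/\ similarity f, A = f @` hull (evvs rotunda), regular_polygon 10 b &
    range b = range (f \o equator_pt)].
Proof.
move=> [f [p [w [[simf w0] rp pw -> ->]]]].
have [g gs [k k0 wE]] := icosidodecahedron_axis rp w0 pw.
have simg := spt_similarity R gs.
exists (f \o spt g); split.
- exact: similarity_comp.
- rewrite -image_comp -rotunda_hull; congr (f @` _); rewrite icosidodecahedronE.
  have E : hull (evvs icosidodecahedron) = spt g @` hull (evvs icosidodecahedron).
    rewrite image_chull; last exact: similarity_affine.
    by rewrite (syms_closedP R icosidodecahedron_closed gs).
  apply/seteqP; split.
    move=> x [xI /= xw]; move: (xI); rewrite {1}E => -[y yI yx]; exists y => //; split=> //=.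
    by move: xw; rewrite wE -yx dotZl (spt_dot _ _ gs) pmulr_rge0; [|exact: k0].
  move=> _ [y [yI /= yn] <-]; split; first by rewrite E; exists y.
  rewrite /= wE dotZl (spt_dot _ _ gs); apply: mulr_ge0 yn; exact: ltW.
- exact: regular_similarity.
have img : range (f \o p) = f @` range p by rewrite image_comp.
have -> : range ((f \o spt g) \o equator_pt) = f @` (spt g @` range equator_pt).
  by rewrite !image_comp.
rewrite img cyc_range //; congr (f @` _).
have eqE : evvs (axis_face icosidodecahedron (0, 0)%ZZ) = evvs equator.
  by case: equator_axis; exact: evvs_eq.
have e0 : ev (0, 0)%ZZ = 0 by rewrite /evz /= ZR0 mul0r addr0.
have pl := plane_vertices R icosidodecahedron_level icosidodecahedron_closed gs.
rewrite e0 eqE in pl.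
have sub x : range p x -> (spt g @` evvs equator) x.
  move=> [i _ <-]; rewrite -pl; have [pI pw0] := pw i; split.
    by rewrite -icosidodecahedronE.
  by apply/eqP; move/eqP: pw0; rewrite wE dotZl mulf_eq0 gt_eqF.
apply/seteqP; split=> // x.
pose s1 := [seq p i | i <- iota 0 10]; pose s2 := [seq spt g (evv v) | v <- equator].
have u1 : uniq s1.
  rewrite map_inj_in_uniq ?iota_uniq // => i j; rewrite !mem_iota !add0n => hi hj.
  exact: (regular_inj (isT : (0 < 10)%N) rp).
have s12 : {subset s1 <= s2}.
  move=> y /mapP[i _ ->]; have : range p (p i) by exists i.
  by move=> /sub[z /evvsP[v vE ->] <-]; apply: (map_f (fun v => spt g (evv v))).
have [_ eq12] := uniq_min_size u1 s12 (ltac:(by rewrite !size_map) : (size s2 <= size s1)%N).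
move=> [z /evvsP[v vE ->] <-].
have : spt g (evv v) \in s2 by apply: (map_f (fun v => spt g (evv v))).
by rewrite -eq12 => /mapP[i _ ->]; exists i.
Qed.

Lemma truncated_dodecahedron_face n f (p : nat -> pt) w a :
  gam R n = phi -> (2 < n)%N -> similarity f -> regular_polygon n p -> w != 0 ->
  f @` hull (evvs truncated_dodecahedron_list) `<=` [set x | dot w x <= a] ->
  polygon p = f @` hull (evvs truncated_dodecahedron_list) `&` [set x | dot w x = a] ->
  exists2 g, g \in syms & range p = range (f \o spt g \o decagon_pt).
Proof.
move=> gn n2 simf rp w0 wT pT.
rewrite -ev_golden in gn.
have [tc sc] := truncated_dodecahedron_triples.
have [g gs E] := face_orbit truncated_dodecahedron_sphere truncated_dodecahedron_closed
  truncated_dodecahedron_level tc sc n2 gn simf rp w0 wT pT.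
clear tc sc; exists g; first exact: gs.
have dE : evvs (axis_face truncated_dodecahedron_list (1, 3)%ZZ) = evvs decagon.
  by case: decagon_axis; exact: evvs_eq.
by rewrite E dE -cyc_range // !image_comp.
Qed.

Lemma rhombicosidodecahedron_face f (p : nat -> pt) w a :
  similarity f -> regular_polygon 5 p -> w != 0 ->
  f @` hull (evvs rhombicosidodecahedron) `<=` [set x | dot w x <= a] ->
  polygon p = f @` hull (evvs rhombicosidodecahedron) `&` [set x | dot w x = a] ->
  exists2 g, g \in syms & range p = (f \o spt g) @` evvs pentagon.
Proof.
move=> simf rp w0 wT pT.
have [tc sc] := rhombicosidodecahedron_triples.
have g5 : gam R 5 = ev (-1, 1)%ZZ by rewrite gam5 /evz /= ZR1 (ZRN R 1) ZR1; ring.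
exact: (face_orbit rhombicosidodecahedron_sphere rhombicosidodecahedron_closed
  rhombicosidodecahedron_level tc sc (isT : (2 < 5)%N) g5 simf rp w0 wT pT).
Qed.

(** The vertices of the triangle and those of the solid on the face lie on spheres, so
    equal hulls have equal generators. *)
Lemma triangle_vertex V r f (x y z : pt) :
  on_sphere V r -> similarity f -> equilateral x y z ->
  is_face (f @` hull (evvs V)) (hull [set x; y; z]) -> (f @` evvs V) z.
Proof.
move=> sV simf [h1 h2] [w [a [w0 wV wF]]].
have [L [k [k0 fL _ Lk _]]] := similarity_linear simf.
rewrite image_chull in wV wF; last exact: similarity_affine.
have wV' u : (f @` evvs V) u -> dot w u <= a by move=> uV; apply: wV; apply: sub_chull.
move: wF; rewrite -hullE (hull_face wV').
have d1 := dist_eq h1; have d2 := dist_eq h2.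
pose c := 3^-1 *: (x + y + z).
have eqd : dot (x - c) (x - c) = dot (z - c) (z - c) /\ dot (y - c) (y - c) = dot (z - c) (z - c).
  have n3 : 3%:R != 0 :> R by rewrite pnatr_eq0.
  move: d1 d2; rewrite /c !dotL !(dotC y x) !(dotC z x) !(dotC z y) => d1 d2.
  by split; lra.
move=> /(sphere_hull_inj (c := c) (r := dot (z - c) (z - c)) (c' := f 0) (r' := k * ev r)) E.
have : [set x; y; z] z by right.
rewrite E => [[]//| u [[->|->]|->] | u [[v vV <-] _]]; [by case: eqd|by case: eqd|by []|].
by rewrite fL subr0 Lk (evvs_sphere sV vV).
Qed.

(** By [decagon_edges], the third vertex of a triangle on an edge of even index would
    not be a vertex of the solid. *)
Lemma decagon_triangle_edge f g (x y z : pt) j : similarity f -> g \in syms ->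
  same_edge x y (f (spt g (decagon_pt j))) (f (spt g (decagon_pt j.+1))) ->
  equilateral x y z ->
  is_face (f @` hull (evvs truncated_dodecahedron_list)) (hull [set x; y; z]) -> odd j.
Proof.
move=> simf gs xy eqz zF.
have [z' zV zE] := triangle_vertex truncated_dodecahedron_sphere simf eqz zF.
move: zV; rewrite -(syms_closedP R truncated_dodecahedron_closed gs) => -[_ /evvsP[v vT ->] vz].
have [L [k [k0 fL _ Lk _]]] := similarity_linear simf.
have sqf u u' : dot (f (spt g (evv u)) - f (spt g (evv u'))) (f (spt g (evv u)) - f (spt g (evv u'))) =
    k * ev (vdot (vsub u u') (vsub u u')).
  by rewrite fL Lk -sptB spt_dot // -evv_sub dot_evv.
have kn : k != 0 by rewrite gt_eqF.
have [h1 h2] := eqz.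
have [q1 q2] := (dist_eq h1, dist_eq h2).
have dC (u u' : pt) : dot (u - u') (u - u') = dot (u' - u) (u' - u).
  by rewrite -(opprB u' u) dotNl dotNr opprK.
have sqv u : dot (f (spt g (evv u)) - z) (f (spt g (evv u)) - z) = k * ev (vdot (vsub u v) (vsub u v)).
  by rewrite -sqf vz zE.
have sqe := sqf (cyc decagon j) (cyc decagon j.+1).
have [s1 s2] : ev (vdot (vsub (cyc decagon j) v) (vsub (cyc decagon j) v)) =
      ev (vdot (vsub (cyc decagon j) (cyc decagon j.+1)) (vsub (cyc decagon j) (cyc decagon j.+1))) /\
    ev (vdot (vsub (cyc decagon j.+1) v) (vsub (cyc decagon j.+1) v)) =
      ev (vdot (vsub (cyc decagon j) (cyc decagon j.+1)) (vsub (cyc decagon j) (cyc decagon j.+1))).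
  split; apply: (mulfI kn); rewrite -sqv -sqe; case: xy => -[<- <-].
  - by rewrite q1 q2 dC.
  - by rewrite -q1 dC.
  - by rewrite -q1.
  - by rewrite [RHS]dC q1 q2 dC.
have jm i : cyc decagon (j + i) = cyc decagon (j %% 10 + i) by rewrite /cyc modnDml.
have j1 : cyc decagon j.+1 = cyc decagon (j %% 10).+1 by rewrite -addn1 jm addn1.
have j0 : cyc decagon j = cyc decagon (j %% 10) by rewrite -{1}[j]addn0 jm addn0.
rewrite j0 j1 in s1 s2.
have := seq.allP decagon_edges (j %% 10)%N; rewrite mem_iota add0n ltn_mod => /(_ isT).
have -> : odd (j %% 10) = odd j by rewrite {2}(divn_eq j 10) oddD oddM andbF.
case/orP=> [//|/seq.allP/(_ _ vT)].
by case/orP=> h; [have := etrans (esym (gdifferP s1)) h|have := etrans (esym (gdifferP s2)) h].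
Qed.

End Frames.

(** * Numerical data over the golden ratio *)

(** The sum of the s_i * l_i for the coefficients s_i that are given at evaluation. *)
Definition layers (l : seq vphi) : cpt :=
  ([seq v.1.1 | v <- l], [seq v.1.2 | v <- l], [seq v.2 | v <- l]).

Definition bint (k z : Z) : zball := (Z.shiftl z k, 0%ZZ).
(** The balls contain the numbers multiplied by 2 ^ k. *)
Definition golden_ball (k : Z) : zball := bshift 1 (badd (bint k 1) (bsqrt k (bint k 5))).
Definition sigma_square (k : Z) : zball := badd (bint k 2) (golden_ball k).
Definition sigma_ball (k : Z) : zball := bsqrt k (sigma_square k).
Definition zeta_square (k : Z) : zball := badd
  (badd (bint k 5) (bscale (-10) (golden_ball k)))
  (badd (bscale 15 (sigma_ball k))
     (bscale (-5) (bshift k (bmul (sigma_ball k) (golden_ball k))))).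
Definition zeta_ball (k : Z) : zball := bsqrt k (zeta_square k).
Definition bnonneg (b : zball) : bool := (b.2 <=? b.1)%ZZ.

Section Balls.
Variable R : realType.
Local Notation pt := 'cV[R]_3.
Local Notation phi := (golden R).
Local Notation evv := (evv R).
Local Notation evvs := (@evvs R).
Local Notation pw := (pow2 R).

(** For the decagonal antiprism, gam is phi: by [antiprism_vertices], the second base
    needs the inverse of sigma, and the square of the height is proportional to
    sigma - phi, hence to the square of zeta, see [zeta_sq]. *)
Definition sigma : R := Num.sqrt (2 + phi).
Definition zeta : R := Num.sqrt (5 - 10 * phi + (15 * sigma - 5 * (sigma * phi))).

Lemma evp_layer ss v : evp phi (1 :: ss) (layers [:: v]) = evv v.
Proof. by rewrite /evp /evv /= !mulr1; case: ss => [|s ss]; rewrite /= !addr0. Qed.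

Lemma evvs_layers V : evvs V = [set` map (evp phi [:: 1]) [seq layers [:: v] | v <- V]].
Proof.
rewrite -map_comp /evvs (@eq_map _ _ evv (evp phi [:: 1] \o (fun v => layers [:: v]))) //.
by move=> v; rewrite [RHS]evp_layer.
Qed.

Lemma evp_layers s t u v w :
  evp phi [:: 1; s; t] (layers [:: u; v; w]) = evv u + s *: evv v + t *: evv w.
Proof. by apply: pt_eq; rewrite !mxE /=; ring. Qed.

Lemma odd_mod j n : ~~ odd n -> odd (j %% n) = odd j.
Proof. by move=> ne; rewrite [in RHS](divn_eq j n) oddD oddM (negbTE ne) andbF. Qed.

Lemma map_cat_set (T : Type) (F : T -> pt) L L' :
  [set` map F (L ++ L')] = [set` map F L] `|` [set` map F L'].
Proof. by rewrite map_cat; apply/seteqP; split=> x; rewrite /= mem_cat => /orP. Qed.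

(** A periodic family of points is the image of one period. *)
Lemma range_mod (T : Type) (F : nat -> T) (G : T -> pt) (P : pred nat) n : (0 < n)%N ->
  (forall j, F j = F (j %% n)%N) -> (forall j, P j = P (j %% n)%N) ->
  [set x | exists2 j, P j & x = G (F j)] = [set` map G [seq F j | j <- iota 0 n & P j]].
Proof.
move=> n0 FE PE; apply/seteqP; split=> x.
  move=> [j Pj ->]; rewrite FE /= -map_comp; apply/mapP; exists (j %% n)%N => //.
  by rewrite mem_filter -PE Pj mem_iota ltn_mod n0.
rewrite /= -map_comp => /mapP[j]; rewrite mem_filter => /andP[Pj _] ->.
by exists j.
Qed.

Lemma range_mod_full (T : Type) (F : nat -> T) (G : T -> pt) n : (0 < n)%N ->
  (forall j, F j = F (j %% n)%N) -> range (fun j => G (F j)) = [set` map G [seq F j | j <- iota 0 n]].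
Proof.
move=> n0 FE; have := range_mod G (P := predT) n0 FE (fun=> erefl); rewrite filter_predT => <-.
by apply/seteqP; split=> x [j]; [move=> _ <-; exists j|move=> _ ->; exists j].
Qed.

Lemma inb_int k z : (0 <= k)%ZZ -> inb (bint k z) (pw k * ZR R z).
Proof. by move=> k0; rewrite /bint Z.shiftl_mul_pow2 // /pow2 mulrC -ZRM; exact: inb_exact. Qed.

Lemma bnonnegP b : bnonneg b -> (0 <= b.1 - b.2)%ZZ.
Proof. by rewrite /bnonneg; lia. Qed.

Lemma inb_golden k : (0 <= k)%ZZ -> inb (golden_ball k) (pw k * phi).
Proof.
move=> k0.
have -> : pw k * phi = (pw k * ZR R 1 + pw k * Num.sqrt (ZR R 5)) / pow2 R 1.
  by rewrite /golden ZR1 -mulrDr mulrA.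
apply: inb_shift => //; apply: inb_add; first exact: inb_int.
apply: inb_sqrt => //; last exact: inb_int.
by rewrite /bint /= Z.sub_0_r; apply/Z.shiftl_nonneg.
Qed.

Lemma inb_sigma k : (0 <= k)%ZZ -> bnonneg (sigma_square k) -> inb (sigma_ball k) (pw k * sigma).
Proof.
move=> k0 /bnonnegP b0; apply: inb_sqrt => //; rewrite mulrDr.
by apply: inb_add; [rewrite -ZR2; exact: inb_int|exact: inb_golden].
Qed.

Lemma inb_zeta k : (0 <= k)%ZZ -> bnonneg (sigma_square k) -> bnonneg (zeta_square k) ->
  inb (zeta_ball k) (pw k * zeta).
Proof.
move=> k0 b0 /bnonnegP b1.
have p0 : pw k != 0 by rewrite gt_eqF // pow2_gt0.
have E : pw k * (5 - 10 * phi + (15 * sigma - 5 * (sigma * phi))) =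
    (pw k * 5 + (- 10) * (pw k * phi)) +
    (15 * (pw k * sigma) + (- 5) * ((pw k * sigma) * (pw k * phi) / pw k)).
  by field.
apply: inb_sqrt => //; rewrite E {E}.
have -> : - 10 = ZR R (-10) by rewrite (ZRN R 10).
have -> : - 5 = ZR R (-5) by rewrite (ZRN R 5).
have hg := inb_golden k0; have hs := inb_sigma k0 b0.
apply: inb_add; first by apply: inb_add; [exact: inb_int|exact: inb_scale].
apply: inb_add; first exact: inb_scale.
by apply/inb_scale/inb_shift => //; exact: inb_mul.
Qed.

Lemma inb_one k : (0 <= k)%ZZ -> inb (bint k 1) (pw k * 1).
Proof. by move=> k0; rewrite -[X in _ * X]ZR1; exact: inb_int. Qed.

Lemma rupert_golden k f vs c : (0 <= k)%ZZ -> similarity f ->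
  check k (golden_ball k) [:: bint k 1] vs c -> Rupert (f @` hull [set` map (evp phi [:: 1]) vs]).
Proof.
move=> k0 sf; apply: (check_rupert k0 (inb_golden k0) _ sf).
by split=> // -[|//] _; exact: (inb_one k0).
Qed.

Lemma rupert_roots k f vs c : (0 <= k)%ZZ -> bnonneg (sigma_square k) ->
  bnonneg (zeta_square k) -> similarity f ->
  check k (golden_ball k) [:: bint k 1; sigma_ball k; zeta_ball k] vs c ->
  Rupert (f @` hull [set` map (evp phi [:: 1; sigma; zeta]) vs]).
Proof.
move=> k0 b0 b1 sf; apply: (check_rupert k0 (inb_golden k0) _ sf).
by split=> // -[|[|[|//]]] _; [exact: (inb_one k0)|exact: (inb_sigma k0 b0)|exact: (inb_zeta k0 b0 b1)].
Qed.

End Balls.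

(** * The diminished rhombicosidodecahedron *)

Definition diminished : seq vphi := [seq v <- rhombicosidodecahedron | v \notin pentagon].

Definition J76_vertices : seq cpt := [seq layers [:: v] | v <- diminished].

Lemma J76_check : check 28 (golden_ball 28) [:: bint 28 1] J76_vertices
  (Certificate (2729, 6804, 1523, 3325)%ZZ (7905, 1001, -1825, 538)%ZZ 52 (2657296, -5127942)%ZZ
  [:: 4; 49; 15; 37; 30; 8; 3; 51; 40; 18; 46; 6; 28; 33; 11; 17; 48; 26]%N).
Proof. by vm_compute. Qed.

Section J76.
Variable R : realType.
Local Notation pt := 'cV[R]_3.
Local Notation evv := (evv R).
Local Notation evvs := (@evvs R).

Lemma evv_inj_list : {in rhombicosidodecahedron, forall v, forall u, u \in pentagon ->
  evv v = evv u -> v = u}.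
Proof.
move=> v vV u uP vu; apply/eqP; apply: contraT => neq.
have H : all (fun v => all (fun u => (v == u) || gpos (vdot (vsub v u) (vsub v u)))
   pentagon) rhombicosidodecahedron by vm_compute.
have := seq.allP (seq.allP H v vV) u uP; clear H.
by rewrite (negbTE neq) /= => /(ev_pos R); rewrite -dot_evv evv_sub vu subrr dot0l ltxx.
Qed.

Lemma diminishedE : evvs rhombicosidodecahedron `\` evvs pentagon = evvs diminished.
Proof.
apply/seteqP; split=> x.
  move=> [/evvsP[v vV ->] vP]; apply/evvsP; exists v; last exact: erefl.
  rewrite mem_filter vV andbT.
  apply/negP => vP'; apply: vP; apply/evvsP; exists v; [exact: vP'|exact: erefl].
move=> /evvsP[v]; rewrite mem_filter => /andP[vP vV] ->; split.
  by apply/evvsP; exists v; [exact: vV|exact: erefl].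
by move=> /evvsP[u uP /(evv_inj_list vV uP) vu]; rewrite vu uP in vP.
Qed.

(** The pentagon that is cut off is the image under a symmetry of the one orthogonal to
    the axis, so the solid is similar to a fixed one. *)
Lemma J76_rupert (P : set pt) : J76 P -> Rupert P.
Proof.
move=> [f [p [simf rp [w [a [w0 fw pE]]] ->]]].
rewrite rhombicosidodecahedronE in fw pE *.
rewrite !hullE -image_chull in fw pE; last exact: similarity_affine.
have [g gs ->] := rhombicosidodecahedron_face simf rp w0 fw pE.
have simg := similarity_comp simf (spt_similarity R gs).
rewrite -[X in f @` X](syms_closedP R rhombicosidodecahedron_closed gs) image_comp.
have -> : (f \o spt g) @` evvs rhombicosidodecahedron `\` (f \o spt g) @` evvs pentagon =
    (f \o spt g) @` evvs diminished.
  rewrite -diminishedE; apply/seteqP; split=> x.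
    by move=> [[y yV <-] yP]; exists y => //; split=> // yP'; apply: yP; exists y.
  move=> [y [yV yP] <-]; split; first by exists y.
  by move=> [z zP /(similarity_injective simg) zy]; apply: yP; rewrite -zy.
rewrite hullE -image_chull; last exact: similarity_affine.
rewrite evvs_layers.
by apply: rupert_golden simg J76_check.
Qed.

End J76.

(** * Antiprisms and cupolas on a given polygon *)

Section Stacking.
Variable R : realType.
Local Notation pt := 'cV[R]_3.
Implicit Types (p q b t y : nat -> pt) (c e : pt) (n : nat) (g r k : R).

Lemma ngon_similarity g r c p f L k : 0 < k -> (forall x z, f x - f z = L (x - z)) ->
  (forall a x z, L (a *: x + z) = a *: L x + L z) ->
  (forall x z, dot (L x) (L z) = k * dot x z) ->
  ngon g r c p -> ngon g (k * r) (f c) (f \o p).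
Proof.
move=> k0 fL Llin Lk.
have L0 : L 0 = 0 by rewrite -[in LHS](subrr c) -fL subrr.
have LN x : L (- x) = - L x by rewrite -[- x]addr0 -scaleN1r Llin L0 addr0 scaleN1r.
move=> [r0 prec psq pnext]; split=> [|i|i|i] /=.
- exact: mulr_gt0.
- by rewrite !fL prec Llin LN.
- by rewrite fL Lk psq.
- by rewrite !fL Lk pnext; ring.
Qed.

(** The second base of an antiprism is the polygon of the edge midpoints of the
    first, rescaled and translated. *)
Lemma antiprism_base g r c p e k : ngon g r c p -> k ^+ 2 * (2 + g) = 1 ->
  ngon g r (c + e) (fun i => c + k *: ((p i - c) + (p i.+1 - c)) + e).
Proof.
move=> pn kg; have [r0 prec psq pnext] := pn.
have shift x : c + x + e - (c + e) = x by apply: pt_eq; rewrite !mxE; ring.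
have far i : dot (p i - c) (p i.+2 - c) = (g ^+ 2 / 2 - 1) * r.
  by rewrite prec dotDr dotNr dotZr pnext psq; field.
split=> [//|i|i|i]; rewrite !shift.
- rewrite (prec i.+1) (prec i); move: (p i - c) (p i.+1 - c) => x z.
  by apply: pt_eq; rewrite !mxE; ring.
- have := psq i; have := psq i.+1; have := pnext i.
  move: (p i - c) (p i.+1 - c) => x z xz zz xx.
  have -> : dot (k *: (x + z)) (k *: (x + z)) = k ^+ 2 * (2 + g) * r.
    by rewrite !dotL (dotC z x) xx zz xz; field.
  by rewrite kg mul1r.
have := psq i.+1; have := pnext i; have := pnext i.+1; have := far i.
move: (p i - c) (p i.+1 - c) (p i.+2 - c) => x z u xu zu xz zz.
have -> : dot (k *: (x + z)) (k *: (z + u)) = k ^+ 2 * (2 + g) * (g * r / 2).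
  by rewrite !dotL xu zu xz zz; field.
by rewrite kg mul1r.
Qed.

(** Needed because the second base of an antiprism is known from the edges of the first,
    whose vertices may be numbered in another way. *)
Lemma range_edges n p y (F : pt -> pt -> pt) : (2 < n)%N -> ~~ odd n ->
  regular_polygon n p -> regular_polygon n y -> range p = range y ->
  (forall x z, F x z = F z x) ->
  range (fun i => F (p i) (p i.+1)) = range (fun i => F (y i) (y i.+1)).
Proof.
move=> n2 nev rp ry py FC; have [s [h h']] := regular_edges n2 nev rp ry py.
apply/seteqP; split=> _ [i _ <-].
  by have [j _ [[-> ->]|[-> ->]]] := h i; exists j.
by have [j _ [[<- <-]|[<- <-]]] := h' i; exists j.
Qed.

(** Exchanging the bases shifts the indices of one of them. *)
Lemma antiprism_flip n p q : (2 < n)%N -> antiprism n p q ->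
  antiprism n q (fun i => p i.+1) /\ range (fun i => p i.+1) = range p.
Proof.
move=> n2 [rp rq [w [a [b [w0 ab wp wq]]]] pq].
have n0 : (0 < n)%N by lia.
split; last first.
  apply/seteqP; split=> _ [i _ <-]; first by exists i.+1.
  exists (i + n.-1)%N => //; rewrite -(regular_period i 1 n0 rp); congr p; lia.
have [c [r [r0 prec psq pnext]]] := regular_ngon n0 rp.
split=> //.
- apply: (@ngon_regular _ n r c _ n2); split=> [//|i|i|i]; [exact: prec|exact: psq|exact: pnext].
- by exists w, b, a; split=> //; rewrite eq_sym.
- by move=> i; split; [exact: (pq i).2|exact: (pq i.+1).1].
Qed.

End Stacking.

Section Placement.
Variable R : realType.
Local Notation pt := 'cV[R]_3.
Implicit Types (p q b t y : nat -> pt) (c e x : pt) (n : nat) (g r k : R).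

(** A vector on a known ray is determined by its length. *)
Lemma ray_length x e k l : 0 < k -> e = - k *: x -> 0 <= l -> x != 0 ->
  dot e e = l ^+ 2 * dot x x -> e = - l *: x.
Proof.
move=> k0 eE l0 x0; rewrite eE !dotL => H.
have xx : dot x x != 0 by rewrite dot_eq0.
have : k ^+ 2 = l ^+ 2 by apply: (mulIf xx); rewrite -H; ring.
by move/eqP; rewrite eqrXn2 // ?ltW // => /eqP ->.
Qed.

(** If the other piece has a point on the side of x, the antiprism is on the side
    of - x. *)
Lemma antiprism_glued n p q y r c A x x1 : (1 < n)%N -> 0 < gam R n.*2 ->
  antiprism n.*2 p q -> regular_polygon n.*2 y -> ngon (gam R n.*2) r c y ->
  range p = range y -> attached A (solid p q) (polygon p) ->
  (forall w, (forall i, dot w (y i - c) = 0) -> dot w x1 = 0) -> A (c + x1 + x) ->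
  (forall i, dot x (y i - c) = 0) -> x != 0 ->
  let s := Num.sqrt (2 + gam R n.*2) in
  exists e, [/\ exists2 k, 0 < k & e = - k *: x, dot e e = (s - gam R n.*2) * r,
    forall i, dot e (y i - c) = 0 &
    range q = range (fun i => c + s^-1 *: ((y i - c) + (y i.+1 - c)) + e)].
Proof.
move=> n1 g0 apq ry yn py att x1E Ax xy x0 s.
have n2 : (2 < n.*2)%N by lia.
have gb := gam_bound R n2; have /andP[gl gr] := gb.
have [rp rq _ _] := apq.
have [c' [r' pn]] := regular_ngon (ltac:(lia) : (0 < n.*2)%N) rp.
have [cc rr] := ngon_same_centre gr gr pn yn py; subst c' r'.
have [e [ee ep qE]] := antiprism_vertices n1 g0 pn apq.
have p_of i : exists j, p j = y i.
  have : range p (y i) by rewrite py; exists i.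
  by case=> j _ <-; exists j.
have y_of i : exists j, y j = p i.
  have : range y (p i) by rewrite -py; exists i.
  by case=> j _ <-; exists j.
have en : e != 0.
  rewrite -dot_eq0 ee mulf_neq0 ?gt_eqF ?(ngon_gt0 yn) // subr_gt0.
  have h : gam R n.*2 ^+ 2 < 2 + gam R n.*2 by nra.
  by rewrite -[ltLHS](ger0_norm (ltW g0)) -sqrtr_sqr ltr_sqrt // addr_gt0.
exists e; split=> //.
- apply: (attached_opposite (y2 := s^-1 *: ((p 0%N - c) + (p 1%N - c))) gb pn att _ Ax _ _ ep x0 en).
  + move=> w wp; split; first by apply: x1E => i; have [j <-] := p_of i.
    by rewrite dotZr dotDr !wp addr0 mulr0.
  + by rewrite -qE; apply: sub_chull; right; exists 0%N.
  + by move=> i; have [j <-] := y_of i.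
- by move=> i; have [j <-] := p_of i.
rewrite -(range_edges (F := fun u v => c + s^-1 *: ((u - c) + (v - c)) + e) n2 _ rp ry py).
- by have -> : q = (fun i => c + s^-1 *: ((p i - c) + (p i.+1 - c)) + e) by apply: funext.
- by rewrite odd_double.
- by move=> u v; rewrite [X in _ *: X]addrC.
Qed.

(** Likewise for a cupola; its height does not vanish because the square of gam is less
    than three. *)
Lemma cupola_glued n b t y r c B x x1 : (1 < n)%N -> 0 < gam R n.*2 -> gam R n.*2 ^+ 2 < 3 ->
  cupola n b t -> regular_polygon n.*2 y -> ngon (gam R n.*2) r c y -> range b = range y ->
  attached (solid b t) B (polygon b) ->
  (forall w, (forall i, dot w (y i - c) = 0) -> dot w x1 = 0) -> B (c + x1 + x) ->
  (forall i, dot x (y i - c) = 0) -> x != 0 ->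
  let g := gam R n.*2 in
  exists e (s : bool), [/\ exists2 k, 0 < k & e = - k *: x,
    dot e e * (2 + g) = (3 - g ^+ 2) * r,
    range t = [set u | exists2 j, odd j = s & u = c + (2 + g)^-1 *: ((y j - c) + (y j.+1 - c)) + e] &
    forall i, exists2 j, odd j = ~~ s & same_edge (b i.*2) (b i.*2.+1) (y j) (y j.+1)].
Proof.
move=> n1 g0 g3 cup ry yn bY att x1E Bx xy x0 g.
have n2 : (2 < n.*2)%N by lia.
have gb := gam_bound R n2; have /andP[gl gr] := gb.
have [e [s [ee ey tE sq]]] := cupola_top n1 g0 cup ry yn bY.
exists e, s; split=> //.
have en : e != 0.
  apply: contraTneq (ngon_gt0 yn) => e0; move: ee; rewrite e0 dot0l mul0r => /esym/eqP.
  by rewrite mulf_eq0 subr_eq0 gt_eqF //= => /eqP->; rewrite ltxx.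
have [j [js tj]] : exists j, odd j = s /\
    range t (c + (2 + g)^-1 *: ((y j - c) + (y j.+1 - c)) + e).
  by exists s; rewrite tE; split; [case: (s)|exists s => //; case: (s)].
have pE : polygon b = polygon y by rewrite /polygon bY.
rewrite pE in att.
have [||k k0 xE] := attached_opposite (y1 := (2 + g)^-1 *: ((y j - c) + (y j.+1 - c)))
    gb yn att _ _ Bx ey xy en x0.
- by move=> w wy; rewrite (x1E _ wy) dotZr dotDr !wy addr0 mulr0.
- by apply: sub_chull; right.
exists k^-1; first by rewrite invr_gt0.
by rewrite xE !scaleNr scalerN opprK scalerA mulVf ?scale1r // gt_eqF.
Qed.

End Placement.

(** * The gyroelongated rotundas *)

(** All coordinates are multiplied by five, which makes them integral over the golden
    ring: the inverse of sigma is sigma * (3 - phi) / 5, see [sigma_inv]. *)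
Definition antiprism_vertex (j : nat) : cpt :=
  layers [:: vzero; vscale (3, -1)%ZZ (vadd (cyc equator j) (cyc equator j.+1));
    vscale (0, -2)%ZZ axis].
Definition J25_vertices : seq cpt :=
  [seq layers [:: vscale (5, 0)%ZZ v] | v <- rotunda] ++
  [seq antiprism_vertex j | j <- iota 0 10].

Definition cupola_vertex (j : nat) : cpt :=
  layers [:: vscale (-6, 2)%ZZ axis; vscale (3, -1)%ZZ (cyc equator j.+1); vscale (0, -2)%ZZ axis].
Definition J47_vertices (s : bool) : seq cpt :=
  J25_vertices ++ [seq cupola_vertex j | j <- iota 0 10 & odd j == s].

Definition root_balls (k : Z) : seq zball := [:: bint k 1; sigma_ball k; zeta_ball k].

Lemma J25_check : check 28 (golden_ball 28) (root_balls 28) J25_vertices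
  (Certificate (1989, 3821, -6296, -2985)%ZZ (2221, 3709, -5969, -3575)%ZZ 51 (34856110, -20853421)%ZZ
  [:: 4; 6; 2; 20; 21; 22; 23; 24; 3; 8; 13]%N).
Proof. by vm_compute. Qed.

(** The parity s is that of the edges over which the top of the cupola lies. *)
Lemma J47_check s : exists c, check 28 (golden_ball 28) (root_balls 28) (J47_vertices s) c.
Proof.
case: s.
- exists (Certificate (-5102, -483, -5495, 3263)%ZZ (-4464, -47, -5989, 3362)%ZZ 51 (-37797589, -8167506)%ZZ
    [:: 21; 20; 34; 29; 28; 9; 0; 13; 10; 19; 16; 22]%N).
  by vm_compute.
exists (Certificate (2269, 2861, 7325, -347)%ZZ (1849, 2650, 7442, -1133)%ZZ 52 (-15718297, -11223750)%ZZ
    [:: 29; 34; 28; 27; 26; 17; 8; 10; 1; 14; 11; 20]%N).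
by vm_compute.
Qed.

Section Gyro.
Variable R : realType.
Local Notation phi := (golden R).
Local Notation sigma := (sigma R).
Local Notation zeta := (zeta R).

Lemma sigma_gt0 : 0 < sigma.
Proof. by rewrite sqrtr_gt0 addr_gt0 ?golden_gt0. Qed.

Lemma sigma_sq : sigma ^+ 2 = 2 + phi.
Proof. by rewrite sqr_sqrtr // addr_ge0 // ltW // golden_gt0. Qed.

Lemma sigma_inv : sigma^-1 = sigma * (3 - phi) / 5.
Proof.
have s0 : sigma != 0 by rewrite gt_eqF // sigma_gt0.
apply: (mulfI s0); rewrite divff //.
have -> : sigma * (sigma * (3 - phi) / 5) = sigma ^+ 2 * (3 - phi) / 5 by ring.
rewrite sigma_sq; have := golden_sq R => h.
have -> : (2 + phi) * (3 - phi) = 5 by rewrite mulrDl !mulrBr -expr2 h; ring.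
by rewrite divff // pnatr_eq0.
Qed.

Lemma sigma_golden : phi < sigma.
Proof.
rewrite -[ltLHS](ger0_norm (ltW (golden_gt0 R))) -sqrtr_sqr ltr_sqrt.
  by rewrite golden_sq; lra.
by rewrite addr_gt0 // golden_gt0.
Qed.

Lemma zeta_sq : zeta ^+ 2 = 5 * (3 - phi) * (sigma - phi).
Proof.
have E : 5 - 10 * phi + (15 * sigma - 5 * (sigma * phi)) = 5 * (3 - phi) * (sigma - phi).
  by have := golden_sq R; lra.
rewrite /zeta E sqr_sqrtr //.
rewrite !mulr_ge0 // subr_ge0 ltW ?sigma_golden //; have := golden_lt2 R; lra.
Qed.

End Gyro.

Section Gyroelongated.
Variable R : realType.
Local Notation pt := 'cV[R]_3.
Local Notation phi := (golden R).
Local Notation ev := (evz phi).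
Local Notation evv := (evv R).
Local Notation evvs := (@evvs R).
Local Notation sigma := (sigma R).
Local Notation zeta := (zeta R).
Local Notation d_ := (fun j => evv (cyc equator j)).
Local Notation ax := (evv axis).
Implicit Types (M : 'M[R]_3) (c : pt) (p q b t : nat -> pt).

(** The height of the antiprism, in units of the axis vector. *)
Definition eta : R := 2 * phi * zeta / 5.

Lemma eta_ge0 : 0 <= eta.
Proof. by rewrite !mulr_ge0 ?sqrtr_ge0 // ltW // golden_gt0. Qed.

Lemma eta_sq : eta ^+ 2 * (2 + phi) = (sigma - phi) * (4 + 4 * phi).
Proof.
have h := golden_sq R.
have -> : eta ^+ 2 * (2 + phi) = zeta ^+ 2 * (4 * phi ^+ 2 * (2 + phi) / 25).
  by rewrite /eta; field.
rewrite zeta_sq h.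
have -> : 5 * (3 - phi) * (sigma - phi) * (4 * (phi + 1) * (2 + phi) / 25) =
    (sigma - phi) * (4 + 4 * phi) * ((6 + phi - phi ^+ 2) / 5) by field.
by rewrite h; field.
Qed.

Lemma axis_equator j : dot ax (d_ j) = 0.
Proof.
have : evvs equator (d_ j) by rewrite -cyc_range //; exists j.
move=> /evvsP[v vE ->]; rewrite dot_evv.
have : all (fun v => vdot axis v == (0, 0)%ZZ) equator by vm_compute.
by move=> /seq.allP/(_ _ vE)/eqP->; rewrite /evz /= ZR0 mul0r addr0.
Qed.

Lemma axis_sq : dot ax ax = 2 + phi.
Proof. by rewrite dot_evv /evz /= ZR1 ZR2; ring. Qed.

(** A vertex of the rotunda over the edge from 8 to 9 shows on which side of the base
    the antiprism is not. *)
Lemma gyroelongated A b p q : pentagonal_rotunda A b -> antiprism 10 p q ->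
  polygon b = polygon p -> attached A (solid p q) (polygon p) ->
  exists c M k, let f := fun x : pt => c + M *m x in
  [/\ 0 < k /\ (forall x y : pt, dot (M *m x) (M *m y) = k * dot x y), similarity f,
      A = f @` hull (evvs rotunda), range p = range (fun j => f (d_ j)) &
      range q = range (fun j => f (sigma^-1 *: (d_ j + d_ j.+1) - eta *: ax))].
Proof.
move=> rot apq bp att.
have [f [simf AE rb bE]] := rotunda_frame rot.
have [M [k [k0 fE Mk]]] := similarity_matrix simf.
pose c := f 0; pose y j := c + M *m d_ j.
have yE : y = f \o d_ by apply: funext => j; rewrite /= fE.
have fB u v : f u - f v = M *m (u - v).
  by rewrite fE (fE v) mulmxBr opprD addrACA subrr add0r.
have yn : ngon (gam R 5.*2) (k * ev (4, 4)%ZZ) c y.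
  rewrite yE gam10; apply: (ngon_similarity k0 fB) => //; last exact: equator_ngon.
  by move=> a u v; rewrite mulmxDr -scalemxAr.
have ry : regular_polygon 5.*2 y by apply: (ngon_regular (isT : (2 < 10)%N)) yn.
have [rp _ _ _] := apq.
have [cp [rp' pn]] := regular_ngon (isT : (0 < 10)%N) rp.
have [cb [rb' bn]] := regular_ngon (isT : (0 < 10)%N) rb.
have py : range p = range y by rewrite -(polygon_range bn pn bp) bE yE.
have g0 : 0 < gam R 5.*2 by rewrite gam10 golden_gt0.
pose x1 := (2 + phi)^-1 *: (M *m d_ 8 + M *m d_ 9).
pose x := ((2 + 2 * phi) / (2 + phi)) *: (M *m ax).
have g1 := golden_gt0 R.
have nax : M *m ax != 0 by apply: (frame_neq0 k0 Mk); exact: axis_neq0.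
have yc i : y i - c = M *m d_ i by rewrite /y addrAC subrr add0r.
have [||||e [[l l0 el] ee ey qE]] := antiprism_glued (n := 5) (x := x) (x1 := x1) isT g0 apq ry yn py att.
- move=> w wy; have wd j : dot w (M *m d_ j) = 0 by rewrite -yc.
  by rewrite dotZr dotDr !wd addr0 mulr0.
- rewrite AE; exists (evv ((1, 0), (0, 1), (1, 1))%ZZ).
    by apply: sub_chull; apply/evvsP; exists ((1, 0), (0, 1), (1, 1))%ZZ.
  have E : vscale (2, 1)%ZZ ((1, 0), (0, 1), (1, 1))%ZZ =
      vadd (vadd (cyc equator 8) (cyc equator 9)) (vscale (2, 2)%ZZ axis) by vm_compute.
  have : ev (2, 1)%ZZ *: evv ((1, 0), (0, 1), (1, 1))%ZZ = d_ 8 + d_ 9 + ev (2, 2)%ZZ *: ax.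
    by rewrite -!evv_scale -!evv_add E.
  have -> : ev (2, 1)%ZZ = 2 + phi by rewrite /evz /= ZR1 ZR2; ring.
  have -> : ev (2, 2)%ZZ = 2 + 2 * phi by rewrite /evz /= ZR2.
  move=> {}E; have n0 : 2 + phi != 0 by rewrite gt_eqF // addr_gt0.
  have -> : evv ((1, 0), (0, 1), (1, 1))%ZZ =
      (2 + phi)^-1 *: (d_ 8 + d_ 9) + ((2 + 2 * phi) / (2 + phi)) *: ax.
    by apply: (scalerI n0); rewrite E scalerDr !scalerA mulfV // scale1r [(2 + phi) * (_ / _)]mulrC divfK.
  by rewrite fE mulmxDr -!scalemxAr mulmxDr addrA.
- by move=> i; rewrite yc dotZl Mk axis_equator !mulr0.
- by rewrite scaler_eq0 negb_or nax andbT gt_eqF // divr_gt0 // addr_gt0 // mulr_gt0.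
exists c, M, k; split=> //.
- by have <- : f = (fun x => c + M *m x) by apply: funext.
- by rewrite AE; congr (_ @` _); apply: funext.
rewrite qE.
have -> : e = - eta *: (M *m ax).
  apply: (@ray_length _ _ _ (l * ((2 + 2 * phi) / (2 + phi)))) eta_ge0 nax _.
  - by rewrite mulr_gt0 // divr_gt0 // addr_gt0 // mulr_gt0.
  - by rewrite el scalerA mulNr.
  - rewrite ee gam10 Mk axis_sq [RHS]mulrCA eta_sq /evz /=.
    have -> : ZR R 4 = 4 by [].
    by rewrite -/sigma; ring.
congr (_ @` _); apply: funext => j.
by rewrite !yc /f gam10 -mulmxDr scaleNr mulmxBr -!scalemxAr addrA.
Qed.

End Gyroelongated.

Section J25.
Variable R : realType.
Local Notation pt := 'cV[R]_3.
Local Notation phi := (golden R).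
Local Notation ev := (evz phi).
Local Notation evv := (evv R).
Local Notation evvs := (@evvs R).
Local Notation sigma := (sigma R).
Local Notation zeta := (zeta R).
Local Notation eta := (eta R).
Local Notation d_ := (fun j => evv (cyc equator j)).
Local Notation ax := (evv axis).
Implicit Types (M : 'M[R]_3) (c : pt) (p q b t : nat -> pt).

Definition position (v : cpt) : pt := 5^-1 *: evp phi [:: 1; sigma; zeta] v.

Lemma rotunda_scaled v : position (layers [:: vscale (5, 0)%ZZ v]) = evv v.
Proof.
rewrite /position evp_layer evv_scale scalerA (_ : ev (5, 0)%ZZ = 5); last by rewrite /evz /= ZR0 mul0r addr0.
by rewrite mulVf ?scale1r // pnatr_eq0.
Qed.

Lemma antiprism_scaled j :
  position (antiprism_vertex j) = sigma^-1 *: (d_ j + d_ j.+1) - eta *: ax.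
Proof.
rewrite /position evp_layers evv0 add0r !evv_scale evv_add sigma_inv.
have -> : ev (3, -1)%ZZ = 3 - phi by rewrite /evz /= (ZRN R 1) ZR1; ring.
have -> : ev (0, -2)%ZZ = - 2 * phi by rewrite /evz /= (ZRN R 2) ZR2 ZR0; ring.
by rewrite /eta; apply: pt_eq; rewrite !mxE; field.
Qed.

Lemma cupola_scaled j : position (cupola_vertex j) =
  sigma^-1 *: d_ j.+1 - (eta + 2 * (3 - phi) / 5) *: ax.
Proof.
rewrite /position evp_layers !evv_scale sigma_inv.
have -> : ev (3, -1)%ZZ = 3 - phi by rewrite /evz /= (ZRN R 1) ZR1; ring.
have -> : ev (0, -2)%ZZ = - 2 * phi by rewrite /evz /= (ZRN R 2) ZR2 ZR0; ring.
have -> : ev (-6, 2)%ZZ = - 6 + 2 * phi by rewrite /evz /= (ZRN R 6) ZR2.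
by rewrite /eta; apply: pt_eq; rewrite !mxE; field.
Qed.

Lemma J25_set : [set` map position J25_vertices] =
  evvs rotunda `|` range (fun j => sigma^-1 *: (d_ j + d_ j.+1) - eta *: ax).
Proof.
rewrite map_cat_set; congr (_ `|` _).
  have E : [seq position (layers [:: vscale (5, 0)%ZZ v]) | v <- rotunda] = map evv rotunda.
    by apply: eq_map => v; exact: rotunda_scaled.
  by rewrite -map_comp /evvs -E.
rewrite -(range_mod_full position (F := antiprism_vertex)) //.
  by congr (_ @` _); apply: funext => j; rewrite antiprism_scaled.
by move=> j; rewrite /antiprism_vertex cyc_mod // cyc_modS.
Qed.

Lemma equator_rotunda : range d_ `<=` evvs rotunda.
Proof.
rewrite cyc_range // => x /evvsP[v vE ->]; apply/evvsP; exists v; last exact: erefl.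
have : all (mem rotunda) equator by vm_compute.
by move/seq.allP; apply.
Qed.

Lemma J25_rupert (P : set pt) : J25 P -> Rupert P.
Proof.
move=> [A [b [p [q [rot apq bp att [PE cP]]]]]].
have [c [M [k [_ simf AE pE qE]]]] := gyroelongated rot apq bp att.
set f := (fun x : pt => c + M *m x) in simf AE pE qE.
have -> : P = f @` hull [set` map position J25_vertices].
  have fd : range p `<=` f @` evvs rotunda.
    rewrite pE => _ [j _ <-]; exists (d_ j) => //; apply: equator_rotunda; by exists j.
  rewrite image_chull; last exact: similarity_affine.
  rewrite J25_set image_setU.
  have -> : [set f x | x in range (fun j => sigma^-1 *: (d_ j + d_ j.+1) - eta *: ax)] = range q.
    by rewrite qE image_comp.
  rewrite AE image_chull in PE; last exact: similarity_affine.
  apply: hull_pieces => //; rewrite PE.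
    move=> x [xr|xq]; first by left; apply: sub_chull.
    by right; apply: sub_chull; right.
  move=> x []; apply: chull_sub => y; first by left.
  by case=> [/fd|]; [left|right].
rewrite hull_scaled; apply: (rupert_roots (k := 28)) J25_check => //.
by apply: similarity_comp simf (similarity_scale _); rewrite invr_gt0.
Qed.

End J25.

Section J47.
Variable R : realType.
Local Notation pt := 'cV[R]_3.
Local Notation phi := (golden R).
Local Notation ev := (evz phi).
Local Notation evv := (evv R).
Local Notation evvs := (@evvs R).
Local Notation sigma := (sigma R).
Local Notation zeta := (zeta R).
Local Notation eta := (eta R).
Local Notation position := (@position R).
Local Notation d_ := (fun j => evv (cyc equator j)).
Local Notation ax := (evv axis).
Implicit Types (M : 'M[R]_3) (c : pt) (p q b t : nat -> pt).

Lemma eta_gt0 : 0 < eta.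
Proof.
rewrite lt_neqAle eta_ge0 andbT eq_sym; apply/eqP => h; have := eta_sq R.
rewrite h expr0n mul0r => /esym/eqP; have := golden_gt0 R => g0.
by rewrite mulf_eq0 subr_eq0 !gt_eqF ?sigma_golden // addr_gt0 // mulr_gt0.
Qed.

Lemma equator_next j : d_ j + d_ j.+2 = phi *: d_ j.+1.
Proof. by have := ngon_rec (equator_ngon R) j; rewrite !subr0 => ->; rewrite addrC subrK. Qed.

Lemma cupola_height : (2 * (3 - phi) / 5) ^+ 2 * (2 + phi) * (2 + phi) = (3 - phi ^+ 2) * (4 + 4 * phi).
Proof.
have h := golden_sq R.
have e1 : (2 + phi) * (2 + phi) = 5 * phi ^+ 2 by lra.
have e2 : (3 - phi) ^+ 2 = 5 * (2 - phi) by lra.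
have -> : (2 * (3 - phi) / 5) ^+ 2 * (2 + phi) * (2 + phi) =
    4 / 25 * (3 - phi) ^+ 2 * ((2 + phi) * (2 + phi)) by field.
by rewrite e1 e2 h; field.
Qed.

(** The antiprism is turned over so that its first base is that of the rotunda; this puts
    the cupola on its second base, at a known place up to a parity. *)
Lemma J47_rupert (P : set pt) : J47 P -> Rupert P.
Proof.
move=> [p [q [b [t [A [d [apq [cup bp att] [rot dq attA] [PE cP]]]]]]]].
have [apq' pS] := antiprism_flip (isT : (2 < 10)%N) apq.
have solE : solid q (fun i => p i.+1) = solid p q by rewrite /solid pS setUC.
rewrite -solE in attA.
have [c [M [k [[k0 Mk] simf AE qE pE]]]] := gyroelongated rot apq' dq attA.
rewrite pS in pE; clear apq' attA pS.
set f := (fun x : pt => c + M *m x) in simf AE pE qE.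
pose z j := f (sigma^-1 *: (d_ j + d_ j.+1) - eta *: ax).
pose c' := f (- eta *: ax).
have f0 : f 0 = c by rewrite /f mulmx0 addr0.
have fB u v : f u - f v = M *m (u - v).
  by rewrite /f mulmxBr opprD addrACA subrr add0r.
have nax : M *m ax != 0 by apply: (frame_neq0 k0 Mk); exact: axis_neq0.
have zc j : z j - c' = sigma^-1 *: (M *m (d_ j + d_ j.+1)).
  by rewrite fB scaleNr opprK subrK -scalemxAr.
have gE : gam R 5.*2 = phi by exact: gam10.
have zn : ngon (gam R 5.*2) (k * ev (4, 4)%ZZ) c' z.
  have yn : ngon phi (k * ev (4, 4)%ZZ) (f 0) (f \o d_).
    apply: (ngon_similarity k0 fB) => //; last exact: equator_ngon.
    by move=> a u v; rewrite mulmxDr -scalemxAr.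
  have s1 : sigma^-1 ^+ 2 * (2 + phi) = 1.
    by rewrite -sigma_sq -exprMn mulVf ?expr1n // gt_eqF // sigma_gt0.
  rewrite gE; have := antiprism_base (- eta *: (M *m ax)) yn s1.
  have -> : f 0 + - eta *: (M *m ax) = c' by rewrite f0 /c' /f -scalemxAr.
  congr (ngon _ _ _ _); apply: funext => j.
  rewrite /= !fB !subr0 f0 -mulmxDr /z /f mulmxBr -!scalemxAr scaleNr -addrA //.
have rz : regular_polygon 5.*2 z by apply: (ngon_regular (isT : (2 < 10)%N)) zn.
have [rp _ _ _] := apq; have [rb _ _ _] := cup.
have [cp [rp' pn]] := regular_ngon (isT : (0 < 10)%N) rp.
have [cb [rb' bn]] := regular_ngon (isT : (0 < 10)%N) rb.
have bz : range b = range z by rewrite (polygon_range bn pn bp) pE.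
have g0 : 0 < gam R 5.*2 by rewrite gE golden_gt0.
have g3 : gam R 5.*2 ^+ 2 < 3 by rewrite gE golden_sq_lt3.
rewrite -bp in att.
have orth i : dot (eta *: (M *m ax)) (z i - c') = 0.
  by rewrite zc dotZl dotZr Mk dotDr !axis_equator addr0 !mulr0.
have [||||e [s [[l l0 el] ee tE _]]] :=
    cupola_glued (x := eta *: (M *m ax)) (x1 := 0) (isT : (1 < 5)%N) g0 g3 cup rz zn bz att.
- by move=> w _; rewrite dot0r.
- (* the centre of the equator *)
  have -> : c' + 0 + eta *: (M *m ax) = 2^-1 *: f (d_ 0) + 2^-1 *: f (d_ 5).
    have Z : vadd (cyc equator 0) (cyc equator 5) = vzero by vm_compute.
    have -> : 2^-1 *: f (d_ 0) + 2^-1 *: f (d_ 5) = c + 2^-1 *: (M *m (d_ 0 + d_ 5)).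
      rewrite /f mulmxDr; move: (M *m d_ 0) (M *m d_ 5) => u v.
      by apply: pt_eq; rewrite !mxE; field.
    rewrite -evv_add Z evv0 mulmx0 scaler0 addr0 addr0 /c' /f -scalemxAr scaleNr.
    by rewrite subrK.
  have qh j : solid p q (f (d_ j)) by apply: sub_chull; right; rewrite qE; exists j.
  have h0 : 0 <= 2^-1 :> R by rewrite invr_ge0.
  have h2 : 2^-1 + 2^-1 = 1 :> R by field.
  exact: (convex_comb (chull_convex _) h0 h0 h2 (qh 0%N) (qh 5%N)).
- exact: orth.
- by rewrite scaler_eq0 negb_or nax andbT gt_eqF // eta_gt0.
pose tau := 2 * (3 - phi) / 5 : R.
have tau0 : 0 <= tau by rewrite /tau; have := golden_lt2 R; lra.
have eE : e = - tau *: (M *m ax).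
  apply: (@ray_length _ _ _ (l * eta)) tau0 nax _.
  - by rewrite mulr_gt0 // eta_gt0.
  - by rewrite el scalerA mulNr.
  have s0 : 2 + phi != 0 by rewrite -sigma_sq expf_neq0 // gt_eqF // sigma_gt0.
  apply: (mulIf s0); rewrite gE in ee; rewrite ee Mk axis_sq.
  have -> : tau ^+ 2 * (k * (2 + phi)) * (2 + phi) = k * (tau ^+ 2 * (2 + phi) * (2 + phi)) by ring.
  rewrite cupola_height /evz /= (_ : ZR R 4 = 4) //; ring.
have topE j : c' + (2 + phi)^-1 *: ((z j - c') + (z j.+1 - c')) + e =
    f (position (cupola_vertex j)).
  have s0 : 2 + phi != 0 by rewrite -sigma_sq expf_neq0 // gt_eqF // sigma_gt0.
  rewrite !zc cupola_scaled eE -scalerDr -mulmxDr.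
  have -> : d_ j + d_ j.+1 + (d_ j.+1 + d_ j.+2) = (2 + phi) *: d_ j.+1.
    rewrite scalerDl -equator_next; move: (evv _) (evv _) (evv _) => u v w.
    by apply: pt_eq; rewrite !mxE; ring.
  rewrite /c' /f -!scalemxAr mulmxBr -!scalemxAr; move: (M *m _) (M *m _) => u v.
  by rewrite /tau; apply: pt_eq; rewrite !mxE; field; rewrite s0 gt_eqF // sigma_gt0.
have {}tE : range t = f @` [set` map position [seq cupola_vertex j | j <- iota 0 10 & odd j == s]].
  rewrite -(range_mod position (F := cupola_vertex) (P := fun j => odd j == s)) //.
  - rewrite tE gE; apply/seteqP; split=> x.
      move=> [j js ->]; rewrite topE; exists (position (cupola_vertex j)) => //.
      by exists j => //; apply/eqP.
    by move=> [_ [j /eqP js ->] <-]; exists j => //; rewrite topE.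
  - by move=> j; rewrite /cupola_vertex cyc_modS.
  - by move=> j; rewrite {1}(divn_eq j 10) oddD oddM andbF.
have -> : P = f @` hull [set` map position (J47_vertices s)].
  rewrite image_chull; last exact: similarity_affine.
  have fd : range q `<=` f @` evvs rotunda.
    rewrite qE => _ [j _ <-]; exists (d_ j) => //; apply: equator_rotunda; by exists j.
  have VE : f @` [set` map position (J47_vertices s)] = f @` evvs rotunda `|` range p `|` range t.
    rewrite map_cat_set J25_set !image_setU -tE; congr (_ `|` _ `|` _).
    by rewrite pE image_comp.
  rewrite AE image_chull in PE; last exact: similarity_affine.
  apply: hull_pieces => //; rewrite VE PE.
  - move=> x [[xr|xp]|xt].
    + by right; apply: sub_chull.
    + by left; left; apply: sub_chull; left.
    + by left; right; apply: sub_chull; right.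
  - move=> x [[|]|]; apply: chull_sub.
    + by move=> y [yp|/fd yq]; left; [right|left].
    + by rewrite bz -pE => y [yp|yt]; [left; right|right].
    + by move=> y yr; left; left.
have [crt h] := J47_check s.
rewrite hull_scaled; apply: (rupert_roots (k := 28)) h => //.
by apply: similarity_comp simf (similarity_scale _); rewrite invr_gt0.
Qed.

End J47.

(** * Numerical data over the square root of two *)

(** From here to the end of the part, pairs (a, b) stand for a + b * sqrt 2, with its
    own multiplication; [vshrink] is the multiplication by 2 - sqrt 2. *)
Definition root2_mul (z : Z * Z) : Z * Z := ((2 * z.2)%ZZ, z.1).
Definition vroot2 (v : vphi) : vphi := (root2_mul v.1.1, root2_mul v.1.2, root2_mul v.2).
Definition vshrink (v : vphi) : vphi := vsub (vadd v v) (vroot2 v).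
Definition vup (z : Z * Z) : vphi := ((0, 0), (0, 0), z)%ZZ.

Definition octagon : seq vphi :=
  [:: ((2, 0), (0, 0), (0, 0)); ((0, 1), (0, 1), (0, 0));
      ((0, 0), (2, 0), (0, 0)); ((0, -1), (0, 1), (0, 0));
      ((-2, 0), (0, 0), (0, 0)); ((0, -1), (0, -1), (0, 0));
      ((0, 0), (-2, 0), (0, 0)); ((0, 1), (0, -1), (0, 0))]%ZZ.

(** The coordinates are multiplied by two: the inverses of sigma8 and of 2 + sqrt 2 are
    sigma8 * (2 - sqrt 2) / 2 and (2 - sqrt 2) / 2. *)
Definition base_vertex (j : nat) : cpt := layers [:: vadd (cyc octagon j) (cyc octagon j)].
Definition second_vertex (j : nat) : cpt :=
  layers [:: vzero; vshrink (vadd (cyc octagon j) (cyc octagon j.+1)); vup (-4, 0)%ZZ].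
Definition upper_vertex (j : nat) : cpt :=
  layers [:: vshrink (vadd (cyc octagon j) (cyc octagon j.+1)); vup (4, -2)%ZZ].
Definition lower_vertex (j : nat) : cpt :=
  layers [:: vzero; vadd (vshrink (cyc octagon j.+1)) (vup (-4, 2)%ZZ); vup (-4, 0)%ZZ].
Definition J45_vertices (s1 s2 : bool) : seq cpt :=
  [seq base_vertex j | j <- iota 0 8] ++ [seq second_vertex j | j <- iota 0 8] ++
  [seq upper_vertex j | j <- iota 0 8 & odd j == s1] ++
  [seq lower_vertex j | j <- iota 0 8 & odd j == s2].

Definition root2_ball (k : Z) : zball := bsqrt k (bint k 2).
Definition sigma8_ball (k : Z) : zball := bsqrt k (badd (bint k 2) (root2_ball k)).
Definition zeta8_square (k : Z) : zball := badd (sigma8_ball k) (bopp (root2_ball k)).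
Definition octagon_balls (k : Z) : seq zball := [:: bint k 1; sigma8_ball k; bsqrt k (zeta8_square k)].

(** The four vertex lists differ by the turns of the two cupolas. *)
Lemma J45_check s1 s2 : exists c, check 28 (root2_ball 28) (octagon_balls 28) (J45_vertices s1 s2) c.
Proof.
case: s1; case: s2.
- exists (Certificate (22875, -5778, 22475, -3456)%ZZ (28749, -3758, 14667, -4242)%ZZ 59 (254154431, 22835420)%ZZ
    [:: 21; 22; 13; 14; 7; 19; 16; 2; 10; 11]%N).
  by vm_compute.
- exists (Certificate (2328, 2367, -5277, -5314)%ZZ (1521, 2951, -6639, -3466)%ZZ 52 (-15283, -12574)%ZZ
    [:: 1; 0; 15; 23; 22; 12; 4; 3; 17; 16]%N).
  by vm_compute.
- exists (Certificate (-23084, 7636, 21914, -1532)%ZZ (-29003, 4971, 14302, -1824)%ZZ 60 (-123403440, 32414151)%ZZ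
    [:: 18; 5; 13; 14; 22; 23; 8; 9; 2; 17]%N).
  by vm_compute.
exists (Certificate (22999, 22416, -5723, 3098)%ZZ (-15004, -28132, 7286, -2033)%ZZ 60 (-13235404, -126904864)%ZZ
  [:: 3; 17; 16; 0; 15; 14; 23; 22; 12; 11]%N).
by vm_compute.
Qed.

Section Octagon.
Variable R : realType.
Local Notation pt := 'cV[R]_3.
Local Notation pw := (pow2 R).

Definition root2 : R := Num.sqrt 2.
Definition sigma8 : R := Num.sqrt (2 + root2).
Definition zeta8 : R := Num.sqrt (sigma8 - root2).
Local Notation ev := (evz root2).

Definition evo (u : vphi) : pt := point3 (ev u.1.1) (ev u.1.2) (ev u.2).

Lemma root2_sq : root2 ^+ 2 = 2. Proof. by rewrite sqr_sqrtr. Qed.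

Lemma root2_gt0 : 0 < root2. Proof. by rewrite sqrtr_gt0. Qed.

Lemma sigma8_sq : sigma8 ^+ 2 = 2 + root2.
Proof. by rewrite sqr_sqrtr // addr_ge0 // ltW // root2_gt0. Qed.

Lemma sigma8_gt0 : 0 < sigma8.
Proof. by rewrite sqrtr_gt0 addr_gt0 // root2_gt0. Qed.

Lemma sigma8_inv : sigma8^-1 = sigma8 * (2 - root2) / 2.
Proof.
have s0 : sigma8 != 0 by rewrite gt_eqF // sigma8_gt0.
apply: (mulfI s0); rewrite divff //.
have -> : sigma8 * (sigma8 * (2 - root2) / 2) = sigma8 ^+ 2 * (2 - root2) / 2 by ring.
rewrite sigma8_sq; have h := root2_sq.
by have -> : (2 + root2) * (2 - root2) = 2 by [lra]; rewrite divff.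
Qed.

Lemma root2_inv : (2 + root2)^-1 = (2 - root2) / 2.
Proof.
have n0 : 2 + root2 != 0 by rewrite gt_eqF // addr_gt0 // root2_gt0.
by apply: (mulfI n0); rewrite divff //; have := root2_sq; lra.
Qed.

Lemma root2_sigma8 : root2 < sigma8.
Proof. by rewrite ltr_sqrt; have := root2_gt0; lra. Qed.

Lemma zeta8_sq : zeta8 ^+ 2 = sigma8 - root2.
Proof. by rewrite sqr_sqrtr // subr_ge0 ltW // root2_sigma8. Qed.

Lemma zeta8_gt0 : 0 < zeta8.
Proof. by rewrite sqrtr_gt0 subr_gt0 root2_sigma8. Qed.

Lemma inb_root2 k : (0 <= k)%ZZ -> inb (root2_ball k) (pw k * root2).
Proof.
move=> k0; apply: inb_sqrt => //; last by rewrite -ZR2; exact: inb_int.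
by rewrite /bint /= Z.sub_0_r; apply/Z.shiftl_nonneg.
Qed.

Lemma inb_sigma8 k : (0 <= k)%ZZ -> bnonneg (badd (bint k 2) (root2_ball k)) ->
  inb (sigma8_ball k) (pw k * sigma8).
Proof.
move=> k0 /bnonnegP b0; apply: inb_sqrt => //; rewrite mulrDr.
by apply: inb_add; [rewrite -ZR2; exact: inb_int|exact: inb_root2].
Qed.

Lemma rupert_octagon k f vs c : (0 <= k)%ZZ -> bnonneg (badd (bint k 2) (root2_ball k)) ->
  bnonneg (zeta8_square k) -> similarity f -> check k (root2_ball k) (octagon_balls k) vs c ->
  Rupert (f @` hull [set` map (evp root2 [:: 1; sigma8; zeta8]) vs]).
Proof.
move=> k0 b0 b1 sf; apply: (check_rupert k0 (inb_root2 k0) _ sf).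
split=> // -[|[|[|//]]] _; [exact: (inb_one R k0)|exact: (inb_sigma8 k0 b0)|].
apply: inb_sqrt => //; first exact: bnonnegP.
rewrite mulrBr; apply: inb_add; first exact: inb_sigma8.
by apply/inb_opp/inb_root2.
Qed.

Lemma ev_root2 z : ev (root2_mul z) = root2 * ev z.
Proof.
case: z => a b; have h := root2_sq.
have -> : ev (root2_mul (a, b)) = 2 * ZR R b + ZR R a * root2.
  by have := ZRM R 2 b; rewrite ZR2 => <-.
by rewrite -{1}h /evz /=; ring.
Qed.

Lemma evo_add u v : evo (vadd u v) = evo u + evo v.
Proof. by apply: pt_eq; rewrite !mxE /= /evz /= !ZRD; ring. Qed.

Lemma evo_opp u : evo (vopp u) = - evo u.
Proof. by apply: pt_eq; rewrite !mxE /= /evz /= !ZRN; ring. Qed.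

Lemma evo_root2 u : evo (vroot2 u) = root2 *: evo u.
Proof. by apply: pt_eq; rewrite !mxE /= ev_root2. Qed.

Lemma evo_shrink u : evo (vshrink u) = (2 - root2) *: evo u.
Proof.
rewrite /vshrink /vsub 2!evo_add evo_opp evo_root2; move: (evo u) => x.
by apply: pt_eq; rewrite !mxE; ring.
Qed.

Lemma evo_up z : evo (vup z) = (ev z / 2) *: evo (vup (2, 0)%ZZ).
Proof.
have e2 : ev (2, 0)%ZZ = 2 by rewrite /evz /= ZR0 mul0r addr0.
by apply: pt_eq; rewrite !mxE /= ?e2 ?[evz _ (0%ZZ, 0%ZZ)]/evz /= ?ZR0 ?mul0r ?addr0 ?mulr0 //; field.
Qed.

End Octagon.

Section J45.
Variable R : realType.
Local Notation pt := 'cV[R]_3.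
Local Notation root2 := (root2 R).
Local Notation sigma := (sigma8 R).
Local Notation zeta := (zeta8 R).
Local Notation ev := (evz root2).
Local Notation evo := (evo R).
Local Notation o_ := (fun j => evo (cyc octagon j)).
Local Notation up := (evo (vup (2, 0)%ZZ)).
Implicit Types (M : 'M[R]_3) (c : pt) (p q b t : nat -> pt).

Definition position8 (v : cpt) : pt := 2^-1 *: evp root2 [:: 1; sigma; zeta] v.

Lemma octagon_rec j : o_ j.+2 = root2 *: o_ j.+1 - o_ j.
Proof.
have mod8 i : cyc octagon (j + i) = cyc octagon (j %% 8 + i) by rewrite /cyc modnDml.
have H : all (fun j => cyc octagon j.+2 == vsub (vroot2 (cyc octagon j.+1)) (cyc octagon j))
  (iota 0 8) by vm_compute.
have := seq.allP H (j %% 8)%N; rewrite mem_iota ltn_mod => /(_ isT)/eqP.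
have := mod8 0%N; have := mod8 1%N; have := mod8 2%N.
rewrite !addn0 !addn1 !addn2 => -> -> ->.
by move=> ->; rewrite evo_add evo_opp evo_root2.
Qed.

(** The frame consists of the first vertex, of the second one made orthogonal to it,
    and of e; the recurrence carries the equation for two vertices to all. *)
Lemma octagon_frame r c p e : ngon root2 r c p -> dot e e = zeta ^+ 2 * r ->
  (forall i, dot e (p i - c) = 0) ->
  exists M k, let f := fun x : pt => c + M *m x in
  [/\ 0 < k /\ (forall x y : pt, dot (M *m x) (M *m y) = k * dot x y), similarity f,
      forall j, p j = f (o_ j) & e = - zeta *: (M *m up)].
Proof.
move=> [r0 prec psq pnext] ee ep.
pose l := Num.sqrt r.
have l0 : 0 < l by rewrite sqrtr_gt0.
have ln : l != 0 by rewrite gt_eqF.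
have lr : l ^+ 2 = r by rewrite sqr_sqrtr // ltW.
have zn : zeta != 0 by rewrite gt_eqF // zeta8_gt0.
have h2 := root2_sq R.
pose u := l^-1 *: (p 0%N - c); pose v := l^-1 *: (root2 *: (p 1%N - c) - (p 0%N - c)).
pose w := - (zeta * l)^-1 *: e.
have uu : dot u u = 1.
  by rewrite /u dotZl dotZr psq -lr; field.
have vv : dot v v = 1.
  have s0 := psq 0%N; have s1 := psq 1%N; have n0 := pnext 0%N.
  rewrite /v; move: (p 0%N - c) (p 1%N - c) s0 s1 n0 => x y s0 s1 n0.
  rewrite !dotL (dotC y x) s0 s1 n0.
  transitivity ((root2 ^+ 2 * r - root2 ^+ 2 * r + r) / l ^+ 2); first by field.
  by rewrite subrr add0r lr divff // gt_eqF.
have uv : dot u v = 0.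
  have s0 := psq 0%N; have n0 := pnext 0%N.
  rewrite /u /v; move: (p 0%N - c) (p 1%N - c) s0 n0 => x y s0 n0.
  rewrite !dotL s0 n0.
  transitivity ((root2 ^+ 2 - 2) * r / (2 * l ^+ 2)); first by field.
  by rewrite h2 subrr !mul0r.
have ww : dot w w = 1.
  by rewrite /w dotZl dotZr ee -lr; field; rewrite ln.
have wu : dot w u = 0 by rewrite /w /u dotZl dotZr ep !mulr0.
have wv : dot w v = 0.
  by rewrite /w /v dotZl dotZr dotDr dotNr dotZr !ep !mulr0 subrr !mulr0.
pose g (x : pt) := x i0 0 *: u + x i1 0 *: v + x i2 0 *: w.
have sg : similarity g.
  apply: isometry_similarity => [a x y|x y]; first by apply: pt_eq; rewrite !mxE; ring.
  rewrite /g; clearbody u v w; rewrite !dotL (dotC v u) (dotC u w) (dotC v w) uu vv ww uv wu wv.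
  by rewrite dotE; ring.
have sh : similarity (fun x : pt => c + (l / 2) *: x).
  exists (l / 2), 1%:M, c; split; first by rewrite divr_gt0.
    by rewrite trmx1 mul1mx.
  by move=> x; rewrite mul1mx.
have sf := similarity_comp sh sg.
set f := (X in similarity X) in sf.
have [M [k [k0 fE Mk]]] := similarity_matrix sf.
have g0 : g 0 = 0 by rewrite /g !mxE !scale0r !addr0.
have f0 : f 0 = c by rewrite /f /= g0 scaler0 addr0.
rewrite f0 in fE.
have ME x : M *m x = (l / 2) *: g x by apply: (addrI c); rewrite -fE.
have e2 : ev (2, 0)%ZZ = 2 by rewrite /evz /= ZR0 mul0r addr0.
have e1 : ev (0, 1)%ZZ = root2 by rewrite /evz /= ZR0 ZR1 add0r mul1r.
have e0 : ev (0, 0)%ZZ = 0 by rewrite /evz /= ZR0 add0r mul0r.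
exists M, k; split=> //.
- by have <- : f = (fun x => c + M *m x) by apply: funext.
- move=> j; have [] : p j = c + M *m o_ j /\ p j.+1 = c + M *m o_ j.+1; last by [].
  elim: j => [|j [IH1 IH2]].
    split; rewrite ME /g !mxE /= ?e2 ?e1 ?e0 scale0r addr0.
      by rewrite scale0r addr0 scalerA divfK // /u scalerA divff // scale1r [c + _]addrC subrK.
    rewrite -scalerDr scalerA /u /v -scalerDr [p 0%N - c + _]addrC subrK !scalerA.
    rewrite (_ : l / 2 * root2 / l * root2 = 1) ?scale1r; first by rewrite [c + _]addrC subrK.
    have -> : l / 2 * root2 / l * root2 = root2 ^+ 2 / 2 by field.
    by rewrite h2 divff.
  split=> //; rewrite -[LHS](subrK c) prec IH1 IH2 addrC octagon_rec.
  by rewrite mulmxDr mulmxN -scalemxAr ![c + _]addrC !addrK addrC.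
rewrite ME /g !mxE /= e0 e2 !scale0r !add0r /w !scalerA.
by rewrite -[LHS]scale1r; congr (_ *: _); field; rewrite ?zn ?ln.
Qed.

Lemma base_position j : position8 (base_vertex j) = o_ j.
Proof.
rewrite /position8.
have -> : evp root2 [:: 1; sigma; zeta] (base_vertex j) = evo (vadd (cyc octagon j) (cyc octagon j)).
  by apply: pt_eq; rewrite !mxE /=; ring.
rewrite evo_add; move: (evo _) => x.
by apply: pt_eq; rewrite !mxE; field.
Qed.

Lemma octagon_layers (s t : R) u v w :
  evp root2 [:: 1; s; t] (layers [:: u; v; w]) = evo u + s *: evo v + t *: evo w.
Proof. by apply: pt_eq; rewrite !mxE /=; ring. Qed.

Lemma evo0 : evo vzero = 0.
Proof. by apply: pt_eq; rewrite !mxE /= /evz /= ZR0; ring. Qed.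

Lemma up_values : [/\ ev (-4, 0)%ZZ = - 4, ev (4, -2)%ZZ = 4 - 2 * root2 &
  ev (-4, 2)%ZZ = - 4 + 2 * root2].
Proof.
split; rewrite /evz /=.
- by rewrite (ZRN R 4) ZR0 mul0r addr0.
- by rewrite (ZRN R 2) ZR2 mulNr.
- by rewrite (ZRN R 4) ZR2.
Qed.

Lemma second_position j : position8 (second_vertex j) =
  sigma^-1 *: (o_ j + o_ j.+1) - zeta *: up.
Proof.
have [e1 _ _] := up_values.
rewrite /position8 octagon_layers evo0 add0r evo_shrink evo_add evo_up e1 sigma8_inv.
by move: (evo _) (evo _) (evo _) => x y z; apply: pt_eq; rewrite !mxE; field.
Qed.

Lemma upper_position j : position8 (upper_vertex j) =
  (2 + root2)^-1 *: (o_ j + o_ j.+1) + sigma^-1 *: up.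
Proof.
have [_ e1 _] := up_values.
rewrite /position8.
have -> : evp root2 [:: 1; sigma; zeta] (upper_vertex j) =
    evo (vshrink (vadd (cyc octagon j) (cyc octagon j.+1))) + sigma *: evo (vup (4, -2)%ZZ).
  by apply: pt_eq; rewrite !mxE /=; ring.
rewrite evo_shrink evo_add evo_up e1 root2_inv sigma8_inv.
by move: (evo _) (evo _) (evo _) => x y z; apply: pt_eq; rewrite !mxE; field.
Qed.

Lemma lower_position j : position8 (lower_vertex j) =
  sigma^-1 *: o_ j.+1 - (zeta + sigma^-1) *: up.
Proof.
have [e1 _ e2] := up_values.
rewrite /position8 octagon_layers evo0 add0r (evo_add R (vshrink _)) evo_shrink (evo_up R (-4, 2)%ZZ) (evo_up R (-4, 0)%ZZ) e1 e2 sigma8_inv.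
by move: (evo _) (evo _) => x y; apply: pt_eq; rewrite !mxE; field.
Qed.

Lemma octagon_mod j : cyc octagon (j %% 8) = cyc octagon j /\
  cyc octagon (j %% 8).+1 = cyc octagon j.+1.
Proof. by rewrite cyc_mod // cyc_modS. Qed.

Lemma J45_set s1 s2 : [set` map position8 (J45_vertices s1 s2)] =
  range o_ `|` (range (fun j => sigma^-1 *: (o_ j + o_ j.+1) - zeta *: up) `|`
  ([set x | exists2 j, odd j = s1 & x = (2 + root2)^-1 *: (o_ j + o_ j.+1) + sigma^-1 *: up] `|`
   [set x | exists2 j, odd j = s2 & x = sigma^-1 *: o_ j.+1 - (zeta + sigma^-1) *: up])).
Proof.
have cls F (G : nat -> pt) s : (forall j, F j = F (j %% 8)%N) -> (forall j, position8 (F j) = G j) ->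
    [set x | exists2 j, odd j = s & x = G j] = [set` map position8 [seq F j | j <- iota 0 8 & odd j == s]].
  move=> FE FG; rewrite -(range_mod position8 (F := F) (P := fun j => odd j == s)) //.
    by apply/seteqP; split=> x [j js ->]; exists j; rewrite ?FG //; apply/eqP.
  by move=> j; rewrite odd_mod.
have full F (G : nat -> pt) : (forall j, F j = F (j %% 8)%N) -> (forall j, position8 (F j) = G j) ->
    range G = [set` map position8 [seq F j | j <- iota 0 8]].
  move=> FE FG; rewrite -(range_mod_full position8 (F := F)) //.
  by congr (_ @` _); apply: funext => j; rewrite FG.
rewrite 3!map_cat_set; congr (_ `|` (_ `|` (_ `|` _))); apply/esym.
- apply: full => j; last exact: base_position.
  by have [e1 e2] := octagon_mod j; rewrite /base_vertex e1.
- apply: full => j; last exact: second_position.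
  by have [e1 e2] := octagon_mod j; rewrite /second_vertex e1 e2.
- apply: cls => j; last exact: upper_position.
  by have [e1 e2] := octagon_mod j; rewrite /upper_vertex e1 e2.
- apply: cls => j; last exact: lower_position.
  by have [e1 e2] := octagon_mod j; rewrite /lower_vertex e2.
Qed.

Lemma octagon_antipode : o_ 0 + o_ 4 = 0.
Proof.
have Z : vadd (cyc octagon 0) (cyc octagon 4) = vzero by vm_compute.
by rewrite -evo_add Z evo0.
Qed.

Lemma up_sq : dot up up = 4.
Proof. by rewrite dotE !mxE /= /evz /= ZR0 ZR2; ring. Qed.

Lemma octagon_sq : dot (o_ 0) (o_ 0) = 4.
Proof. by rewrite dotE !mxE /= /evz /= ZR0 ZR2; ring. Qed.

(** The frame is chosen with the second base below the first, so the cupola on the first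
    base is above it, and the cupola on the second one below it. *)
Lemma J45_rupert (P : set pt) : J45 P -> Rupert P.
Proof.
move=> [p [q [b1 [t1 [b2 [t2 [apq [cup1 bp1 att1] [cup2 bp2 att2] [PE cP]]]]]]]].
have [rp rq _ _] := apq; have [rb1 _ _ _] := cup1; have [rb2 _ _ _] := cup2.
have gE : gam R 4.*2 = root2 by exact: gam8.
have g0 : 0 < gam R 4.*2 by rewrite gE root2_gt0.
have g3 : gam R 4.*2 ^+ 2 < 3 by rewrite gE root2_sq; lra.
have [c [r pn]] := regular_ngon (isT : (0 < 8)%N) rp.
have [e [ee ep qE]] := antiprism_vertices (isT : (1 < 4)%N) g0 pn apq.
have pn' := pn; rewrite -[8%N]/4.*2 gE in pn'.
rewrite gE -/sigma -zeta8_sq in ee.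
have [M [k [[k0 Mk] simf pE eE]]] := octagon_frame pn' ee ep.
set f := (fun x : pt => c + M *m x) in simf pE.
have f0 : f 0 = c by rewrite /f mulmx0 addr0.
have pc j : p j - c = M *m o_ j by rewrite pE /f addrAC subrr add0r.
have rE : r = k * 4 by rewrite -(ngon_sq pn 0) pc Mk octagon_sq.
have nup : M *m up != 0.
  by apply: (frame_neq0 k0 Mk); rewrite -dot_eq0 up_sq pnatr_eq0.
have s0 : sigma != 0 by rewrite gt_eqF // sigma8_gt0.
have z0 := zeta8_gt0 R.
have en : e != 0 by rewrite eE scaler_eq0 negb_or nup andbT oppr_eq0 gt_eqF.
rewrite gE -/sigma in qE.
have s1 : sigma^-1 ^+ 2 * (2 + root2) = 1.
  by rewrite -sigma8_sq -exprMn mulVf ?expr1n.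
have qn : ngon (gam R 4.*2) r (c + e) q.
  rewrite gE (funext qE : q = _); exact: (antiprism_base e pn' s1).
have qc j : q j - (c + e) = sigma^-1 *: (M *m (o_ j + o_ j.+1)).
  by rewrite qE !pc -mulmxDr; move: (M *m _) => x; apply: pt_eq; rewrite !mxE; ring.
have bp1' : range b1 = range p.
  by have [? [? bn]] := regular_ngon (isT : (0 < 8)%N) rb1; exact: polygon_range bn pn bp1.
have bp2' : range b2 = range q.
  by have [? [? bn]] := regular_ngon (isT : (0 < 8)%N) rb2; exact: polygon_range bn qn bp2.
rewrite -bp1 in att1; rewrite -bp2 in att2.
have height x l : x = l *: (M *m up) -> 0 < l ->
    dot x x * (2 + root2) = (3 - root2 ^+ 2) * r -> x = sigma^-1 *: (M *m up).
  move=> xE l0 xx; rewrite -[RHS]opprK -scalerN -scaleNr.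
  apply: (@ray_length _ _ _ l) => //.
  - by rewrite xE scaleNr scalerN opprK.
  - by rewrite invr_ge0 ltW // sigma8_gt0.
  - by rewrite oppr_eq0.
  have r2 : 2 + root2 != 0 by rewrite -sigma8_sq expf_neq0.
  apply: (mulIf r2); rewrite xx dotNl dotNr opprK mulrAC s1 Mk up_sq rE root2_sq.
  by rewrite mul1r (_ : 3 - 2 = 1) ?mul1r //; ring.
have [||||e1 [p1 [[l1 l1p e1E] ee1 t1E _]]] :=
    cupola_glued (x := e) (x1 := sigma^-1 *: ((p 0%N - c) + (p 1%N - c)))
      (isT : (1 < 4)%N) g0 g3 cup1 rp pn bp1' att1.
- by move=> w wp; rewrite dotZr dotDr !wp addr0 mulr0.
- by rewrite -qE; apply: sub_chull; right; exists 0%N.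
- exact: ep.
- exact: en.
have [||||e2 [p2 [[l2 l2p e2E] ee2 t2E _]]] :=
    cupola_glued (x := - e) (x1 := 0) (isT : (1 < 4)%N) g0 g3 cup2 rq qn bp2' att2.
- by move=> w _; rewrite dot0r.
- rewrite addr0 addrK -f0; apply: (midpoint simf octagon_antipode).
    by left; exists 0%N.
  by left; exists 4%N.
- by move=> i; rewrite qc dotNl dotZr mulmxDr -!pc dotDr !ep addr0 mulr0 oppr0.
- by rewrite oppr_eq0.
rewrite gE in ee1 ee2.
have {}e1E : e1 = sigma^-1 *: (M *m up).
  apply: (height _ (l1 * zeta)) => //; last by rewrite mulr_gt0.
  by rewrite e1E eE scalerA mulrNN.
have {}e2E : e2 = - sigma^-1 *: (M *m up).
  rewrite -[e2]opprK [- e2](height _ (l2 * zeta)) ?scaleNr //.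
  - by rewrite e2E eE; move: (M *m up) => x; apply: pt_eq; rewrite !mxE; ring.
  - by rewrite mulr_gt0.
  - by rewrite dotNl dotNr opprK.
have -> : P = f @` hull [set` map position8 (J45_vertices p1 p2)].
  rewrite image_chull; last exact: similarity_affine.
  have VE : f @` [set` map position8 (J45_vertices p1 p2)] =
      range p `|` (range q `|` (range t1 `|` range t2)).
    rewrite J45_set !image_setU; congr (_ `|` (_ `|` (_ `|` _))).
    - by rewrite image_comp; congr (_ @` _); apply: funext => j; rewrite pE.
    - rewrite image_comp; congr (_ @` _); apply: funext => j.
      rewrite /= qE !pc eE /f -mulmxDr mulmxBr -!scalemxAr scaleNr addrA //.
    - rewrite t1E gE e1E; have E j : c + (2 + root2)^-1 *: ((p j - c) + (p j.+1 - c)) +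
          sigma^-1 *: (M *m up) = f ((2 + root2)^-1 *: (o_ j + o_ j.+1) + sigma^-1 *: up).
        by rewrite !pc /f -mulmxDr [in RHS]mulmxDr -!scalemxAr addrA.
      apply/seteqP; split=> x.
        by move=> [_ [j jp ->] <-]; exists j => //; rewrite E.
      by move=> [j jp ->]; rewrite E; eexists; last reflexivity; exists j.
    rewrite t2E gE e2E; have E j : c + e + (2 + root2)^-1 *: ((q j - (c + e)) + (q j.+1 - (c + e))) -
        sigma^-1 *: (M *m up) = f (sigma^-1 *: o_ j.+1 - (zeta + sigma^-1) *: up).
      have r2 : 2 + root2 != 0 by rewrite -sigma8_sq expf_neq0.
      rewrite !qc eE -scalerDr -mulmxDr.
      have -> : o_ j + o_ j.+1 + (o_ j.+1 + o_ j.+2) = (2 + root2) *: o_ j.+1.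
        rewrite octagon_rec; move: (evo _) (evo _) => u v.
        by apply: pt_eq; rewrite !mxE; ring.
      rewrite /f mulmxBr -!scalemxAr; move: (M *m _) (M *m _) => u v.
      by apply: pt_eq; rewrite !mxE; field; rewrite ?r2 ?s0.
    apply/seteqP; split=> x.
      by move=> [_ [j jp ->] <-]; exists j => //; rewrite -E scaleNr.
    by move=> [j jp ->]; rewrite scaleNr E; eexists; last reflexivity; exists j.
  apply: hull_pieces => //; rewrite VE PE.
  - move=> x [xp|[xq|[xt|xt]]].
    + by left; left; apply: sub_chull; left.
    + by left; left; apply: sub_chull; right.
    + by left; right; apply: sub_chull; right.
    + by right; apply: sub_chull; right.
  - move=> x [[|]|]; apply: chull_sub.
    + by move=> y [yp|yq]; [left|right; left].
    + by rewrite bp1' => y [yp|yt]; [left|right; right; left].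
    + by rewrite bp2' => y [yp|yt]; [right; left|right; right; right].
have [crt h] := J45_check p1 p2.
rewrite hull_scaled; apply: (rupert_octagon (k := 28)) h => //.
by apply: similarity_comp simf (similarity_scale _); rewrite invr_gt0.
Qed.

End J45.

(** * The triaugmented truncated dodecahedron *)

(** Also multiplied by five; the tops lie over the edges of even index, because the
    squares stand on those of odd index. *)
Definition decagon_top (j : nat) : vphi :=
  let x k := vsub (cyc decagon k) decagon_centre in
  vadd (vadd (vscale (5, 0)%ZZ decagon_centre) (vscale (3, -1)%ZZ (vadd (x j) (x j.+1))))
    (vscale (-8, 6)%ZZ axis).
Definition decagon_tops : seq vphi := [seq decagon_top j | j <- iota 0 10 & ~~ odd j].

Definition J71_vertices (gs : seq sym) : seq cpt :=
  [seq layers [:: vscale (5, 0)%ZZ v] | v <- truncated_dodecahedron_list] ++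
  [seq layers [:: act g x] | g <- gs, x <- decagon_tops].

Definition sym1 : sym := ((false, 0), (true, 1), (false, 2))%N.
Definition sym2 : sym := ((true, 2), (false, 0), (true, 1))%N.
Definition sym3 : sym := ((false, 1), (true, 2), (false, 0))%N.

Definition far_triples : seq (seq sym) := [:: [:: sid; sym1; sym2]; [:: sid; sym2; sym3]].

Lemma J71_check gs : gs \in far_triples -> exists c,
  check 28 (golden_ball 28) [:: bint 28 1] (J71_vertices gs) c.
Proof.
rewrite !inE => /orP[] /eqP ->.
- exists (Certificate (-5804, -1005, 3971, -4080)%ZZ (-3992, -3757, 5881, -1573)%ZZ 52 (39267905, -56701409)%ZZ
    [:: 64; 63; 12; 0; 6; 18; 42; 68; 69; 65; 4; 10; 34; 58; 57; 71; 70; 74; 51; 55; 31; 7; 60]%N).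
  by vm_compute.
exists (Certificate (-617, -2358, -7426, 2455)%ZZ (-5215, 3053, 461, -5512)%ZZ 52 (39112789, -56824240)%ZZ
    [:: 62; 61; 19; 31; 55; 47; 23; 68; 67; 66; 57; 33; 21; 45; 52; 72; 73; 74; 26; 14; 38; 36; 63]%N).
by vm_compute.
Qed.

(** The images of the axis have scalar products 2 + phi, phi, - phi and - 2 - phi with each
    other; the first means equal faces and the second adjacent ones. *)
Definition far (u v : vphi) : bool := vdot u v \in [:: (0, -1); (-2, -1)]%ZZ.

Definition normals : seq vphi := undup [seq act g axis | g <- syms].

Lemma normals_mem g : g \in syms -> act g axis \in normals.
Proof. by move=> gs; rewrite mem_undup; apply: (map_f (fun g => act g axis)). Qed.

Lemma near_edges : all (fun h => far axis (act h axis) || has (fun i => has (fun j =>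
    let e k := (cyc decagon k, cyc decagon k.+1) in
    let e' k := (act h (cyc decagon k), act h (cyc decagon k.+1)) in
    (e i == e' j) || (e i == ((e' j).2, (e' j).1))) (iota 0 10)) (iota 0 10)) syms.
Proof. by vm_compute. Qed.

(** There are twenty triples of pairwise far normals, in two orbits. *)
Lemma far_orbits : all (fun a => all (fun b => if far a b then all (fun c =>
    if far a c then if far b c then
      has (fun u => has (fun gs => let ns := [seq act (scomp u g) axis | g <- gs] in
        all (mem ns) [:: a; b; c] && all (mem [:: a; b; c]) ns) far_triples) syms
    else true else true) normals else true) normals) normals.
Proof. by vm_compute. Qed.

(** A symmetry that fixes the plane of a decagon keeps the parity of its edges. *)
Lemma tops_stable : all (fun h => if act h axis == axis
  then all (fun v => act h v \in decagon_tops) decagon_tops else true) syms.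
Proof. by vm_compute. Qed.

Lemma normals_quotient : all (fun g => all (fun h => let gh := scomp (sinv_in g) h in
    (far axis (act gh axis) ==> far (act g axis) (act h axis)) &&
    ((act g axis == act h axis) ==> (act gh axis == axis))) syms) syms.
Proof. by vm_compute. Qed.

Lemma decagon_axis_orth : all (fun v => vdot axis (vsub v decagon_centre) == (0, 0)%ZZ) decagon.
Proof. by vm_compute. Qed.

Lemma top_mod j : decagon_top (j %% 10) = decagon_top j.
Proof. by rewrite /decagon_top cyc_mod // cyc_modS. Qed.

Section J71.
Variable R : realType.
Local Notation pt := 'cV[R]_3.
Local Notation phi := (golden R).
Local Notation ev := (evz phi).
Local Notation evv := (evv R).
Local Notation evvs := (@evvs R).
Local Notation d_ := (fun j => evv (cyc decagon j)).
Local Notation c0 := (evv decagon_centre).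
Local Notation ax := (evv axis).
Local Notation td := (evvs truncated_dodecahedron_list).
Implicit Types (M : 'M[R]_3) (c : pt) (p q b t : nat -> pt).

Definition tops : set pt := [set 5^-1 *: x | x in evvs decagon_tops].
Definition tops_of (L : seq sym) : set pt := [set x | exists2 g, g \in L & (spt g @` tops) x].

Lemma tops_same g h : g \in syms -> h \in syms -> act g axis = act h axis ->
  spt h @` tops `<=` spt g @` tops.
Proof.
move=> gs hs gh _ [_ [_ /evvsP[v vT ->] <-] <-].
have /andP[_] := seq.allP (seq.allP normals_quotient g gs) h hs.
rewrite gh eqxx /= => E.
have [is1 _] := sinvP gs.
have := seq.allP tops_stable _ (scomp_in is1 hs); rewrite E => /seq.allP/(_ _ vT) vT'.
exists (5^-1 *: evv (act (scomp (sinv_in g) h) v)).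
  by exists (evv (act (scomp (sinv_in g) h) v)) => //; apply/evvsP; exists (act (scomp (sinv_in g) h) v).
by rewrite -spt_evv spt_comp -sptZ (sptK R gs).2 sptZ.
Qed.

Lemma tops_of_sub L L' : {subset L <= syms} -> {subset L' <= syms} ->
  (forall g, g \in L -> act g axis \in [seq act h axis | h <- L']) -> tops_of L `<=` tops_of L'.
Proof.
move=> Ls Ls' LL x [g gL xg]; have /mapP[h hL gh] := LL g gL.
by exists h => //; apply: tops_same xg; [exact: Ls'|exact: Ls|exact/esym].
Qed.

Lemma top_height : (2 * (3 * phi - 4) / 5) ^+ 2 * (2 + phi) * (2 + phi) = (3 - phi ^+ 2) * 4.
Proof.
have h := golden_sq R.
have e1 : (2 + phi) * (2 + phi) = 5 * phi ^+ 2 by lra.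
have e2 : (3 * phi - 4) ^+ 2 = 5 * (5 - 3 * phi) by lra.
have -> : (2 * (3 * phi - 4) / 5) ^+ 2 * (2 + phi) * (2 + phi) =
    4 / 25 * (3 * phi - 4) ^+ 2 * ((2 + phi) * (2 + phi)) by field.
rewrite e1 e2.
have -> : 4 / 25 * (5 * (5 - 3 * phi)) * (5 * phi ^+ 2) = 4 * (5 * phi ^+ 2 - 3 * phi * phi ^+ 2) by field.
by rewrite h; lra.
Qed.

Lemma decagon_topE j : 5^-1 *: evv (decagon_top j) = c0 +
  ((2 + phi)^-1 *: ((d_ j - c0) + (d_ j.+1 - c0)) + (2 * (3 * phi - 4) / 5) *: ax).
Proof.
have h := golden_sq R; have g1 := golden_gt0 R.
have n0 : 2 + phi != 0 by rewrite gt_eqF // addr_gt0.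
have -> : (2 + phi)^-1 = (3 - phi) / 5.
  by apply: (mulfI n0); rewrite divff //; lra.
have -> : evv (decagon_top j) = ev (5, 0)%ZZ *: c0 +
    ev (3, -1)%ZZ *: ((d_ j - c0) + (d_ j.+1 - c0)) + ev (-8, 6)%ZZ *: ax.
  by rewrite -!evv_sub -evv_add -!evv_scale -!evv_add.
have -> : ev (5, 0)%ZZ = 5 by rewrite /evz /= ZR0 mul0r addr0.
have -> : ev (3, -1)%ZZ = 3 - phi by rewrite /evz /= (ZRN R 1) ZR1 mulN1r.
have -> : ev (-8, 6)%ZZ = - 8 + 6 * phi by rewrite /evz /= (ZRN R 8).
move: (d_ j - c0) (d_ j.+1 - c0) => x y; move: c0 ax => z u.
by apply: pt_eq; rewrite !mxE; field.
Qed.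

Lemma axis_decagon j : dot ax (d_ j - c0) = 0.
Proof.
have : evvs decagon (d_ j) by rewrite -cyc_range //; exists j.
move=> /evvsP[v vE ->]; rewrite -evv_sub dot_evv.
by rewrite (eqP (seq.allP decagon_axis_orth v vE)) /evz /= ZR0 mul0r addr0.
Qed.

(** The centre of the dodecahedron shows on which side of the face it lies, and
    [decagon_triangle_edge] gives the parity of the squares. *)
Lemma cupola_on_dodecahedron f b t : similarity f -> cupola 5 b t ->
  attached (solid b t) (f @` hull td) (polygon b) ->
  (exists z, equilateral (b 0%N) (b 1%N) z /\
     is_face (f @` hull td) (hull [set b 0%N; b 1%N; z])) ->
  exists g, [/\ g \in syms, range b = range (f \o spt g \o d_) &
    range t = f @` (spt g @` tops)].
Proof.
move=> simf cup att [z [eqz zF]]; have [rb _ _ _] := cup.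
have [w [a [w0 _ _ wT wF]]] := att.
have [g gs bE] : exists2 g, g \in syms & range b = range (f \o spt g \o d_).
  apply: (truncated_dodecahedron_face (gam10 R) (isT : (2 < 10)%N) simf rb (w := - w) (a := - a)).
  - by rewrite oppr_eq0.
  - by move=> x /wT; rewrite /= dotNl lerN2.
  - rewrite wF; congr (_ `&` _); apply/seteqP; split=> x /=; rewrite dotNl.
      by move=> ->.
    by move/oppr_inj.
exists g; split=> //.
have [M [k [k0 fE Mk]]] := similarity_matrix simf.
pose c := f (spt g c0); pose y := f \o spt g \o d_.
have fB u v : f u - f v = M *m (u - v).
  by rewrite fE (fE v) mulmxBr opprD addrACA subrr add0r.
have yc j : y j - c = M *m spt g (d_ j - c0) by rewrite fB -sptB.
have gE : gam R 5.*2 = phi by exact: gam10.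
have yn : ngon (gam R 5.*2) (k * ev (4, 0)%ZZ) c y.
  rewrite gE; apply: (ngon_similarity k0 fB) => //; last exact: (ngon_spt gs (decagon_ngon R)).
  by move=> s u v; rewrite mulmxDr -scalemxAr.
have ry : regular_polygon 5.*2 y by apply: (ngon_regular (isT : (2 < 10)%N)) yn.
have g0 : 0 < gam R 5.*2 by rewrite gE golden_gt0.
have g3 : gam R 5.*2 ^+ 2 < 3 by rewrite gE golden_sq_lt3.
have nax : M *m spt g ax != 0.
  by apply: (frame_neq0 k0 Mk); rewrite (spt_neq0 ax gs) axis_neq0.
have c0E : c0 = phi *: ax by rewrite evv_scale ev_golden.
have g1 := golden_gt0 R.
pose x := - phi *: (M *m spt g ax).
have [||||e [s [[l l0 el] ee tE sq]]] :=
    cupola_glued (x := x) (x1 := 0) (isT : (1 < 5)%N) g0 g3 cup ry yn bE att.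
- by move=> u _; rewrite dot0r.
- (* the centre of the dodecahedron *)
  have -> : c + 0 + x = f 0.
    by rewrite addr0 /c (fE (spt g c0)) c0E sptZ -scalemxAr /x scaleNr addrK.
  rewrite hullE image_chull; last exact: similarity_affine.
  have [u uT u0] : exists2 u, u \in truncated_dodecahedron_list & vopp u \in truncated_dodecahedron_list.
    by exists ((0, 0), (-1, 1), (2, 1))%ZZ.
  have uu : evv u + evv (vopp u) = 0 by rewrite evv_opp subrr.
  have tdE v : v \in truncated_dodecahedron_list -> (f @` td) (f (evv v)).
    by move=> vT; exists (evv v) => //; apply/evvsP; exists v; [exact: vT|exact: erefl].
  by apply: (midpoint simf uu); apply: tdE; [exact: uT|exact: u0].
- by move=> i; rewrite yc dotZl Mk spt_dot // axis_decagon !mulr0.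
- by rewrite scaler_eq0 negb_or nax andbT oppr_eq0 gt_eqF.
have s_even : s = false.
  have [j js je] := sq 0%N.
  have : odd j by apply: decagon_triangle_edge simf gs je eqz zF.
  by rewrite js => /negbTE.
pose mu := 2 * (3 * phi - 4) / 5 : R.
have mu0 : 0 <= mu by rewrite /mu; have := golden_lower R; lra.
have eE : e = mu *: (M *m spt g ax).
  rewrite -[RHS]opprK -scalerN -scaleNr.
  apply: (@ray_length _ _ _ (l * phi)) mu0 _ _.
  - by rewrite mulr_gt0.
  - by rewrite el /x; move: (M *m _) => v; apply: pt_eq; rewrite !mxE; ring.
  - by rewrite oppr_eq0.
  have n0 : 2 + phi != 0 by rewrite gt_eqF // addr_gt0.
  apply: (mulIf n0); rewrite gE in ee; rewrite ee dotNl dotNr opprK Mk spt_dot // axis_sq.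
  have -> : mu ^+ 2 * (k * (2 + phi)) * (2 + phi) = k * (mu ^+ 2 * (2 + phi) * (2 + phi)) by ring.
  rewrite top_height /evz /= ZR0 mul0r addr0 (_ : ZR R 4 = 4) //; ring.
have topE j : c + (2 + gam R 5.*2)^-1 *: ((y j - c) + (y j.+1 - c)) + e =
    f (spt g (5^-1 *: evv (decagon_top j))).
  have sD (u v : pt) : spt g (u + v) = spt g u + spt g v by rewrite -[u]scale1r spt_linear !scale1r.
  have fD (u v : pt) : f (u + v) = f u + M *m v by rewrite fE (fE u) mulmxDr addrA.
  rewrite (yc j) (yc j.+1) eE gE -addrA decagon_topE (sD c0) fD; congr (_ + _).
  by rewrite [in RHS]sD [in RHS]mulmxDr !sptZ -!scalemxAr (sD (d_ j - c0)) mulmxDr.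
rewrite tE s_even; apply/seteqP; split=> u.
  move=> [j jo ->]; rewrite topE; exists (spt g (5^-1 *: evv (decagon_top j))) => //.
  exists (5^-1 *: evv (decagon_top j)) => //; exists (evv (decagon_top j)) => //.
  apply/evvsP; exists (decagon_top (j %% 10)); last by rewrite top_mod.
  by apply: map_f; rewrite mem_filter odd_mod // jo mem_iota ltn_mod.
move=> [_ [_ [_ /evvsP[v + ->] <-] <-] <-] => /mapP[j]; rewrite mem_filter => /andP[jo _] ->.
by exists j; [exact: negbTE|rewrite topE].
Qed.

(** The edges of a decagon are determined by its set of vertices, and by [near_edges]
    decagons that are not far apart have a common edge. *)
Lemma decagons_far f g h b b' : similarity f -> g \in syms -> h \in syms ->
  regular_polygon 10 b -> regular_polygon 10 b' ->
  range b = range (f \o spt g \o d_) -> range b' = range (f \o spt h \o d_) ->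
  (forall i j, [set b i; b i.+1] <> [set b' j; b' j.+1]) ->
  far (act g axis) (act h axis).
Proof.
move=> simf gs hs rb rb' bE bE' nosh.
have ry g' : g' \in syms -> regular_polygon 10 (f \o spt g' \o d_).
  move=> gs'; apply: regular_similarity (decagon_regular R).
  by apply: similarity_comp simf (spt_similarity R gs').
have [s1 [_ h1]] := regular_edges (isT : (2 < 10)%N) (isT : ~~ odd 10) rb (ry _ gs) bE.
have [s2 [_ h2]] := regular_edges (isT : (2 < 10)%N) (isT : ~~ odd 10) rb' (ry _ hs) bE'.
have [is1 _] := sinvP gs.
have /andP[/implyP tr _] := seq.allP (seq.allP normals_quotient g gs) h hs.
have /orP[/tr //|] := seq.allP near_edges _ (scomp_in is1 hs).
move=> /seq.hasP[i _ /seq.hasP[j _ ij]]; exfalso.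
have E v : spt g (evv (act (scomp (sinv_in g) h) v)) = spt h (evv v).
  by rewrite -spt_evv spt_comp (sptK R gs).2.
have set2 (x y x' y' : pt) : same_edge x y x' y' -> [set x; y] = [set x'; y'].
  by case=> -[-> ->] //; rewrite setUC.
have [i' _ /set2 ei] := h1 i; have [j' _ /set2 ej] := h2 j.
apply: (nosh i' j'); rewrite ei ej; apply: set2.
by case/orP: ij => /eqP[/= e1 e2]; [left|right]; rewrite /= -!E -e1 -e2.
Qed.

Lemma far_triplesP gs : gs \in far_triples -> {subset gs <= syms}.
Proof.
move=> h; apply/seq.allP; move: gs h; apply/seq.allP.
by vm_compute.
Qed.

Lemma J71_set gs : [set` map (fun v => 5^-1 *: evp phi [:: 1] v) (J71_vertices gs)] =
  td `|` tops_of gs.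
Proof.
rewrite map_cat_set; congr (_ `|` _).
  have E : [seq 5^-1 *: evp phi [:: 1] (layers [:: vscale (5, 0)%ZZ v]) | v <- truncated_dodecahedron_list] =
      map evv truncated_dodecahedron_list.
    apply: eq_map => v; rewrite evp_layer evv_scale scalerA.
    rewrite (_ : ev (5, 0)%ZZ = 5); last by rewrite /evz /= ZR0 mul0r addr0.
    by rewrite mulVf ?scale1r // pnatr_eq0.
  by rewrite -map_comp /evvs -E.
apply/seteqP; split=> x.
  move=> /mapP[_ /allpairsP[[g v] [/= gg vT ->]] ->]; exists g => //.
  exists (5^-1 *: evv v); last by rewrite sptZ spt_evv evp_layer.
  by exists (evv v) => //; apply/evvsP; exists v.
move=> [g gg [_ [_ /evvsP[v vT ->] <-] <-]]; apply/mapP.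
exists (layers [:: act g v]); last by rewrite sptZ spt_evv evp_layer.
by apply/allpairsP; exists (g, v).
Qed.

(** The vertices of the tops depend only on the normals of the three decagons, and the
    triple of normals can be moved to one of two. *)
Lemma J71_rupert (P : set pt) : J71 P -> Rupert P.
Proof.
move=> [T [b [t [[f simf TE] cup squares noshare [PE cP]]]]].
rewrite truncated_dodecahedronE in TE; subst T.
have exG k : exists g, [/\ g \in syms, range (b k) = range (f \o spt g \o d_) &
    range (t k) = f @` (spt g @` tops)].
  by have [ck ak] := cup k; apply: cupola_on_dodecahedron simf ck ak (squares k 0%N).
have [G HG] := choice exG.
have Gs k : G k \in syms by case: (HG k).
have far2 k l : k != l -> far (act (G k) axis) (act (G l) axis).
  move=> kl; have [_ bk _] := HG k; have [_ bl _] := HG l.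
  have [[rk _ _ _] _] := cup k; have [[rl _ _ _] _] := cup l.
  exact: (decagons_far simf (Gs k) (Gs l) rk rl bk bl (noshare k l kl)).
have nm k := normals_mem (Gs k).
have := seq.allP (seq.allP far_orbits _ (nm i0)) _ (nm i1).
rewrite (far2 i0 i1 isT) => /seq.allP/(_ _ (nm i2)).
rewrite (far2 i0 i2 isT) (far2 i1 i2 isT) => /seq.hasP[u us /seq.hasP[gs gsF /andP[]]].
set L := [:: G i0; G i1; G i2]; set L' := [seq scomp u g | g <- gs].
move=> LL' LL; have gsS := far_triplesP gsF.
have LS : {subset L <= syms}.
  by apply/seq.allP; rewrite /L /all (Gs i0) (Gs i1) (Gs i2).
have LS' : {subset L' <= syms} by move=> g /mapP[h /gsS hs ->]; exact: scomp_in.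
have mapE : [seq act (scomp u g) axis | g <- gs] = [seq act h axis | h <- L'].
  by rewrite /L'; elim: (gs) => //= g gs' ->.
rewrite mapE in LL' LL.
have topsE : tops_of L = spt u @` tops_of gs.
  apply/seteqP; split.
    apply: subset_trans (tops_of_sub LS LS' _) _.
      by move=> g gL; apply: (seq.allP LL'); apply: (map_f (fun g => act g axis) gL).
    move=> x [_ /mapP[g gg ->] [y yT <-]]; exists (spt g y); last by rewrite spt_comp.
    by exists g => //; exists y.
  apply: subset_trans (tops_of_sub LS' LS _).
    move=> _ [x [g gg [y yT <-]] <-]; exists (scomp u g); first exact: map_f.
    by exists y => //; rewrite spt_comp.
  by move=> g gL; apply: (seq.allP LL); apply: (map_f (fun g => act g axis) gL).
have simu := similarity_comp simf (spt_similarity R us).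
have -> : P = (f \o spt u) @` hull (td `|` tops_of gs).
  rewrite image_chull; last exact: similarity_affine.
  have -> : (f \o spt u) @` (td `|` tops_of gs) = f @` td `|` f @` tops_of L.
    by rewrite topsE image_setU !image_comp -image_comp (syms_closedP R truncated_dodecahedron_closed us).
  have LE x : (f @` tops_of L) x <-> exists k, range (t k) x.
    split=> [[y [g gL yT] <-]|[k xt]].
      have [k gE] : exists k, g = G k.
        by move: gL; rewrite !inE => /or3P[] /eqP ->; eexists.
      by exists k; have [_ _ ->] := HG k; exists y => //; rewrite -gE.
    have [_ _ tE] := HG k; move: xt; rewrite tE => -[y yT <-]; exists y => //.
    exists (G k) => //; move: k {tE yT}; apply: forall_I3; rewrite !inE eqxx ?orbT //.
  rewrite image_chull in PE; last exact: similarity_affine.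
  apply: hull_pieces => //; rewrite PE.
  - move=> x [xT|/LE[k xt]]; first by left; apply: sub_chull.
    by right; exists k => //; apply: sub_chull; right.
  - move=> x [|[k _]]; first by apply: chull_sub => y; left.
    apply: chull_min; first exact: chull_convex.
    move=> y [yb|yt]; last by apply: sub_chull; right; apply/LE; exists k.
    move: yb; have [_ -> _] := HG k => -[j _ <-]; apply: sub_chull; left.
    rewrite -(syms_closedP R truncated_dodecahedron_closed (Gs k)) image_comp.
    exists (d_ j) => //; have : evvs decagon (d_ j) by rewrite -cyc_range //; exists j.
    move=> /evvsP[v vE ->]; apply/evvsP; exists v; last exact: erefl.
    have : all (mem truncated_dodecahedron_list) decagon by vm_compute.
    by move/seq.allP; apply.
have [crt ck] := J71_check gsF.
rewrite -J71_set hull_scaled; apply: (rupert_golden (k := 28)) ck => //.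
by apply: similarity_comp simu (similarity_scale _); rewrite invr_gt0.
Qed.

End J71.

Theorem mainTheorem2 (R : realType) :
  [/\ forall P : set 'cV[R]_3, J25 P -> Rupert P,
      forall P : set 'cV[R]_3, J45 P -> Rupert P,
      forall P : set 'cV[R]_3, J47 P -> Rupert P,
      forall P : set 'cV[R]_3, J71 P -> Rupert P &
      forall P : set 'cV[R]_3, J76 P -> Rupert P].
Proof.
split; [exact: J25_rupert|exact: J45_rupert|exact: J47_rupert|exact: J71_rupert|exact: J76_rupert].
Qed.
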